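(* Let $T>0$, let $\Omega\subset\mathbb{R}^d$ be compact, and let $W,\widehat W,V\in\mathcal{W}^{2,\infty}(\mathbb{R}^d)$ with $\operatorname{supp}W\subseteq\Omega$ and $\operatorname{supp}V\subseteq\Omega$. Let $\mu_0,\widehat\mu_0\in\mathcal{P}^2(\mathbb{R}^d)$ and let $\mu,\widehat\mu\in C([0,T],\mathcal{P}^2(\mathbb{R}^d))$ be solutions, with initial data $\mu_0$ and $\widehat\mu_0$ respectively, of $$\partial_t\mu=\nabla\cdot\big(\mu(\nabla W*\mu+\nabla V)\big),\qquad \partial_t\widehat\mu=\nabla\cdot\big(\widehat\mu(\nabla\widehat W*\widehat\mu+\nabla V)\big).$$ Then for every $t\in[0,T]$, $$d_2^2(\mu_t,\widehat\mu_t)\le C_1\,\tilde{\mathcal{E}}_\infty(\widehat W)+C_2\,d_2^2(\mu_0,\widehat\mu_0),$$ where $C_1$ and $C_2$ are non-negative constants depending on $T$ and on $L_W,L_{\widehat W},L_V$, the Lipschitz constants of $\nabla W$, $\nabla\widehat W$ and $\nabla V$, respectively.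
   Context: $\mathcal{P}^2(\mathbb{R}^d)$ is the space of Borel probability measures on $\mathbb{R}^d$ with finite second moment, and $d_2$ is the 2-Wasserstein distance, $d_2(\mu,\xi)=\big(\min_{\gamma\in\Pi(\mu,\xi)}\int|x-y|^2\,d\gamma(x,y)\big)^{1/2}$, with $\Pi(\mu,\xi)$ the set of couplings of $\mu$ and $\xi$. $C([0,T],\mathcal{P}^2(\mathbb{R}^d))$ is the set of curves continuous with respect to $d_2$; $\mu_t$ denotes the value at time $t$. $\mathcal{W}^{2,\infty}(\mathbb{R}^d)$ is the set of $b:\mathbb{R}^d\to\mathbb{R}$ with $\|b\|_\infty+\|\nabla b\|_\infty+\|\nabla^2 b\|_\infty<\infty$. Solutions are understood in the weak (distributional) sense, and $(\nabla W*\mu_t)(x)=\int_{\mathbb{R}^d}\nabla W(x-y)\,d\mu_t(y)$. The error functional, relative to $W$ and the curve $\mu$, is $$\tilde{\mathcal{E}}_\infty(\widehat W)=\frac1T\int_0^T\int_{\mathbb{R}^d}\big|(\nabla W*\mu_t)(x)-(\nabla\widehat W*\mu_t)(x)\big|^2\,d\mu_t(x)\,dt .$$ ''Constants depending on'' certain quantities means constants that are functions of those quantities only. *)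

(* Defs.v *)
From HB Require Import structures.
From mathcomp Require Import all_boot all_order all_algebra.
From mathcomp Require Import all_classical all_reals all_analysis.
Set Implicit Arguments.
Unset Strict Implicit.
Unset Printing Implicit Defensive.
Import Order.TTheory GRing.Theory Num.Theory.
Import numFieldNormedType.Exports.
Local Open Scope classical_set_scope.
Local Open Scope ring_scope.

(* The Borel sigma-algebra on R^n. *)
HB.instance Definition _ (R : realType) (n : nat) :=
  Measurable.copy 'rV[R]_n (g_sigma_algebraType (@open 'rV[R]_n)).

(* The library norm on 'rV[R]_n is the sup norm; all the norms below are
   Euclidean. *)
Definition sqnorm (R : realType) n (x : 'rV[R]_n) : R :=
  \sum_(i < n) x 0 i ^+ 2.

Definition enorm (R : realType) n (x : 'rV[R]_n) : R := Num.sqrt (sqnorm x).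

Definition partial (R : realType) n (i : 'I_n) (f : 'rV[R]_n -> R)
  (x : 'rV[R]_n) : R := 'D_(delta_mx 0 i) f x.

Definition grad (R : realType) n (f : 'rV[R]_n -> R) (x : 'rV[R]_n) :
  'rV[R]_n := \row_i partial i f x.

Definition supp (R : realType) n (f : 'rV[R]_n -> R) : set 'rV[R]_n :=
  closure [set x | f x != 0].

Fixpoint is_Ck (R : realType) n (k : nat) (f : 'rV[R]_n -> R) : Prop :=
  continuous f /\
  match k with
  | 0%N => True
  | k'.+1 => forall i : 'I_n,
      (forall x, derivable f x (delta_mx 0 i)) /\ is_Ck k' (partial i f)
  end.

(* f \in C_c^oo(R^n) *)
Definition test_function (R : realType) n (f : 'rV[R]_n -> R) : Prop :=
  (forall k, is_Ck k f) /\ compact (supp f).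

(* The point (t, x) of R^(1+n). *)
Definition cons_rV (R : realType) n (t : R) (x : 'rV[R]_n) : 'rV[R]_(1 + n) :=
  row_mx t%:M x.

(* The integral over R^n with respect to the n-dimensional Lebesgue measure,
   as an iterated integral; it is only applied to bounded Borel functions with
   compact support, for which the two agree by Fubini's theorem. *)
Fixpoint integral_rV (R : realType) n : ('rV[R]_n -> R) -> R :=
  match n with
  | 0%N => fun f => f 0
  | m.+1 => fun f =>
      \int[lebesgue_measure]_t (@integral_rV R m (fun x => f (cons_rV t x)))
  end.

Definition weak_partial (R : realType) n (i : 'I_n)
    (f g : 'rV[R]_n -> R) : Prop :=
  forall phi : 'rV[R]_n -> R, test_function phi ->
    integral_rV (fun x => f x * partial i phi x) =
    - integral_rV (fun x => g x * phi x).

(* An element of L^oo(R^n), through a representative that is bounded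
   everywhere. *)
Definition bounded_borel (R : realType) n (f : 'rV[R]_n -> R) : Prop :=
  measurable_fun setT f /\ exists M : R, forall x, `|f x| <= M.

(* The Sobolev space W^{2,oo}(R^n): f and its weak derivatives of order 1 and 2
   are in L^oo. A class in W^{2,oo} has a unique continuous representative, and
   f is this representative (it is then C^1, so that its pointwise gradient
   grad f is meaningful everywhere). *)
Definition sobolev2oo (R : realType) n (f : 'rV[R]_n -> R) : Prop :=
  continuous f /\ bounded_borel f /\
  exists (g : 'I_n -> 'rV[R]_n -> R) (h : 'I_n -> 'I_n -> 'rV[R]_n -> R),
    (forall i, bounded_borel (g i) /\ weak_partial i f (g i)) /\
    (forall i j, bounded_borel (h i j) /\ weak_partial j (g i) (h i j)).

(* The least Lipschitz constant of F (for a Lipschitz F; otherwise 0, by the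
   convention on the infimum of the empty set). *)
Definition lipschitz_constant (R : realType) n (F : 'rV[R]_n -> 'rV[R]_n) : R :=
  inf [set K : R | 0 <= K /\ forall x y, enorm (F x - F y) <= K * enorm (x - y)].

(* mu \in P^2(R^n) *)
Definition finite_second_moment (R : realType) n
    (mu : probability 'rV[R]_n R) : Prop :=
  (\int[mu]_x (sqnorm x)%:E < +oo)%E.

Definition coupling (R : realType) n (mu xi : probability 'rV[R]_n R)
    (gamma : probability ('rV[R]_n * 'rV[R]_n)%type R) : Prop :=
  forall A : set 'rV[R]_n, measurable A ->
    gamma (A `*` setT) = mu A /\ gamma (setT `*` A) = xi A.

Definition wasserstein2 (R : realType) n (mu xi : probability 'rV[R]_n R) :
    \bar R :=
  sqrte (ereal_inf [set (\int[gamma]_z (sqnorm (z.1 - z.2)%R)%:E)%E |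
                    gamma in [set gamma | coupling mu xi gamma]]).

(* mu \in C([0, T], P^2(R^n)); values outside [0, T] are irrelevant. *)
Definition P2_curve (R : realType) n (T : R)
    (mu : R -> probability 'rV[R]_n R) : Prop :=
  forall t : R, t \in `[0, T] ->
    finite_second_moment (mu t) /\
    wasserstein2 (mu s) (mu t) @[s --> within `[0, T] (nbhs t)] --> 0%E.

(* (grad W * mu)(x) *)
Definition grad_conv (R : realType) n (W : 'rV[R]_n -> R)
    (mu : probability 'rV[R]_n R) (x : 'rV[R]_n) : 'rV[R]_n :=
  \row_i \int[mu]_y (grad W (x - y) 0 i).

(* Distributional solution, on (0, T) x R^n, of
     d_t mu = div (mu (grad W * mu + grad V))
   with initial datum mu0; phi (t, x) ranges over C_c^oo((0, T) x R^n), and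
   coordinate 0 of R^(1+n) is time. *)
Definition weak_solution (R : realType) n (T : R) (W V : 'rV[R]_n -> R)
    (mu0 : probability 'rV[R]_n R) (mu : R -> probability 'rV[R]_n R) : Prop :=
  (forall A, measurable A -> mu 0 A = mu0 A) /\
  forall phi : 'rV[R]_(1 + n) -> R, test_function phi ->
    supp phi `<=` [set z : 'rV[R]_(1 + n) | 0 < z 0 0 < T] ->
    \int[lebesgue_measure]_(t in `[0, T])
      (\int[mu t]_x
         (partial 0 phi (cons_rV t x) -
          \sum_(i < n) partial (rshift 1 i) phi (cons_rV t x) *
                       (grad_conv W (mu t) x + grad V x) 0 i)) = 0.

(* The error functional of What, relative to W and to the curve mu. *)
Definition error_functional (R : realType) n (T : R) (W : 'rV[R]_n -> R)
    (mu : R -> probability 'rV[R]_n R) (What : 'rV[R]_n -> R) : \bar R :=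
  ((T^-1)%:E * \int[lebesgue_measure]_(t in `[0%R, T])
     \int[mu t]_x
        (sqnorm (grad_conv W (mu t) x - grad_conv What (mu t) x)%R)%:E)%E.

(* Main.v *)
(* The velocity v_t = - (grad W * mu_t + grad V) is bounded, Lipschitz in x and,
   since t |-> mu_t is d_2-continuous, uniformly continuous in t; its flow X is
   the limit of Euler polygons. Testing the equation with products
   eta(t) k(x - z), for a mollifier k, gives the increments of the mollified
   density of mu_t up to o(h), and a commutator estimate between mollification
   and the Euler step x + h v(x) shows that the integral of u against mu_(t+h)
   is that of u(x + h v_t(x)) against mu_t up to o(h), for every Lipschitz u with
   compact support. Iterating, mu_t is the image of mu_0 under X_t.
   If gamma is a coupling of mu_0 and muhat_0, its image under (X_t, Xhat_t) is
   then a coupling of mu_t and muhat_t, and D_t, the integral of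
   |X_t(x) - Xhat_t(y)|^2 against gamma, satisfies D' <= K D + a, where
   K = 5 + 2 LWhat^2 + LV^2 and a_t is the integral of
   |grad W * mu_t - grad What * mu_t|^2 against mu_t. Gronwall's lemma and the
   infimum over gamma conclude. *)
Require Import Defs.
From HB Require Import structures.
From mathcomp Require Import all_boot all_order all_algebra.
From mathcomp Require Import all_classical all_reals all_analysis.
From mathcomp Require Import measurable_realfun.
From mathcomp Require Import ring lra.
Set Implicit Arguments.
Unset Strict Implicit.
Unset Printing Implicit Defensive.
Import Order.TTheory GRing.Theory Num.Theory.
Import numFieldNormedType.Exports.
Local Open Scope classical_set_scope.
Local Open Scope ring_scope.

(** * Borel sets of row vectors *)

(** The curve solves its equation only in the distributional sense and the velocity is only
    Lipschitz, so the natural test functions u(X_t(x)) are merely Lipschitz and the equation cannot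
    be tested with them. Mollification supplies admissible test functions, but the scale e has to be
    fixed before the time step h: an error O(e) per step would add up to O(e / h) over t / h steps,
    while an error O(h e) adds up to O(e). Two kinds of constants are kept apart. The sup-norm
    bounds M extracted from the Sobolev hypotheses only feed limits (existence of the flow,
    vanishing remainders); the final constants come from the Euclidean Lipschitz constants. In K,
    the 5 comes from Young's inequality applied to four parts of the velocity difference and to a
    remainder; LWhat^2 occurs twice because grad What * muhat is perturbed both in the point and in
    the measure. The interaction kernel is replaced at the measure mu_t, before the measure is
    changed, so that W is seen only through a_t. *)

Section RowVectors.
Context {R : realType} {n : nat}.
Implicit Types x y : 'rV[R]_n.

Lemma normrV_ge x i : `|x 0 i| <= `|x|.
Proof.
rewrite [leRHS]/Num.norm /= mx_normrE.
by apply/bigmax_geP; right; exists (0, i).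
Qed.

Lemma normrV_le x (r : R) : 0 <= r -> (forall i, `|x 0 i| <= r) -> `|x| <= r.
Proof.
move=> r0 xr; rewrite [leLHS]/Num.norm /= mx_normrE; apply/bigmax_leP; split => //.
by move=> [j i] _ /=; rewrite ord1.
Qed.

Lemma normrV_lt x (r : R) : 0 < r -> (forall i, `|x 0 i| < r) -> `|x| < r.
Proof.
move=> r0 xr; rewrite [ltLHS]/Num.norm /= mx_normrE; apply/bigmax_ltP; split => //.
by move=> [j i] _ /=; rewrite ord1.
Qed.

Definition open_box (p : {ffun 'I_n -> R * R}) : set 'rV[R]_n :=
  [set x | forall i, (p i).1 < x 0 i < (p i).2].

Definition rat_box (p : {ffun 'I_n -> rat * rat}) : {ffun 'I_n -> R * R} :=
  [ffun i => (ratr (p i).1, ratr (p i).2)].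

(** Boxes with rational corners are countably many, so this is a countable union; it reduces
    measurability of vector-valued maps to that of their coordinates. *)
Lemma open_bigcup_box (U : set 'rV[R]_n) : open U ->
  U = \bigcup_(p in [set p | open_box (rat_box p) `<=` U]) open_box (rat_box p).
Proof.
move=> oU; apply/seteqP; split=> [x Ux|x [p pU /pU//]].
have /nbhs_ballP[e /= e0 eU] : nbhs x U by exact: open_nbhs_nbhs.
have ex i : exists pq : rat * rat,
    (x 0 i - e < ratr pq.1 < x 0 i) && (x 0 i < ratr pq.2 < x 0 i + e).
  have [|p] := @rat_in_itvoo R (x 0 i - e) (x 0 i); first by lra.
  have [|q] := @rat_in_itvoo R (x 0 i) (x 0 i + e); first by lra.
  by rewrite !in_itv /= => qi pi; exists (p, q); rewrite /= pi qi.
have [f fP] := choice ex.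
exists [ffun i => f i] => /= [|i]; last first.
  by rewrite !ffunE; have /andP[/andP[_ ->] /andP[->]] := fP i.
move=> y xy; apply: eU; rewrite -ball_normE /ball_ /=; apply: normrV_lt => // i.
have := xy i; rewrite !ffunE /= => /andP[h1 h2].
have /andP[/andP[h3 h4] /andP[h5 h6]] := fP i.
by rewrite !mxE ltr_norml; apply/andP; split; lra.
Qed.

Lemma open_measurable_rV (A : set 'rV[R]_n) : open A -> measurable A.
Proof. by move=> oA; exact: sub_sigma_algebra. Qed.

Lemma continuous_measurable_rV (f : 'rV[R]_n -> R) :
  continuous f -> measurable_fun setT f.
Proof.
move=> cf.
apply: (measurability _ (measurable_realfun.RGenOInfty.measurableE R)) => _ [_ [a ->] <-].
rewrite setTI; apply: open_measurable_rV; apply: open_comp; last exact: interval_open.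
by move=> x _; exact: cf.
Qed.

Lemma measurable_coord i : measurable_fun setT (fun x => x 0 i).
Proof. by apply: continuous_measurable_rV => x; exact: coord_continuous. Qed.

Lemma measurable_fun_rV d (T : measurableType d) (D : set T) (f : T -> 'rV[R]_n) :
  (forall i, measurable_fun D (fun t => f t 0 i)) -> measurable_fun D f.
Proof.
move=> mf mD; apply: (measurability (@open 'rV[R]_n)) => //.
move=> _ [U oU <-].
rewrite (open_bigcup_box oU) preimage_bigcup setI_bigcupr.
rewrite bigcup_mkcond; apply: countable_bigcupT_measurable => [//|p].
case: ifPn => _; last exact: measurable0.
(* The last factor [D] keeps the identity true for n = 0, where the intersection over the
   coordinates is the whole space. *)
have -> : D `&` f @^-1` open_box (rat_box p) =
    \bigcap_(i in [set: 'I_n]) (D `&` (fun t => f t 0 i) @^-1`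
       `](rat_box p i).1, (rat_box p i).2[) `&` D.
  apply/seteqP; split=> [x [Dx /= fx]|x [/= fx Dx]]; split => //.
    by move=> i _; split => //=; rewrite in_itv; exact: fx.
  by move=> i; have [_ /=] := fx i I; rewrite in_itv.
apply: measurableI => //.
apply: fin_bigcap_measurable => // i _.
by apply: mf => //; exact: measurable_itv.
Qed.

End RowVectors.

(** * Test functions of product form *)

(** Most derivatives below are read off from an explicit remainder by this criterion; [C = 0] takes
    care of affine functions. *)
Lemma is_derive_quadratic (R : realType) (V : normedModType R) (f : V -> R)
    (x v : V) (l C : R) :
  (forall h, `|h| <= 1 -> `|f (h *: v + x) - f x - h * l| <= C * h ^+ 2) ->
  is_derive x v f l.
Proof.
move=> fl.
have C0 : 0 <= C.
  by have := fl 1; rewrite normr1 expr1n mulr1 => /(_ (lexx _)); apply: le_trans.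
have cf : h^-1 *: ((f \o shift x) (h *: v) - f x) @[h --> 0^'] --> l.
  apply/cvgrPdist_le => /= e e0.
  near=> h.
  have h0 : h != 0 by near: h; exact: nbhs_dnbhs_neq.
  have h1 : `|h| <= 1.
    near: h; apply/nbhs_dnbhs => /=; apply/nbhs_ballP; exists 1 => //= y.
    by rewrite /ball /= sub0r normrN => /ltW.
  have h2 : `|h| <= e / (C + 1).
    near: h; apply/nbhs_dnbhs => /=; apply/nbhs_ballP; exists (e / (C + 1)) => /=.
      by rewrite divr_gt0// ltr_wpDl.
    by move=> y; rewrite /ball /= sub0r normrN => /ltW.
  rewrite distrC.
  have -> : h^-1 *: (f (h *: v + x) - f x) - l = h^-1 * (f (h *: v + x) - f x - h * l).
    by rewrite mulrBr mulrA mulVf// mul1r.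
  rewrite normrM normfV ler_pdivrMl ?normr_gt0//.
  apply: (le_trans (fl h h1)); rewrite -real_normK ?num_real// expr2 mulrCA.
  rewrite ler_wpM2l//.
  apply: (@le_trans _ _ ((C + 1) * (e / (C + 1)))).
    by rewrite ler_pM// ?lerDl.
  by rewrite mulrCA divff ?mulr1// gt_eqF// ltr_wpDl.
by split; [apply/cvg_ex; exists l|exact: cvg_lim].
Unshelve. all: by end_near. Qed.

Lemma is_derive_line (R : realType) (V : normedModType R) (f : V -> R)
    (x v : V) (g : R -> R) (y l : R) :
  (forall h : R, f (h *: v + x) = g (h + y)) ->
  is_derive y 1 g l -> is_derive x v f l.
Proof.
move=> fg [dg gl].
have E : (fun h => h^-1 *: ((f \o shift x) (h *: v) - f x)) =
         (fun h => h^-1 *: ((g \o shift y) (h *: 1) - g y)).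
  apply/funext => h /=; rewrite fg -[in X in _ - f X](add0r x) -[in X in _ - f X](scale0r v) fg.
  by rewrite add0r [h *: 1]mulr1.
split; first by rewrite /derivable E.
by rewrite /derive E.
Qed.

Lemma is_derive_horner (R : realType) (p : {poly R}) (x : R) :
  is_derive x 1 (horner p) (p^`()).[x].
Proof.
elim/poly_ind: p => [|p c IH].
  rewrite deriv0 horner0 (_ : horner 0 = cst 0); first exact: is_derive_cst.
  by apply/funext => y; rewrite horner0.
rewrite (_ : horner _ = horner p * id + cst c); last first.
  by apply/funext => y; rewrite !hornerE.
apply: is_derive_eq; rewrite derivD derivM derivX derivC !hornerE /=.
by rewrite /GRing.scale /=; ring.
Qed.

Lemma expr_le_expR (R : realType) (y : R) k : 0 <= y ->
  y ^+ k <= k`!%:R * expR y.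
Proof.
case: k => [|k] y0.
  by rewrite expr0 mul1r; apply: le_trans (expR_ge1Dx y); rewrite lerDl.
rewrite -ler_pdivrMl ?ltr0n ?fact_gt0// mulrC.
by apply: le_trans (expR_ge1Dxn k y0); rewrite lerDr.
Qed.

Section Bump.
Context {R : realType}.

(** The negative power makes the family closed under differentiation, up to polynomial factors. *)
Definition flat k (s : R) : R := if 0 < s then s ^- k * expR (- s^-1) else 0.

Lemma flat_ge0 k s : 0 <= flat k s.
Proof.
by rewrite /flat; case: ifPn => // s0; rewrite mulr_ge0 ?expR_ge0 ?invr_ge0 ?exprn_ge0// ltW.
Qed.

(** With y = 1 / s this is y^(k+2) <= (k+2)! exp(y), a single term of the exponential series. *)
Lemma flat_quadratic k s : `|s| <= 1 ->
  flat k s <= (k + 2)`!%:R * s ^+ 2.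
Proof.
rewrite /flat; case: ifPn => s0 s1; last first.
  by rewrite mulr_ge0 ?sqr_ge0.
rewrite expRN ler_pdivrMr ?expR_gt0// mulrAC -ler_pdivrMr ?exprn_gt0//.
rewrite -!exprVn -exprD; apply: expr_le_expR.
by rewrite invr_ge0 ltW.
Qed.

(** The only delicate point is [s = 0], where the quadratic bound forces the derivative to
    vanish. *)
Lemma is_derive_flat k (s : R) :
  is_derive s 1 (flat k) ((1 - k%:R * s) * flat k.+2 s).
Proof.
have [s0|s0|->] := ltgtP s 0.
- rewrite [flat k.+2 s]/flat ltNge (ltW s0) mulr0.
  have : is_derive s 1 (cst 0 : R -> R) 0 by exact: is_derive_cst.
  apply: near_eq_is_derive; near=> y.
  rewrite /flat ifF//; apply/negbTE; rewrite -leNgt ltW//.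
  by near: y; exact: lt_nbhsl.
- have : is_derive s 1 ((fun y => y^-1 ^+ k) * (expR \o (fun y : R => - y^-1)))
      ((1 - k%:R * s) * flat k.+2 s).
    have dV : is_derive s 1 (fun y : R => y^-1) (- s ^- 2).
      by rewrite -[X in is_derive _ _ _ X]mulr1; apply: is_deriveV; rewrite ?gt_eqF.
    have dN : is_derive s 1 (fun y : R => - y^-1) (s ^- 2).
      by rewrite -[s ^- 2]opprK; exact: is_deriveN.
    have dE := @is_derive1_comp R expR (fun y => - y^-1) s _ _
      (is_derive_expR (- s^-1)) dN.
    have dX := is_deriveX k dV; rewrite exprfctE in dX.
    have H := is_deriveM dX dE; apply: (@is_derive_eq _ _ _ _ _ _ _ _ H).
    rewrite /flat s0 /GRing.scale /=.
    have [->|k0] := posnP k.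
      by rewrite !mul0r !expr0 subr0 !mul1r mulr0 addr0 mulrC.
    have sn0 : s != 0 by rewrite gt_eqF.
    rewrite -!exprVn -[in s^-1 ^+ k.+2](prednK k0) -[in s^-1 ^+ k](prednK k0) !exprS.
    by move: (_ ^+ k.-1) (expR _) k%:R => a b c; field.
  apply: near_eq_is_derive; near=> y.
  have y0 : 0 < y by near: y; exact: lt_nbhsr.
  by rewrite /flat y0 -exprVn.
- have f0 m : flat m 0 = 0 by rewrite /flat ltxx.
  rewrite f0 mulr0; apply: (@is_derive_quadratic _ _ _ _ _ _ ((k + 2)`!%:R)).
  move=> h h1; rewrite f0 subr0 mulr0 subr0 addr0 [h *: 1]mulr1.
  by rewrite ger0_norm ?flat_ge0// flat_quadratic.
Unshelve. all: by end_near. Qed.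

(* The k-th derivative of exp (- 1 / (1 - x^2)) on ]-1, 1[ is
   [(bump_poly k).[x] / (1 - x^2)^(2k) * exp (- 1 / (1 - x^2))]. *)
Fixpoint bump_poly k : {poly R} :=
  if k is k'.+1 then
    (bump_poly k')^`() * (1 - 'X^2) ^+ 2 -
    2%:P * 'X * bump_poly k' * (1 - k'.*2%:R%:P * (1 - 'X^2))
  else 1.

Definition smooth_bump k (x : R) : R := (bump_poly k).[x] * flat k.*2 (1 - x ^+ 2).

Lemma flatS2 k s : flat k s = s ^+ 2 * flat k.+2 s.
Proof.
rewrite /flat; case: ifPn => [s0|]; last by rewrite mulr0.
have sn0 : s != 0 by rewrite gt_eqF.
by rewrite -!exprVn !exprS; move: (_ ^+ k) (expR _) => a b; field.
Qed.

(** The two terms of the product rule carry the weights [k.*2] and [k.*2.+2]; [flatS2] raises the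
    first one, and what remains is the recursion of [bump_poly]. *)
Lemma is_derive_bump k (x : R) : is_derive x 1 (smooth_bump k) (smooth_bump k.+1 x).
Proof.
have d1 : is_derive x 1 (fun y : R => 1 - y ^+ 2) (- 2 * x).
  rewrite (_ : (fun _ => _) = cst 1 - id ^+ 2)//.
  by apply: is_derive_eq; rewrite /GRing.scale /=; ring.
have d2 := @is_derive1_comp R (flat k.*2) (fun y => 1 - y ^+ 2) x _ _
  (is_derive_flat k.*2 (1 - x ^+ 2)) d1.
have d3 := is_derive_horner (bump_poly k) x.
have := is_deriveM d3 d2; rewrite (_ : _ * _ = smooth_bump k)//.
move=> H; apply: (@is_derive_eq _ _ _ _ _ _ _ _ H).
rewrite /smooth_bump doubleS /= !hornerE /= /GRing.scale /= (flatS2 k.*2).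
ring.
Qed.

Lemma bump_out k x : 1 <= `|x| -> smooth_bump k x = 0.
Proof.
move=> x1; rewrite /smooth_bump /flat ifF ?mulr0//; apply/negbTE.
by rewrite -leNgt subr_le0 -real_normK ?num_real// exprn_ege1.
Qed.

Lemma bump0_ge0 x : 0 <= smooth_bump 0 x.
Proof. by rewrite /smooth_bump /= hornerE mul1r flat_ge0. Qed.

End Bump.

(* [phi] is the sequence of the successive derivatives of a smooth function
   vanishing outside of [[-K, K]]. *)
Definition smooth_jet (R : realType) (K : R) (phi : nat -> R -> R) : Prop :=
  (forall k (x : R), is_derive x 1 (phi k) (phi k.+1 x)) /\
  (forall k x, K <= `|x| -> phi k x = 0).

Section SmoothJet.
Context {R : realType}.
Implicit Types (phi : nat -> R -> R) (K : R).

Lemma smooth_jet_continuous K phi k : smooth_jet K phi -> continuous (phi k).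
Proof.
move=> [dphi _] x; have [d _] := dphi k x.
by apply: differentiable_continuous; apply/derivable1_diffP.
Qed.

Lemma smooth_jet_bounded K phi k : smooth_jet K phi ->
  exists2 C : R, 0 <= C & forall x, `|phi k x| <= C.
Proof.
move=> sphi.
have cphi : {within `[- `|K|, `|K|], continuous (fun x => `|phi k x|)}.
  apply: continuous_subspaceT => x; apply: continuous_comp.
    exact: (smooth_jet_continuous sphi).
  exact: norm_continuous.
have [|c _ cmax] := EVT_max _ cphi; first by rewrite ge0_cp.
exists `|phi k c| => // x.
have [xK|xK] := leP `|x| `|K|.
  by apply: cmax; rewrite in_itv /= -ler_norml.
by rewrite sphi.2 ?normr0// (le_trans (ler_norm K))// ltW.
Qed.

Definition scaled_bump (a e c : R) k x : R := c * e^-1 ^+ k * smooth_bump k ((x - a) / e).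

Lemma scaled_bump_smooth a e c : 0 < e ->
  smooth_jet (`|a| + e) (scaled_bump a e c).
Proof.
move=> e0; split => [k x|k x ax]; last first.
  rewrite /scaled_bump bump_out ?mulr0// normrM normfV [`|e|]gtr0_norm//.
  by rewrite ler_pdivlMr// mul1r; have := ler_distD 0 x a; have := ler_distD a x 0;
    rewrite !subr0 !sub0r !normrN; lra.
have d1 : is_derive x 1 (fun y : R => (y - a) / e) e^-1.
  apply: (@is_derive_quadratic _ _ _ _ _ _ 0) => h _.
  rewrite [h *: 1]mulr1 mul0r.
  by rewrite (_ : _ - _ = 0) ?normr0//; ring.
have d2 := @is_derive1_comp R (smooth_bump k) (fun y => (y - a) / e) x _ _
  (is_derive_bump k ((x - a) / e)) d1.
have d3 := @is_deriveZ _ _ _ _ (c * e^-1 ^+ k) _ _ _ d2.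
apply: (@is_derive_eq _ _ _ _ _ _ _ _ d3).
by rewrite /scaled_bump /GRing.scale /= exprSr; ring.
Qed.

End SmoothJet.

Section ProductTestFunctions.
Context {R : realType} {n : nat}.
Implicit Types (phi : 'I_n -> nat -> R -> R) (al : 'I_n -> nat) (x : 'rV[R]_n).

(** The multi-index [al] records the order of derivation in each coordinate, so that the family is
    stable under partial derivatives. *)
Definition prod_jet phi al x : R := \prod_i phi i (al i) (x 0 i).

Definition incr_at (i : 'I_n) al : 'I_n -> nat :=
  fun j => if j == i then (al j).+1 else al j.

Lemma is_derive_prod_jet K phi al i x : (forall i, smooth_jet K (phi i)) ->
  is_derive x (delta_mx 0 i) (prod_jet phi al) (prod_jet phi (incr_at i al) x).
Proof.
move=> sphi.
pose c := \prod_(j | j != i) phi j (al j) (x 0 j).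
apply: (@is_derive_line _ _ _ _ _ (c *: phi i (al i)) (x 0 i)) => [h|].
  rewrite /prod_jet (bigD1 i)//= mulrC /GRing.scale /= !mxE !eqxx mulr1.
  congr (_ * _); apply: eq_bigr => j ji.
  by rewrite !mxE eqxx /= (negbTE ji) mulr0 add0r.
have [d _] := sphi i.
have H := @is_deriveZ _ _ _ _ c _ _ _ (d (al i) (x 0 i)).
apply: (@is_derive_eq _ _ _ _ _ _ _ _ H).
rewrite /prod_jet (bigD1 i)//= mulrC /incr_at eqxx; congr (_ * _).
by apply: eq_bigr => j ji; rewrite (negbTE ji).
Qed.

Lemma prod_jet_continuous K phi al : (forall i, smooth_jet K (phi i)) ->
  continuous (prod_jet phi al).
Proof.
move=> sphi.
have -> : prod_jet phi al = \prod_i (fun x => phi i (al i) (x 0 i)).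
  by rewrite /prod_jet; apply/funext => x; elim/big_rec2: _ => // i y1 y2 _ ->.
elim/big_ind: _ => [x|f g cf cg x|i _ x].
- exact: cst_continuous.
- by apply: continuousM; [exact: cf|exact: cg].
- by apply: continuous_comp; [exact: coord_continuous
                             |exact: (smooth_jet_continuous (sphi i))].
Qed.

Lemma prod_jet_bounded K phi al : (forall i, smooth_jet K (phi i)) ->
  exists2 C : R, 0 <= C & forall x, `|prod_jet phi al x| <= C.
Proof.
move=> sphi.
have ex i := smooth_jet_bounded (al i) (sphi i).
have [C C0 HC] : exists2 C : 'I_n -> R, (forall i, 0 <= C i) &
    forall i (y : R), `|phi i (al i) y| <= C i.
  have /choice[C HC] : forall i, exists Ci : R,
      0 <= Ci /\ forall y : R, `|phi i (al i) y| <= Ci.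
    by move=> i; have [Ci] := ex i; exists Ci.
  by exists C => i; have [] := HC i.
exists (\prod_i C i) => [|x]; first exact: prodr_ge0.
by rewrite /prod_jet normr_prod; apply: ler_prod => i _; rewrite normr_ge0 HC.
Qed.

Lemma prod_jet_out K phi al x i : (forall i, smooth_jet K (phi i)) ->
  K <= `|x 0 i| -> prod_jet phi al x = 0.
Proof.
move=> sphi Kx; rewrite /prod_jet (bigD1 i)//=.
by have [_ ->] := sphi i; rewrite ?mul0r.
Qed.

Lemma prod_jet_test_function K phi al : (forall i, smooth_jet K (phi i)) ->
  test_function (prod_jet phi al).
Proof.
move=> sphi; split.
  (* The induction is on all multi-indices at once, since a partial derivative is again a [prod_jet]
     with another [al]. *)
  move=> k; elim: k al => [|k IH] al /=; split => //.
  - exact: prod_jet_continuous sphi.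
  - exact: prod_jet_continuous sphi.
  - move=> i; split.
      by move=> x; have [] := is_derive_prod_jet al i x sphi.
    rewrite (_ : partial i _ = prod_jet phi (incr_at i al)); first exact: IH.
    by apply/funext => x; have [] := is_derive_prod_jet al i x sphi.
have sub : [set x | prod_jet phi al x != 0] `<=` [set x | `|x| <= `|K|].
  move=> x /= x0; apply: normrV_le => // i; rewrite leNgt; apply/negP => Kx.
  move/eqP: x0; apply; apply: (@prod_jet_out K _ _ _ i sphi).
  by rewrite ltW// (le_lt_trans (ler_norm K)).
have cl : closed [set x : 'rV[R]_n | `|x| <= `|K|].
  apply: (@preimage_closed _ _ (fun x : 'rV[R]_n => `|x|) [set y | y <= `|K|]).
    by move=> x _; exact: norm_continuous.
  exact: closed_le.
apply: bounded_closed_compact; last exact: closed_closure.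
exists `|K|; split => // M KM x /(closureS sub).
by rewrite -(iffLR (closure_id _) cl) => /le_trans; apply; exact: ltW.
Qed.

End ProductTestFunctions.

(** * Mean value estimates along coordinate directions *)

Section MeanValue.
Context {R : realType}.

Lemma mean_value_bound (f df : R -> R) (a b C : R) :
  (forall x : R, is_derive x 1 f (df x)) ->
  (forall x, `|x - a| <= `|b - a| -> `|df x| <= C) ->
  `|f b - f a| <= C * `|b - a|.
Proof.
move=> fdf dfC.
have cf : continuous f.
  move=> x; have [d _] := fdf x.
  by apply: differentiable_continuous; apply/derivable1_diffP.
have [ab|ba] := leP a b.
  have [c cab ->] := MVT_segment ab (fun x _ => fdf x) (continuous_subspaceT cf).
  rewrite normrM ler_wpM2r// dfC//; move: cab; rewrite in_itv /= => /andP[h1 h2].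
  by rewrite !ger0_norm ?subr_ge0// lerB.
have [c cab E] := MVT_segment (ltW ba) (fun x _ => fdf x) (continuous_subspaceT cf).
rewrite distrC E normrM [`|a - b|]distrC ler_wpM2r// dfC//.
move: cab; rewrite in_itv /= => /andP[h1 h2].
by rewrite !ler0_norm ?subr_le0 ?(ltW ba)// lerN2 lerB.
Qed.

Lemma is_derive_along (V : normedModType R) (f : V -> R) (z v : V) (s l : R) :
  is_derive (s *: v + z) v f l -> is_derive s 1 (fun s => f (s *: v + z)) l.
Proof.
move=> [df fl].
have E : (fun h => h^-1 *: (((fun s => f (s *: v + z)) \o shift s) (h *: 1) - f (s *: v + z))) =
         (fun h => h^-1 *: ((f \o shift (s *: v + z)) (h *: v) - f (s *: v + z))).
  by apply/funext => h /=; rewrite [h *: 1]mulr1 scalerDl addrA.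
split; first by rewrite /derivable E.
by rewrite /derive E.
Qed.

(** The coordinates of [y] are replaced by those of [x] one at a time. The intermediate points stay
    within sup-distance |x - y| of [y], so a bound on that ball is enough; this locality gives the
    quadratic Taylor remainder later. *)
Lemma partial_bound_lipschitz n (f : 'rV[R]_n -> R) (g : 'I_n -> 'rV[R]_n -> R)
    (x y : 'rV[R]_n) (C : R) :
  (forall i z, is_derive z (delta_mx 0 i) f (g i z)) ->
  (forall i z, `|z - y| <= `|x - y| -> `|g i z| <= C) ->
  `|f x - f y| <= C * \sum_i `|x 0 i - y 0 i|.
Proof.
move=> fg gC.
pose z k : 'rV[R]_n := \row_i (if (i < k)%N then x 0 i else y 0 i).
have z0 : z 0%N = y by apply/rowP => i; rewrite mxE.
have zn : z n = x by apply/rowP => i; rewrite mxE ltn_ord.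
suff H k : (k <= n)%N ->
    `|f (z k) - f y| <= C * \sum_(i < n | (i < k)%N) `|x 0 i - y 0 i|.
  rewrite -{1}zn; apply: (le_trans (H n (leqnn n))).
  by rewrite (eq_bigl xpredT)// => i; rewrite ltn_ord.
elim: k => [_|k IH kn].
  by rewrite z0 subrr normr0 big_pred0 ?mulr0// => i.
pose i0 := Ordinal kn.
have zk1 : z k.+1 = (x 0 i0 - y 0 i0) *: delta_mx 0 i0 + z k.
  apply/rowP => i; rewrite !mxE eqxx /= -val_eqE /= ltnS leq_eqVlt.
  have [ik|ik] /= := eqVneq (i : nat) k; last by rewrite mulr0 add0r.
  have -> : i = i0 by exact: val_inj.
  by rewrite /= ltnn mulr1 subrK.
rewrite (bigD1 i0)//= (eq_bigl (fun i : 'I_n => (i < k)%N)); last first.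
  move=> i; rewrite ltnS leq_eqVlt -val_eqE /=.
  by have [->|] := eqVneq (i : nat) k; rewrite ?ltnn ?andbT.
rewrite mulrDr -(subrKA (f (z k))) (le_trans (ler_normD _ _))// lerD ?IH 1?ltnW//.
have := @mean_value_bound (fun s => f (s *: delta_mx 0 i0 + z k))
  (fun s => g i0 (s *: delta_mx 0 i0 + z k)) 0 (x 0 i0 - y 0 i0) C.
rewrite subr0 scale0r add0r -zk1; apply.
  by move=> s; apply: is_derive_along; exact: fg.
move=> s; rewrite subr0 => sxy; apply: gC.
apply: normrV_le => // i; rewrite !mxE eqxx /=.
have [ii0|_] /= := eqVneq i i0.
  rewrite ii0 /= ltnn mulr1 addrK; apply: (le_trans sxy).
  by have := normrV_ge (x - y) i0; rewrite !mxE.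
rewrite mulr0 add0r; have := normrV_ge (x - y) i; rewrite !mxE.
by case: ifPn => // _ _; rewrite subrr normr0.
Qed.

Lemma sum_coord_le n (x : 'rV[R]_n) : \sum_i `|x 0 i| <= n%:R * `|x|.
Proof.
apply: (@le_trans _ _ (\sum_(i < n) `|x|)).
  by apply: ler_sum => i _; exact: normrV_ge.
by rewrite sumr_const card_ord mulr_natl.
Qed.

End MeanValue.

(** * Integration of bounded measurable functions *)

Section BoundedMeasurable.
Context d (T : measurableType d) (R : realType).
Implicit Types f g : T -> R.

(** An algebra of functions integrable against every finite measure: all side conditions of
    linearity and Fubini reduce to membership in it. *)
Definition bounded_measurable f :=
  measurable_fun setT f /\ exists M : R, forall x, `|f x| <= M.

Lemma bounded_measurable_cst (c : R) : bounded_measurable (fun=> c).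
Proof. by split; [exact: measurable_cst|exists `|c|]. Qed.

Lemma bounded_measurableD f g : bounded_measurable f -> bounded_measurable g ->
  bounded_measurable (fun x => f x + g x).
Proof.
move=> [mf [M fM]] [mg [N gN]]; split; first exact: measurable_funD.
by exists (M + N) => x; apply: (le_trans (ler_normD _ _)); rewrite lerD.
Qed.

Lemma bounded_measurableN f : bounded_measurable f ->
  bounded_measurable (fun x => - f x).
Proof.
move=> [mf [M fM]]; split; first exact: measurableT_comp.
by exists M => x; rewrite normrN.
Qed.

Lemma bounded_measurableB f g : bounded_measurable f -> bounded_measurable g ->
  bounded_measurable (fun x => f x - g x).
Proof. by move=> bf bg; apply: bounded_measurableD => //; exact: bounded_measurableN. Qed.

Lemma bounded_measurableM f g : bounded_measurable f -> bounded_measurable g ->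
  bounded_measurable (fun x => f x * g x).
Proof.
move=> [mf [M fM]] [mg [N gN]]; split; first exact: measurable_funM.
by exists (M * N) => x; rewrite normrM ler_pM.
Qed.

Lemma bounded_measurable_sum (I : Type) (s : seq I) (F : I -> T -> R) :
  (forall i, bounded_measurable (F i)) ->
  bounded_measurable (fun x => \sum_(i <- s) F i x).
Proof.
move=> bF; elim: s => [|i s IH].
  under eq_fun do rewrite big_nil; exact: bounded_measurable_cst.
by under eq_fun do rewrite big_cons; apply: bounded_measurableD.
Qed.

Lemma bounded_measurable_norm f : bounded_measurable f ->
  bounded_measurable (fun x => `|f x|).
Proof.
move=> [mf [M fM]]; split; first exact: measurableT_comp.
by exists M => x; rewrite normr_id.
Qed.

End BoundedMeasurable.

Lemma bounded_measurable_comp d d' (T : measurableType d) (T' : measurableType d')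
    (R : realType) (f : T -> R) (h : T' -> T) :
  measurable_fun setT h -> bounded_measurable f -> bounded_measurable (fun x => f (h x)).
Proof.
move=> mh [mf [M fM]]; split; last by exists M => x.
exact: measurableT_comp.
Qed.

Section RintegralFinite.
Context d (T : measurableType d) (R : realType).
Variable mu : {finite_measure set T -> \bar R}.
Implicit Types f g : T -> R.

Lemma bounded_measurable_integrable f : bounded_measurable f ->
  mu.-integrable setT (EFin \o f).
Proof.
move=> [mf [M fM]]; apply: measurable_bounded_integrable => //.
  by apply: fin_num_fun_lty; exact: fin_num_measure.
exists M; split; rewrite ?num_real// => N MN x _ /=.
exact: le_trans (fM x) (ltW MN).
Qed.

Lemma RintD f g : bounded_measurable f -> bounded_measurable g ->
  \int[mu]_x (f x + g x) = \int[mu]_x f x + \int[mu]_x g x.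
Proof. by move=> bf bg; rewrite RintegralD//; exact: bounded_measurable_integrable. Qed.

Lemma RintB f g : bounded_measurable f -> bounded_measurable g ->
  \int[mu]_x (f x - g x) = \int[mu]_x f x - \int[mu]_x g x.
Proof. by move=> bf bg; rewrite RintegralB//; exact: bounded_measurable_integrable. Qed.

Lemma RintZ (c : R) f : bounded_measurable f ->
  \int[mu]_x (c * f x) = c * \int[mu]_x f x.
Proof. by move=> bf; rewrite RintegralZl//; exact: bounded_measurable_integrable. Qed.

Lemma Rint_sum (I : Type) (s : seq I) (F : I -> T -> R) :
  (forall i, bounded_measurable (F i)) ->
  \int[mu]_x (\sum_(i <- s) F i x) = \sum_(i <- s) \int[mu]_x F i x.
Proof.
move=> bF; elim: s => [|i s IH].
  rewrite big_nil; under eq_Rintegral do rewrite big_nil.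
  by rewrite Rintegral_cst// mul0r.
rewrite big_cons -IH -RintD//; last exact: bounded_measurable_sum.
by under eq_Rintegral do rewrite big_cons.
Qed.

Lemma le_Rint f g : bounded_measurable f -> bounded_measurable g ->
  (forall x, f x <= g x) -> \int[mu]_x f x <= \int[mu]_x g x.
Proof.
by move=> bf bg fg; apply: le_Rintegral => //; exact: bounded_measurable_integrable.
Qed.

Lemma le_norm_Rint f g : bounded_measurable f -> bounded_measurable g ->
  (forall x, `|f x| <= g x) -> `|\int[mu]_x f x| <= \int[mu]_x g x.
Proof.
move=> bf bg fg; apply: (le_trans (le_normr_Rintegral _ _)) => //.
  exact: bounded_measurable_integrable.
by apply: le_Rint => //; exact: bounded_measurable_norm.
Qed.

Lemma le_norm_Rint_cst f (c : R) : bounded_measurable f ->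
  (forall x, `|f x| <= c) -> `|\int[mu]_x f x| <= c * fine (mu setT).
Proof.
move=> bf fc; rewrite -Rintegral_cst//; apply: le_norm_Rint => //.
exact: bounded_measurable_cst.
Qed.

End RintegralFinite.

Section RintegralFubini.
Context d1 d2 (T1 : measurableType d1) (T2 : measurableType d2) (R : realType).
Variables (m1 : {finite_measure set T1 -> \bar R})
          (m2 : {finite_measure set T2 -> \bar R}).

Lemma product_measure_finite : ((m1 \x m2) setT < +oo)%E.
Proof.
rewrite -setXTT product_measure1E// lte_mul_pinfty ?fin_num_measure//.
by rewrite -ge0_fin_numE// fin_num_measure.
Qed.

Lemma bounded_measurable_pair_integrable (f : T1 * T2 -> R) : bounded_measurable f ->
  (m1 \x m2)%E.-integrable setT (EFin \o f).
Proof.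
move=> [mf [M fM]]; apply: measurable_bounded_integrable => //.
  exact: product_measure_finite.
exists M; split; rewrite ?num_real// => N MN x _ /=.
exact: le_trans (fM x) (ltW MN).
Qed.

Lemma bounded_measurable_pair1 (f : T1 * T2 -> R) (x : T1) : bounded_measurable f ->
  bounded_measurable (fun y => f (x, y)).
Proof. exact: bounded_measurable_comp. Qed.

Lemma bounded_measurable_pair2 (f : T1 * T2 -> R) (y : T2) : bounded_measurable f ->
  bounded_measurable (fun x => f (x, y)).
Proof. exact: bounded_measurable_comp. Qed.

Lemma Rint_EFin d (T : measurableType d) (mu : {finite_measure set T -> \bar R}) (f : T -> R) :
  bounded_measurable f -> (\int[mu]_x (f x)%:E = (\int[mu]_x f x)%:E)%E.
Proof.
move=> bf; rewrite /Rintegral fineK//; apply: integrable_fin_num => //.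
exact: (bounded_measurable_integrable mu bf).
Qed.

Lemma bounded_measurable_Rint2 (f : T1 * T2 -> R) : bounded_measurable f ->
  bounded_measurable (fun x => \int[m2]_y f (x, y)).
Proof.
move=> bf; split.
  have := measurable_fubini_F (bounded_measurable_pair_integrable bf).
  move=> /(measurableT_comp (@measurable_realfun.fine_measurable R setT measurableT)).
  exact.
have [_ [M fM]] := bf; exists (M * fine (m2 setT)) => x.
by apply: le_norm_Rint_cst => //; exact: bounded_measurable_pair1.
Qed.

Lemma bounded_measurable_Rint1 (f : T1 * T2 -> R) : bounded_measurable f ->
  bounded_measurable (fun y => \int[m1]_x f (x, y)).
Proof.
move=> bf; split.
  have := measurable_fubini_G (bounded_measurable_pair_integrable bf).
  move=> /(measurableT_comp (@measurable_realfun.fine_measurable R setT measurableT)).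
  exact.
have [_ [M fM]] := bf; exists (M * fine (m1 setT)) => y.
by apply: le_norm_Rint_cst => //; exact: bounded_measurable_pair2.
Qed.

Lemma Rint_prod (f : T1 * T2 -> R) : bounded_measurable f ->
  \int[m1]_x \int[m2]_y f (x, y) = \int[(m1 \x m2)%E]_z f z.
Proof.
move=> bf; rewrite [RHS]/Rintegral.
rewrite -(integral12_prod_meas1 (bounded_measurable_pair_integrable bf)).
congr fine; apply: eq_integral => x _.
by rewrite /fubini_F [RHS]Rint_EFin//; exact: bounded_measurable_pair1.
Qed.

Lemma Rint_Fubini (f : T1 * T2 -> R) : bounded_measurable f ->
  \int[m1]_x \int[m2]_y f (x, y) = \int[m2]_y \int[m1]_x f (x, y).
Proof.
move=> bf; rewrite /Rintegral; congr fine.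
transitivity (\int[m1]_x \int[m2]_y (f (x, y))%:E)%E.
  by apply: eq_integral => x _; rewrite Rint_EFin//; exact: bounded_measurable_pair1.
rewrite (Fubini (bounded_measurable_pair_integrable bf)).
by apply: eq_integral => y _; rewrite Rint_EFin//; exact: bounded_measurable_pair2.
Qed.

End RintegralFubini.

(** * Image measures and change of variables *)

Section ImageMeasure.
Context d1 d2 (T1 : measurableType d1) (T2 : measurableType d2) (R : realType).
Variables (h : T1 -> T2) (mh : measurable_fun setT h).
Local Notation image_measure m :=
  (measure_function.measure_function_pushforward__canonical__measure_function_Measure m mh).

Lemma exists_image_measure (m : {measure set T1 -> \bar R}) : (m setT < +oo)%E ->
  exists m' : {finite_measure set T2 -> \bar R},
    forall A, measurable A -> m' A = m (h @^-1` A).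
Proof.
move=> moo.
have fin : (image_measure m setT < +oo)%E by rewrite /= /pushforward preimage_setT.
(* Restricting the push-forward to the whole space changes nothing but gives it the structure of a
   finite measure. *)
exists (mfrestr measurableT fin) => A mA.
by rewrite /= /mfrestr /mrestr setIT.
Qed.

Lemma ge0_integral_image (m : {measure set T1 -> \bar R}) (m' : {measure set T2 -> \bar R})
    (f : T2 -> \bar R) :
  (forall A, measurable A -> m' A = m (h @^-1` A)) ->
  measurable_fun setT f -> (forall y, (0 <= f y)%E) ->
  (\int[m']_y f y = \int[m]_x f (h x))%E.
Proof.
move=> m'E mf f0.
rewrite (eq_measure_integral (image_measure m)) => [|A mA _]; last exact: m'E.
by rewrite ge0_integral_pushforward.
Qed.

Lemma Rint_image (m : {measure set T1 -> \bar R}) (m' : {measure set T2 -> \bar R})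
    (f : T2 -> R) : (m setT < +oo)%E ->
  (forall A, measurable A -> m' A = m (h @^-1` A)) ->
  bounded_measurable f ->
  \int[m']_y f y = \int[m]_x f (h x).
Proof.
move=> moo m'E [mf [M fM]]; rewrite /Rintegral; congr fine.
rewrite (eq_measure_integral (image_measure m)) => [|A mA _]; last exact: m'E.
rewrite (integral_pushforward mh)//; first exact/measurable_EFinP.
rewrite preimage_setT; apply: (@measurable_bounded_integrable _ _ _ _ (f \o h)) => //.
  exact: measurableT_comp.
exists M; split; rewrite ?num_real// => N MN x _ /=.
exact: le_trans (fM _) (ltW MN).
Qed.

End ImageMeasure.

(** * The iterated Lebesgue integral on boxes *)

Section IntegralRV.
Context {R : realType}.
Local Notation leb := (@lebesgue_measure R).

(* [integral_rV] is an iterated integral; on functions supported in a box it is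
   the integral against a finite measure, to which Fubini's theorem applies. *)
Definition box_measure_spec n (K : R) (m : {finite_measure set 'rV[R]_n -> \bar R}) :=
  forall f : 'rV[R]_n -> R, bounded_measurable f ->
    (forall (x : 'rV[R]_n) i, K < `|x 0 i| -> f x = 0) ->
    integral_rV f = \int[m]_x f x.

Lemma cons_rV0 n (t : R) (x : 'rV[R]_n) (i : 'I_1) : cons_rV t x 0 (lshift n i) = t.
Proof. by rewrite row_mxEl mxE ord1 eqxx. Qed.

Lemma cons_rVS n (t : R) (x : 'rV[R]_n) (i : 'I_n) : cons_rV t x 0 (rshift 1 i) = x 0 i.
Proof. by rewrite row_mxEr. Qed.

Lemma measurable_cons_rV n :
  measurable_fun setT (fun z : measurableTypeR R * 'rV[R]_n => cons_rV z.1 z.2).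
Proof.
apply: measurable_fun_rV => i; rewrite -(splitK i); case: (fintype.split i) => j /=.
  rewrite (_ : (fun _ => _) = fst); first exact: measurable_fst.
  by apply/funext => z; rewrite cons_rV0.
rewrite (_ : (fun _ => _) = (fun x : 'rV[R]_n => x 0 j) \o snd).
  exact: (measurableT_comp (measurable_coord j)).
by apply/funext => z; rewrite cons_rVS.
Qed.

Lemma exists_interval_measure (K : R) :
  exists l : {finite_measure set (measurableTypeR R) -> \bar R},
  forall g : R -> R, (forall t, K < `|t| -> g t = 0) -> \int[leb]_t g t = \int[l]_t g t.
Proof.
have fin : (leb [set` `[- K, K]%R] < +oo)%E.
  by rewrite lebesgue_measure_itv /=; case: ifP => _; rewrite ?ltry.
pose l := @mfrestr _ (measurableTypeR R) _ _ leb (@measurable_itv R `[- K, K]) fin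
  : {finite_measure set (measurableTypeR R) -> \bar R}.
exists l => g g0.
have gK (m : {measure set (measurableTypeR R) -> \bar R}) :
    \int[m]_t g t = \int[m]_(t in `[- K, K]) g t.
  rewrite [RHS]Rintegral_mkcond; apply: eq_Rintegral => t _.
  rewrite patchE; case: ifPn => //.
  rewrite notin_setE /= in_itv /= -ler_norml => /negP.
  by rewrite -ltNge => /g0 ->.
rewrite (gK leb) (gK l).
rewrite /Rintegral; congr fine; apply: eq_measure_integral => A mA AK.
by rewrite /l /= /mfrestr /mrestr setIidl.
Qed.

(** In dimension 0 the iterated integral is evaluation at the only point, hence a Dirac mass; each
    further dimension takes the image under [cons_rV] of a product with Lebesgue measure on
    [-K, K]. *)
Lemma exists_box_measure n (K : R) : exists m, @box_measure_spec n K m.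
Proof.
elim: n => [|n [m IH]].
  exists (\d_(0 : 'rV[R]_0)) => f [mf _] _ /=.
  rewrite /Rintegral integral_dirac//=; last exact/measurable_EFinP.
  by rewrite indicT mul1r.
have [l lP] := exists_interval_measure K.
have [m' m'E] := exists_image_measure (measurable_cons_rV (n := n)) (product_measure_finite l m).
exists m' => f bf f0.
rewrite (Rint_image (measurable_cons_rV (n := n)) (product_measure_finite l m) m'E bf).
rewrite -(Rint_prod l m (f := fun z => f (cons_rV z.1 z.2))); last first.
  exact: bounded_measurable_comp (measurable_cons_rV (n := n)) bf.
rewrite /=.
have -> : (fun t => integral_rV (fun x => f (cons_rV t x))) =
    fun t => \int[m]_x f (cons_rV t x).
  apply/funext => t; apply: IH => [|x i Ki].
    have H := bounded_measurable_comp (measurable_cons_rV (n := n)) bf.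
    exact: (bounded_measurable_pair1 t H).
  by apply: (f0 _ (rshift 1 i)); rewrite cons_rVS.
apply: lP => t tK.
rewrite (_ : (fun _ => _) = fun=> 0) ?Rintegral_cst ?mul0r//.
by apply/funext => x; apply: (f0 _ (lshift n (ord0 : 'I_1))); rewrite cons_rV0.
Qed.

End IntegralRV.

(** * Translation invariance and mollifiers *)

Section Translation.
Context {R : realType}.
Local Notation leb := (@lebesgue_measure R).

Lemma lebesgue_measure_shift (a : R) (A : set (measurableTypeR R)) : measurable A ->
  leb A = leb ((fun x : measurableTypeR R => x + a : measurableTypeR R) @^-1` A).
Proof.
move=> mA.
have ms : measurable_fun setT (fun x : measurableTypeR R => x + a : measurableTypeR R).
  exact: measurable_funD.
pose m := measure_function.measure_function_pushforward__canonical__measure_function_Measure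
  leb ms.
rewrite (@lebesgue_measure_unique _ m)// => _ [[b c]] _ <- /=.
rewrite /pushforward.
have -> : (fun x : measurableTypeR R => x + a : measurableTypeR R) @^-1` `]b, c]%classic =
    `]b - a, c - a]%classic.
  by apply/seteqP; split => x /=; rewrite !in_itv /= ltrBlDr lerBrDr.
rewrite !lebesgue_measure_itv /= !lte_fin ltrD2r -!EFinB.
by have -> : c - a - (b - a) = c - b by ring.
Qed.

(** Arguing on positive and negative parts separately, measurability alone is enough. *)
Lemma Rintegral_shift (g : R -> R) (a : R) : measurable_fun setT g ->
  \int[leb]_t g (t + a) = \int[leb]_t g t.
Proof.
move=> mg; rewrite /Rintegral; congr fine.
have ms : measurable_fun setT (fun x : measurableTypeR R => x + a : measurableTypeR R).
  exact: measurable_funD.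
have mG : measurable_fun setT (EFin \o g) by exact/measurable_EFinP.
rewrite integralE [RHS]integralE; congr (_ - _)%E; apply/esym.
  rewrite (ge0_integral_image ms (@lebesgue_measure_shift a)) => [|| t]; last 2 first.
  - exact: measurable_funepos.
  - exact: funepos_ge0.
  by apply: eq_integral => t _; rewrite !funeposE.
rewrite (ge0_integral_image ms (@lebesgue_measure_shift a)) => [|| t]; last 2 first.
- exact: measurable_funeneg.
- exact: funeneg_ge0.
by apply: eq_integral => t _; rewrite !funenegE.
Qed.

Definition box_supported n (K : R) (f : 'rV[R]_n -> R) :=
  forall (x : 'rV[R]_n) i, K < `|x 0 i| -> f x = 0.

Lemma bounded_measurable_cons n (f : 'rV[R]_n.+1 -> R) : bounded_measurable f ->
  bounded_measurable (fun z : measurableTypeR R * 'rV[R]_n => f (cons_rV z.1 z.2)).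
Proof. exact: (bounded_measurable_comp (measurable_cons_rV (n := n))). Qed.

Lemma bounded_measurable_cons2 n (f : 'rV[R]_n.+1 -> R) t : bounded_measurable f ->
  bounded_measurable (fun x => f (cons_rV t x)).
Proof.
move=> /bounded_measurable_cons bf.
exact: (@bounded_measurable_pair1 _ _ (measurableTypeR R) _ R _ t bf).
Qed.

Lemma box_supported_cons n K (f : 'rV[R]_n.+1 -> R) t : box_supported K f ->
  box_supported K (fun x => f (cons_rV t x)).
Proof. by move=> f0 x i Kx; apply: (f0 _ (rshift 1 i)); rewrite cons_rVS. Qed.

Lemma bounded_measurable_integral_rV n K (f : 'rV[R]_n.+1 -> R) :
  bounded_measurable f -> box_supported K f ->
  bounded_measurable (fun t : measurableTypeR R => integral_rV (fun x => f (cons_rV t x))).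
Proof.
move=> bf f0; have [m mP] := exists_box_measure n K.
rewrite (_ : (fun _ => _) = fun t => \int[m]_x f (cons_rV t x)).
  exact: (bounded_measurable_Rint2 (\d_(0 : measurableTypeR R)) m
            (bounded_measurable_cons bf)).
apply/funext => t; apply: mP; first exact: bounded_measurable_cons2.
exact: box_supported_cons.
Qed.

Lemma integral_rV_shift n K (f : 'rV[R]_n -> R) a :
  bounded_measurable f -> box_supported K f ->
  integral_rV (fun x => f (x + a)) = integral_rV f.
Proof.
elim: n f a => [|n IH] f a bf f0 /=.
  by congr f; apply/rowP => -[].
pose a' : 'rV[R]_(1 + n) := a.
pose G t := integral_rV (fun x => f (cons_rV t x)).
transitivity (\int[leb]_t G (t + a' 0 (lshift n ord0))).
  apply: eq_Rintegral => t _.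
  pose h y := f (cons_rV (t + a' 0 (lshift n ord0)) y).
  pose b : 'rV[R]_n := \row_i a' 0 (rshift 1 i).
  have -> : (fun x => f (cons_rV t x + a)) = fun x => h (x + b).
    apply/funext => x; congr f; apply/rowP => i.
    rewrite -(splitK (i : 'I_(1 + n))); case: (fintype.split _) => j /=.
      by rewrite cons_rV0 mxE cons_rV0 ord1.
    by rewrite cons_rVS mxE cons_rVS 2!mxE.
  by apply: IH; [exact: bounded_measurable_cons2|exact: box_supported_cons].
apply: Rintegral_shift.
by have [] := bounded_measurable_integral_rV bf f0.
Qed.

Lemma integral_rVZ n K (c : R) (f : 'rV[R]_n -> R) :
  bounded_measurable f -> box_supported K f ->
  integral_rV (fun x => c * f x) = c * integral_rV f.
Proof.
move=> bf f0; have [m mP] := exists_box_measure n K.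
rewrite (mP _ bf f0) mP; first by rewrite RintZ.
  by apply: bounded_measurableM => //; exact: bounded_measurable_cst.
by move=> x i Kx; rewrite (f0 x i Kx) mulr0.
Qed.

Lemma smooth_jet_bounded_measurable K (phi : nat -> R -> R) k : smooth_jet K phi ->
  bounded_measurable (phi k : measurableTypeR R -> R).
Proof.
move=> sphi; split.
  by apply: continuous_measurable_fun; exact: smooth_jet_continuous sphi.
by have [C _ HC] := smooth_jet_bounded k sphi; exists C.
Qed.

Lemma integral_rV_prod n K (phi : nat -> R -> R) : smooth_jet K phi ->
  integral_rV (@prod_jet R n (fun=> phi) (fun=> 0%N)) = (\int[leb]_t phi 0%N t) ^+ n.
Proof.
move=> sphi; elim: n => [|n IH] /=; first by rewrite /prod_jet big_ord0.
transitivity (\int[leb]_t (phi 0%N t * (\int[leb]_t phi 0%N t) ^+ n)).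
  apply: eq_Rintegral => t _; rewrite -IH -(@integral_rVZ _ K); last 2 first.
  - split; last first.
      have [C _ HC] := @prod_jet_bounded _ n K (fun=> phi) (fun=> 0%N) (fun=> sphi).
      by exists C.
    apply: continuous_measurable_rV.
    exact: (@prod_jet_continuous _ n K (fun=> phi) (fun=> 0%N) (fun=> sphi)).
  - by move=> x i Kx; apply: (@prod_jet_out _ _ K _ _ _ i (fun=> sphi)); exact: ltW.
  congr integral_rV; apply/funext => x.
  rewrite /prod_jet big_ord_recl; congr (_ * _).
    congr (phi _ _); rewrite -[RHS](@cons_rV0 _ n t x ord0).
    by congr (cons_rV t x _ _); exact: val_inj.
  apply: eq_bigr => i _; congr (phi _ _); rewrite -(@cons_rVS _ n t x i).
  by congr (cons_rV t x _ _); exact: val_inj.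
have [l lP] := exists_interval_measure K.
have bphi := smooth_jet_bounded_measurable 0 sphi.
rewrite exprSr (lP (phi 0%N)) => [|t tK]; last by rewrite sphi.2// ltW.
set c := _ ^+ n; rewrite (lP (fun t => phi 0%N t * c)) => [|t tK]; last first.
  by rewrite sphi.2 ?mul0r// ltW.
by under eq_Rintegral do rewrite mulrC; rewrite RintZ.
Qed.

(** Evenness is required so that the two arguments of the kernel can be exchanged, which moves the
    mollification from the observable to the measure. *)
Lemma exists_mollifier (e : R) : 0 < e ->
  exists phi : nat -> R -> R, [/\ smooth_jet e phi, forall x, 0 <= phi 0%N x,
    forall x, phi 0%N (- x) = phi 0%N x & \int[leb]_t phi 0%N t = 1].
Proof.
move=> e0.
have sb := scaled_bump_smooth 0 1 e0; rewrite normr0 add0r in sb.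
have [l lP] := exists_interval_measure e.
have bb := smooth_jet_bounded_measurable 0 sb.
have b0 x : 0 <= scaled_bump 0 e 1 0 x.
  by rewrite /scaled_bump expr0 !mul1r bump0_ge0.
pose I := \int[leb]_t scaled_bump 0 e 1 0 t.
have lE : I = \int[l]_t scaled_bump 0 e 1 0 t.
  by apply: lP => t te; rewrite sb.2// ltW.
have I0 : 0 < I.
  (* For |t| <= e / 2 one has 1 - (t / e)^2 >= 3 / 4, so the bump is at least exp(-4 / 3) >= exp(-4)
     there; its integral is therefore positive and can be normalised. *)
  pose g : R -> R := fun t => expR (- 4) * \1_[set` `[- (e / 2), e / 2]] t.
  have bg : bounded_measurable (g : measurableTypeR R -> R).
    split; first by apply: measurable_funM => //; exact: measurable_indic.
    exists (expR (- 4)) => t; rewrite normrM gtr0_norm ?expR_gt0// ger_pMr ?expR_gt0//.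
    by rewrite indicE; case: (_ \in _); rewrite ?normr1 ?normr0.
  apply: (@lt_le_trans _ _ (\int[leb]_t g t)).
    rewrite /Rintegral; under eq_integral do rewrite /g EFinM.
    rewrite integralZl//; last exact: integrable_indic_itv.
    rewrite integral_indic// setIT.
    rewrite [X in (_ * X)%E](_ : _ = e%:E).
      by rewrite -EFinM /= mulr_gt0 ?expR_gt0.
    apply: etrans (lebesgue_measure_itv _) _; rewrite /= lte_fin.
    by rewrite ifT -?EFinB; [congr (_%:E); field|lra].
  rewrite lE lP => [|t te]; last first.
    rewrite /g indicE memNset ?mulr0//= in_itv /= -ler_norml; apply/negP.
    by rewrite -ltNge (lt_trans _ te)//; lra.
  apply: le_Rint => // t; rewrite /g indicE.
  have [|] := boolP (t \in _); last by rewrite mulr0.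
  rewrite inE /= in_itv /= -ler_norml => te; rewrite mulr1.
  rewrite /scaled_bump expr0 !mul1r subr0 /smooth_bump /= hornerE mul1r /flat.
  have te2 : (t / e) ^+ 2 <= 1 / 4.
    rewrite -real_normK ?num_real// normrM normfV (gtr0_norm e0).
    have h1 : `|t| / e <= 1 / 2 by rewrite ler_pdivrMr//; lra.
    have h0 : 0 <= `|t| / e by rewrite divr_ge0// ltW.
    by nra.
  rewrite ifT; last by lra.
  rewrite expr0 invr1 mul1r ler_expR lerN2 invf_ple ?posrE//; lra.
exists (scaled_bump 0 e I^-1); split.
- by have := scaled_bump_smooth 0 I^-1 e0; rewrite normr0 add0r.
- move=> x; have := b0 x; rewrite /scaled_bump expr0 !mul1r mulr1 => ?.
  by rewrite mulr_ge0// invr_ge0 ltW.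
- by move=> x; rewrite /scaled_bump !subr0 mulNr /smooth_bump sqrrN /= !hornerE.
rewrite (lP (scaled_bump 0 e I^-1 0)) => [|t te]; last first.
  by have := (scaled_bump_smooth 0 I^-1 e0).2; rewrite normr0 add0r => ->//; exact: ltW.
rewrite (_ : scaled_bump 0 e I^-1 0 = fun t => I^-1 * scaled_bump 0 e 1 0 t).
  by rewrite RintZ// -lE mulVf// gt_eqF.
by apply/funext => t; rewrite /scaled_bump expr0 !mul1r mulr1.
Qed.

End Translation.

(** * Mollification and regularity of Sobolev functions *)

Section KernelEstimates.
Context {R : realType}.

Lemma smooth_jet_shift K K' (phi : nat -> R -> R) a :
  `|a| + K <= K' -> smooth_jet K phi -> smooth_jet K' (fun k s => phi k (s - a)).
Proof.
move=> aK [dphi phi0]; split => [k x|k x Kx]; last first.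
  by apply: phi0; have := lerB_dist x a; lra.
have d1 : is_derive x 1 (fun s : R => s - a) 1.
  apply: (@is_derive_quadratic _ _ _ _ _ _ 0) => h _.
  rewrite [h *: 1]mulr1 mul0r.
  by rewrite (_ : _ - _ = 0) ?normr0//; ring.
have := @is_derive1_comp R (phi k) (fun s => s - a) x _ _ (dphi k (x - a)) d1.
by rewrite mulr1.
Qed.

Context {n : nat}.
Implicit Types (phi : 'I_n -> nat -> R -> R) (al : 'I_n -> nat).

Lemma prod_jet_lipschitz K phi al : (forall i, smooth_jet K (phi i)) ->
  exists2 C : R, 0 <= C & forall x y : 'rV[R]_n,
    `|prod_jet phi al x - prod_jet phi al y| <= C * `|x - y|.
Proof.
move=> sphi.
have /choice[D HD] : forall i, exists C : R, 0 <= C /\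
    forall x : 'rV[R]_n, `|prod_jet phi (incr_at i al) x| <= C.
  by move=> i; have [C C0 HC] := prod_jet_bounded (incr_at i al) sphi; exists C.
have C0 : 0 <= \sum_i D i by apply: sumr_ge0 => i _; have [] := HD i.
exists ((\sum_i D i) * n%:R) => [|x y]; first by rewrite mulr_ge0.
apply: (@le_trans _ _ ((\sum_i D i) * \sum_i `|x 0 i - y 0 i|)).
  apply: (partial_bound_lipschitz (g := fun i => prod_jet phi (incr_at i al))).
    by move=> i z; exact: is_derive_prod_jet sphi.
  move=> i z _; apply: (le_trans ((HD i).2 z)).
  by rewrite (bigD1 i)//= lerDl sumr_ge0// => j _; have [] := HD j.
rewrite -mulrA ler_wpM2l//.
by have := sum_coord_le (x - y); under eq_bigr do rewrite !mxE.
Qed.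

(** Once its linear part at [y] is subtracted, the function has partial derivatives of size O(|w|)
    on the ball of radius |w| around [y], and the coordinatewise mean value bound gives a second
    factor |w|. *)
Lemma prod_jet_taylor K phi al : (forall i, smooth_jet K (phi i)) ->
  exists2 C : R, 0 <= C & forall y w : 'rV[R]_n,
    `|prod_jet phi al (y + w) - prod_jet phi al y -
      \sum_i prod_jet phi (incr_at i al) y * w 0 i| <= C * `|w| ^+ 2.
Proof.
move=> sphi.
have /choice[D HD] : forall i, exists C : R, 0 <= C /\
    forall x y : 'rV[R]_n, `|prod_jet phi (incr_at i al) x -
       prod_jet phi (incr_at i al) y| <= C * `|x - y|.
  by move=> i; have [C C0 HC] := prod_jet_lipschitz (incr_at i al) sphi; exists C.
have C0 : 0 <= \sum_i D i by apply: sumr_ge0 => i _; have [] := HD i.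
exists ((\sum_i D i) * n%:R) => [|y w]; first by rewrite mulr_ge0.
pose g x := prod_jet phi al x - \sum_i prod_jet phi (incr_at i al) y * x 0 i.
pose dg i x := prod_jet phi (incr_at i al) x - prod_jet phi (incr_at i al) y.
have -> : prod_jet phi al (y + w) - prod_jet phi al y -
      \sum_i prod_jet phi (incr_at i al) y * w 0 i = g (y + w) - g y.
  have E : \sum_i prod_jet phi (incr_at i al) y * (y + w) 0 i =
      \sum_i prod_jet phi (incr_at i al) y * y 0 i +
      \sum_i prod_jet phi (incr_at i al) y * w 0 i.
    by rewrite -big_split /=; apply: eq_bigr => i _; rewrite mxE mulrDr.
  by rewrite /g E; ring.
have -> : (\sum_i D i) * n%:R * `|w| ^+ 2 = ((\sum_i D i) * `|w|) * (n%:R * `|w|).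
  by ring.
apply: (@le_trans _ _ (((\sum_i D i) * `|w|) * \sum_i `|(y + w) 0 i - y 0 i|)).
  apply: (partial_bound_lipschitz (g := dg)) => [i z|i z zy].
    have -> : g = prod_jet phi al - (fun x => \sum_i prod_jet phi (incr_at i al) y * x 0 i).
      by [].
    apply: is_deriveB; first exact: is_derive_prod_jet sphi.
    apply: (@is_derive_quadratic _ _ _ _ _ _ 0) => h _.
    rewrite mul0r -sumrB (bigD1 i)//= big1 => [|j ji].
      by rewrite !mxE !eqxx /= mulr1 addr0 (_ : _ - _ = 0) ?normr0//; ring.
    by rewrite !mxE eqxx /= (negbTE ji) mulr0 add0r subrr.
  apply: (le_trans ((HD i).2 z y)); move: zy; rewrite addrAC subrr add0r => zy.
  apply: ler_pM => //; first by have [] := HD i.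
  by rewrite (bigD1 i)//= lerDl sumr_ge0// => j _; have [] := HD j.
rewrite ler_wpM2l ?mulr_ge0//.
have := sum_coord_le w; apply: le_trans; apply: ler_sum => i _.
by rewrite mxE addrAC subrr add0r.
Qed.

End KernelEstimates.

Section Mollification.
Context {R : realType} {n : nat}.
Local Notation leb := (@lebesgue_measure R).
Variables (e : R) (phi : nat -> R -> R).
Hypotheses (e0 : 0 <= e) (sphi : smooth_jet e phi) (phi_ge0 : forall x, 0 <= phi 0%N x)
  (phi1 : \int[leb]_t phi 0%N t = 1).

Definition prod_kernel (al : 'I_n -> nat) : 'rV[R]_n -> R := prod_jet (fun=> phi) al.
Local Notation al0 := (fun=> 0%N : nat).

Lemma kernel_shiftE al (x y : 'rV[R]_n) :
  prod_kernel al (y - x) = prod_jet (fun i k s => phi k (s - x 0 i)) al y.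
Proof. by apply: eq_bigr => i _; rewrite !mxE. Qed.

Lemma kernel_shift_jet (x : 'rV[R]_n) i :
  smooth_jet (`|x| + e) (fun k s => phi k (s - x 0 i)).
Proof. by apply: smooth_jet_shift sphi; rewrite lerD2r normrV_ge. Qed.

Lemma kernel_ge0 x : 0 <= prod_kernel al0 x.
Proof. exact: prodr_ge0. Qed.

Lemma kernel_bounded al : exists2 C : R, 0 <= C & forall x, `|prod_kernel al x| <= C.
Proof. exact: (prod_jet_bounded al (fun=> sphi)). Qed.

Lemma kernel_out al (x : 'rV[R]_n) : e < `|x| -> prod_kernel al x = 0.
Proof.
move=> ex; have [i xi] : exists i, e <= `|x 0 i|.
  apply: contrapT => /forallNP xe; move: ex; apply/negP; rewrite -leNgt.
  by apply: normrV_le => // i; have /negP := xe i; rewrite -ltNge => /ltW.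
exact: (@prod_jet_out _ _ e _ _ _ i (fun=> sphi)).
Qed.

Lemma bounded_measurable_kernel al (x : 'rV[R]_n) :
  bounded_measurable (fun y : 'rV[R]_n => prod_kernel al (y - x)).
Proof.
split; last by have [C _ HC] := kernel_bounded al; exists C.
rewrite (_ : (fun _ => _) = prod_jet (fun i k s => phi k (s - x 0 i)) al).
  apply: continuous_measurable_rV.
  exact: prod_jet_continuous (kernel_shift_jet x).
by apply/funext => y; rewrite kernel_shiftE.
Qed.

Lemma box_supported_kernel al (x : 'rV[R]_n) K (f : 'rV[R]_n -> R) : `|x| + e <= K ->
  box_supported K (fun y => f y * prod_kernel al (y - x)).
Proof.
move=> xK y i Ky; rewrite kernel_shiftE.
rewrite (@prod_jet_out _ _ _ _ _ _ i (kernel_shift_jet x)) ?mulr0//.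
exact: le_trans xK (ltW Ky).
Qed.

Lemma box_supported_kernel1 al (x : 'rV[R]_n) K : `|x| + e <= K ->
  box_supported K (fun y => prod_kernel al (y - x)).
Proof.
move=> xK y i Ky; rewrite -[LHS]mul1r.
exact: (@box_supported_kernel al x K (fun=> 1) xK y i Ky).
Qed.

Definition moll (f : 'rV[R]_n -> R) (x : 'rV[R]_n) : R :=
  integral_rV (fun y => f y * prod_kernel al0 (y - x)).

Lemma integral_kernel (x : 'rV[R]_n) : integral_rV (fun y => prod_kernel al0 (y - x)) = 1.
Proof.
rewrite (@integral_rV_shift _ n e (prod_kernel al0)).
- by rewrite /prod_kernel (integral_rV_prod n sphi) phi1 expr1n.
- by have := bounded_measurable_kernel al0 0; under eq_fun do rewrite subr0.
- move=> y i ye; apply: (@prod_jet_out _ _ e _ _ _ i (fun=> sphi)); exact: ltW.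
Qed.

Lemma moll_bound (f : 'rV[R]_n -> R) (M : R) x : bounded_measurable f -> (forall y, `|f y| <= M) ->
  `|moll f x| <= M.
Proof.
move=> bf fM; have [m mP] := exists_box_measure n (`|x| + e).
have bk := bounded_measurable_kernel al0 x.
rewrite /moll mP; [|exact: bounded_measurableM|exact: box_supported_kernel].
have <- : M * integral_rV (fun y => prod_kernel al0 (y - x)) = M.
  by rewrite integral_kernel mulr1.
rewrite mP//; last exact: box_supported_kernel1.
rewrite -RintZ//; apply: le_norm_Rint.
- exact: bounded_measurableM.
- by apply: bounded_measurableM => //; exact: bounded_measurable_cst.
- by move=> y; rewrite normrM [`|prod_kernel _ _|]ger0_norm ?kernel_ge0// ler_wpM2r ?kernel_ge0.
Qed.

Lemma moll_close (f : 'rV[R]_n -> R) (x : 'rV[R]_n) (r : R) : bounded_measurable f -> 0 <= r ->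
  (forall y, `|y - x| <= e -> `|f y - f x| <= r) -> `|moll f x - f x| <= r.
Proof.
move=> bf r0 fr.
have [m mP] := exists_box_measure n (`|x| + e).
have bk := bounded_measurable_kernel al0 x.
have bc := bounded_measurable_cst.
have IE (c : R) : \int[m]_y (c * prod_kernel al0 (y - x)) = c.
  by rewrite RintZ// -mP ?integral_kernel ?mulr1//; exact: box_supported_kernel1.
rewrite /moll mP; [|exact: bounded_measurableM|exact: box_supported_kernel].
rewrite -[f x in X in _ - X]IE -RintB; try exact: bounded_measurableM.
rewrite -[r]IE; apply: le_norm_Rint.
- by apply: bounded_measurableB; exact: bounded_measurableM.
- exact: bounded_measurableM.
move=> y; rewrite -mulrBl normrM [`|prod_kernel _ _|]ger0_norm ?kernel_ge0//.
have [ye|ye] := leP `|y - x| e.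
  by rewrite ler_wpM2r ?kernel_ge0// fr.
by rewrite kernel_out// !mulr0.
Qed.

(** Differentiating k(y - x) in [x] instead of [y] costs a sign, which cancels the one of the weak
    derivative tested against y |-> k(y - x). *)
Lemma is_derive_moll (f g : 'rV[R]_n -> R) i (x : 'rV[R]_n) :
  bounded_measurable f -> weak_partial i f g ->
  is_derive x (delta_mx 0 i) (moll f) (moll g x).
Proof.
move=> bf fg.
have bk := bounded_measurable_kernel.
have [M fM] := bf.2.
have M0 : 0 <= M by exact: le_trans (fM 0).
have [C C0 HC] := prod_jet_taylor al0 (fun=> sphi) (n := n).
(* The extra 1 leaves room for the kernels centred at all points x + h e_i with |h| <= 1, so that
   one finite measure serves every difference quotient. *)
have [m mP] := exists_box_measure n (`|x| + 1 + e).
have -> : moll g x = - \int[m]_y (f y * prod_kernel (incr_at i al0) (y - x)).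
  rewrite -mP; last 2 first.
  - exact: bounded_measurableM.
  - by apply: box_supported_kernel; rewrite lerD2r lerDl.
  have := fg _ (prod_jet_test_function al0 (kernel_shift_jet x)).
  rewrite /moll => /(congr1 -%R); rewrite opprK => E.
  transitivity (- integral_rV
    (fun y => f y * partial i (prod_jet (fun i k s => phi k (s - x 0 i)) al0) y)).
    by rewrite E; congr integral_rV; apply/funext => y; rewrite kernel_shiftE.
  congr (- integral_rV _); apply/funext => y; rewrite kernel_shiftE.
  by have [_ <-] := is_derive_prod_jet al0 i y (kernel_shift_jet x).
apply: (@is_derive_quadratic _ _ _ _ _ _ (M * C * fine (m setT))) => h h1.
have hn : `|h *: delta_mx 0 i : 'rV[R]_n| <= `|h|.
  apply: normrV_le => // j; rewrite !mxE eqxx /=.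
  by case: (j == i); rewrite ?mulr1// mulr0 normr0.
rewrite /moll mP; last 2 first.
- exact: bounded_measurableM.
- apply: box_supported_kernel; rewrite lerD2r (le_trans (ler_normD _ _))// addrC lerD2l.
  exact: le_trans hn h1.
rewrite mP; last 2 first.
- exact: bounded_measurableM.
- by apply: box_supported_kernel; rewrite lerD2r lerDl.
rewrite mulrN opprK -RintZ; last exact: bounded_measurableM.
rewrite -RintB; try exact: bounded_measurableM.
rewrite -RintD; last 2 first.
- by apply: bounded_measurableB; exact: bounded_measurableM.
- by apply: bounded_measurableM; [exact: bounded_measurable_cst|exact: bounded_measurableM].
rewrite mulrAC; apply: le_norm_Rint_cst.
  apply: bounded_measurableD.
    by apply: bounded_measurableB; exact: bounded_measurableM.
  by apply: bounded_measurableM; [exact: bounded_measurable_cst|exact: bounded_measurableM].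
move=> y.
have := HC (y - x) (- (h *: delta_mx 0 i)).
rewrite (bigD1 i)//= big1 => [|j ji]; last first.
  by rewrite !mxE eqxx (negbTE ji) /= mulr0 oppr0 mulr0.
rewrite addr0 !mxE !eqxx mulr1 normrN => H.
have -> : f y * prod_kernel al0 (y - (h *: delta_mx 0 i + x)) - f y * prod_kernel al0 (y - x) +
    h * (f y * prod_kernel (incr_at i al0) (y - x)) =
  f y * (prod_kernel al0 (y - x - h *: delta_mx 0 i) - prod_kernel al0 (y - x) -
   prod_kernel (incr_at i al0) (y - x) * - h).
  by rewrite [h *: _ + x]addrC opprD addrA; ring.
rewrite normrM -mulrA ler_pM//; apply: (le_trans H).
rewrite ler_wpM2l// -[leRHS]real_normK ?num_real// ler_sqr ?nnegrE//.
Qed.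

End Mollification.

Lemma cvg_inv_rate (R : realType) (V : completeNormedModType R) (u : nat -> V) (C : R) :
  0 <= C -> (forall p q, `|u p - u q| <= C * (p.+1%:R^-1 + q.+1%:R^-1)) ->
  exists l, forall p, `|u p - l| <= C * p.+1%:R^-1.
Proof.
move=> C0 uC.
have small e : 0 < e -> \forall q \near \oo, C * q.+1%:R^-1 <= e.
  move=> e0; have e1 : 0 < e / (C + 1) by rewrite divr_gt0// ltr_wpDl.
  have := near_infty_natSinv_lt (PosNum e1); apply: filterS => q /= /ltW qe.
  apply: (@le_trans _ _ (C * (e / (C + 1)))); first by rewrite ler_wpM2l.
  by rewrite mulrCA ger_pMr// ler_pdivrMr ?ltr_wpDl// mul1r lerDl.
have cu : cvg (u @ \oo).
  apply/cauchy_cvgP/cauchy_exP => e e0.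
  have e2 : 0 < e / 4 by rewrite divr_gt0.
  have /= [N _ HN] := small _ e2.
  exists (u N); exists N => // p /= Np; rewrite -ball_normE /ball_ /=.
  apply: (le_lt_trans (uC N p)); rewrite mulrDr.
  move: (HN p Np) (HN N (leqnn N)) => /=.
  by move: (C / N.+1%:R) (C / p.+1%:R) => a b h1 h2; lra.
exists (lim (u @ \oo)) => p; apply/ler_addgt0Pr => e e0.
have e2 : 0 < e / 2 by rewrite divr_gt0.
have /= [q [qe ql]] : exists q, C * q.+1%:R^-1 <= e / 2 /\ `|lim (u @ \oo) - u q| <= e / 2.
  have := cu => /cvgrPdist_le /(_ _ e2) H.
  have [q [? ?]] := filter_ex (filterI (small _ e2) H).
  by exists q.
rewrite -(subrKA (u q)) (le_trans (ler_normD _ _))//.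
rewrite [`|u q - _|]distrC; have := uC p q; rewrite mulrDr; move: qe.
by move: (C / q.+1%:R) (C / p.+1%:R) => a b h1 h2; lra.
Qed.

Lemma le_of_quadratic (R : realFieldType) (A B C : R) :
  (forall s, 0 < s -> s * A <= s * B + C * s ^+ 2) -> A <= B.
Proof.
move=> H; apply/ler_addgt0Pr => e e0.
have C1 : 0 < `|C| + 1 by rewrite ltr_wpDl.
have s0 : 0 < e / (`|C| + 1) by rewrite divr_gt0.
have := H _ s0; rewrite expr2 mulrCA -mulrDr ler_pM2l// => /le_trans; apply.
rewrite lerD2l mulrA ler_pdivrMr// mulrC ler_pM2l//.
by rewrite (le_trans (ler_norm C))// lerDl.
Qed.

(** * Differentiability from smooth approximations with uniform bounds *)

Section SobolevRegularity.
Context {R : realType} {n : nat}.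
Variables (f : 'rV[R]_n -> R) (M : R).
Hypotheses (M0 : 0 <= M)
  (fM : forall e : R, 0 < e -> exists (F : 'rV[R]_n -> R) (G : 'I_n -> 'rV[R]_n -> R),
    [/\ forall (x : 'rV[R]_n) (r : R), 0 <= r -> (forall y, `|y - x| <= e -> `|f y - f x| <= r) ->
          `|F x - f x| <= r,
        forall i x, is_derive x (delta_mx 0 i) F (G i x),
        forall i x, `|G i x| <= M &
        forall i x y, `|G i x - G i y| <= M * `|x - y|])
  (cf : continuous f).

Let taylor (F : 'rV[R]_n -> R) (G : 'rV[R]_n -> R) i x s :
  (forall x, is_derive x (delta_mx 0 i) F (G x)) ->
  (forall x y, `|G x - G y| <= M * `|x - y|) ->
  `|F (s *: delta_mx 0 i + x) - F x - s * G x| <= M * s ^+ 2.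
Proof.
move=> FG GM.
have := @mean_value_bound R (fun s => F (s *: delta_mx 0 i + x) - s * G x)
  (fun s => G (s *: delta_mx 0 i + x) - G x) 0 s (M * `|s|).
rewrite scale0r add0r mul0r !subr0 -mulrA -expr2 real_normK ?num_real//.
have E : F (s *: delta_mx 0 i + x) - F x - s * G x =
  F (s *: delta_mx 0 i + x) - s * G x - F x by ring.
rewrite E; apply => [t|t]; last rewrite subr0 => ts.
  have d1 := is_derive_along (FG (t *: delta_mx 0 i + x)).
  apply: (is_deriveB d1).
  apply: (@is_derive_quadratic _ _ _ _ _ _ 0) => h _.
  by rewrite [h *: 1]mulr1 mul0r (_ : _ - _ = 0) ?normr0//; ring.
apply: (le_trans (GM _ _)); rewrite addrK ler_wpM2l//.
apply: (@le_trans _ _ `|t|) => //; apply: normrV_le => // j.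
by rewrite !mxE eqxx /=; case: (j == i); rewrite ?mulr1// mulr0 normr0.
Qed.

(** Two base points and two increments share the same [G]: this is what allows difference quotients
    of [f] to be compared with each other. *)
Let approx i x s x' s' (r : R) : 0 < r -> exists G : 'rV[R]_n -> R,
  [/\ forall y, `|G y| <= M, forall y z, `|G y - G z| <= M * `|y - z|,
      `|f (s *: delta_mx 0 i + x) - f x - s * G x| <= M * s ^+ 2 + r &
      `|f (s' *: delta_mx 0 i + x') - f x' - s' * G x'| <= M * s' ^+ 2 + r].
Proof.
move=> r0.
have r2 : 0 < r / 2 by rewrite divr_gt0.
have ce (y : 'rV[R]_n) : \forall e \near 0^'+, forall z, `|z - y| <= e -> `|f z - f y| <= r / 2.
  have := cf (x := y) => /cvgrPdist_le /(_ _ r2) /nbhs_ballP [e /= e0 eP].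
  have := nbhs_right_lt e0; apply: filterS => d de z zd; rewrite distrC; apply: eP.
  by rewrite -ball_normE /ball_ /= distrC (le_lt_trans zd).
have [e [/= e0 [[h1 h2] [h3 h4]]]] := filter_ex (filterI (nbhs_right_gt (0 : R))
  (filterI (filterI (ce (s *: delta_mx 0 i + x)) (ce x))
    (filterI (ce (s' *: delta_mx 0 i + x')) (ce x')))).
have [F [G [FF FG GM GL]]] := fM e0.
exists (G i); split => //.
  have := taylor x s (FG i) (GL i).
  have := FF _ _ (ltW r2) h1; have := FF _ _ (ltW r2) h2.
  rewrite !ler_norml => /andP[? ?] /andP[? ?] /andP[? ?]; apply/andP; split; lra.
have := taylor x' s' (FG i) (GL i).
have := FF _ _ (ltW r2) h3; have := FF _ _ (ltW r2) h4.
rewrite !ler_norml => /andP[? ?] /andP[? ?] /andP[? ?]; apply/andP; split; lra.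
Qed.

(** The quotients with steps s and s' are within M |s| and M |s'| of the same number G(x), up to an
    arbitrarily small error; they are thus Cauchy as the step tends to 0. *)
Let deriv i x : exists l : R, forall s,
  `|f (s *: delta_mx 0 i + x) - f x - s * l| <= M * s ^+ 2.
Proof.
pose q (s : R) := (f (s *: delta_mx 0 i + x) - f x) / s.
have qq s s' : 0 < s -> s' != 0 -> `|q s - q s'| <= M * (s + `|s'|).
  move=> s0 s'0; apply/ler_addgt0Pr => r r0.
  have s'1 : 0 < `|s'| by rewrite normr_gt0.
  (* After division by the step, each of the two approximation errors is at most r / 2. *)
  pose r' := Num.min (r / 2 * s) (r / 2 * `|s'|).
  have r'0 : 0 < r' by rewrite lt_min !mulr_gt0.
  have [G [_ _ h1 h2]] := approx i x s x s' r'0.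
  have {}h1 : `|q s - G x| <= M * s + r / 2.
    have -> : q s - G x = (f (s *: delta_mx 0 i + x) - f x - s * G x) / s.
      by rewrite /q; field; rewrite gt_eqF.
    rewrite normrM normfV (gtr0_norm s0) ler_pdivrMr//; apply: (le_trans h1).
    by rewrite mulrDl -mulrA -expr2 lerD2l ge_min lexx.
  have {}h2 : `|q s' - G x| <= M * `|s'| + r / 2.
    have -> : q s' - G x = (f (s' *: delta_mx 0 i + x) - f x - s' * G x) / s'.
      by rewrite /q; field.
    rewrite normrM normfV ler_pdivrMr//; apply: (le_trans h2).
    by rewrite mulrDl -mulrA -expr2 real_normK ?num_real// lerD2l ge_min lexx orbT.
  rewrite -(subrKA (G x)) (le_trans (ler_normD _ _))// [`|G x - _|]distrC mulrDr.
  by lra.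
have [l lP] : exists l : R, forall p, `|q p.+1%:R^-1 - l| <= M * p.+1%:R^-1.
  apply: (@cvg_inv_rate R R) => // p p'.
  have := @qq p.+1%:R^-1 p'.+1%:R^-1.
  by rewrite invr_gt0 ltr0n invr_eq0 pnatr_eq0 [`|_^-1|]ger0_norm ?invr_ge0//; exact.
exists l => s; have [->|s0] := eqVneq s 0.
  by rewrite scale0r add0r subrr mul0r subrr normr0 expr0n mulr0.
have s1 : 0 < `|s| by rewrite normr_gt0.
have ql : `|q s - l| <= M * `|s|.
  apply/ler_addgt0Pr => r r0.
  have C1 : 0 < 2 * M + 1 by rewrite ltr_wpDl// mulr_ge0.
  have r1 : 0 < r / (2 * M + 1) by rewrite divr_gt0.
  have [p /= /ltW pr] := filter_ex (near_infty_natSinv_lt (PosNum r1)).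
  have p0 : 0 < p.+1%:R^-1 :> R by rewrite invr_gt0 ltr0n.
  have := qq _ s p0 s0; have := lP p; set a := p.+1%:R^-1 in pr p0 *.
  rewrite [`|q a - q s|]distrC => h1 h2.
  rewrite -(subrKA (q a)) (le_trans (ler_normD _ _))//.
  have h3 : a * (2 * M + 1) <= r by rewrite -ler_pdivlMr.
  nra.
have -> : f (s *: delta_mx 0 i + x) - f x - s * l = s * (q s - l).
  by rewrite /q; field.
by rewrite normrM -real_normK ?num_real// expr2 mulrCA ler_pM2l.
Qed.

(** At each point, the remainders of [f] for its derivative and for [G] contribute M s^2 each, which
    explains 2 M for one point and 4 M for two; dividing by s and letting it tend to 0 transfers the
    bounds from [G] to the derivative. *)
Lemma partial_lipschitz_of_approx i :
  (forall x, `|partial i f x| <= M) /\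
  (forall x y, `|partial i f x - partial i f y| <= M * `|x - y|).
Proof.
have dP x : forall s, `|f (s *: delta_mx 0 i + x) - f x - s * partial i f x| <= M * s ^+ 2.
  have [l lP] := deriv i x.
  suff -> : partial i f x = l by [].
  by have [] := @is_derive_quadratic _ _ f x (delta_mx 0 i) l M (fun s _ => lP s).
split=> [x|x y].
  apply: (@le_of_quadratic _ _ _ (2 * M)) => s s0; apply/ler_addgt0Pr => r r0.
  have [G [GM _ h _]] := approx i x s x s r0.
  rewrite -{1}(gtr0_norm s0) -normrM.
  have := dP x s; have := GM x; move: h; rewrite !ler_norml.
  by move=> /andP[? ?] /andP[? ?] /andP[? ?]; apply/andP; split; nra.
apply: (@le_of_quadratic _ _ _ (4 * M)) => s s0; apply/ler_addgt0Pr => r r0.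
have r2 : 0 < r / 2 by rewrite divr_gt0.
have [G [_ GL h1 h2]] := approx i x s y s r2.
rewrite -{1}(gtr0_norm s0) -normrM.
have := dP x s; have := dP y s; have := GL x y; move: h1 h2.
have : 0 <= M * `|x - y| by rewrite mulr_ge0.
move: (M * `|x - y|) => B; rewrite !ler_norml => B0.
by move=> /andP[? ?] /andP[? ?] /andP[? ?] /andP[? ?] /andP[? ?]; apply/andP; split; nra.
Qed.

End SobolevRegularity.

(** Mollifying [f] at scale e gives a function whose derivatives are the mollified weak derivatives,
    and these are bounded and Lipschitz independently of e. *)
Lemma sobolev2oo_grad (R : realType) n (f : 'rV[R]_n -> R) : sobolev2oo f ->
  exists2 M : R, 0 <= M & forall i,
    (forall x, `|partial i f x| <= M) /\
    (forall x y, `|partial i f x - partial i f y| <= M * `|x - y|).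
Proof.
move=> [cf [bf [g [h [gP hP]]]]].
have /choice[A HA] : forall i, exists C : R, 0 <= C /\ forall x, `|g i x| <= C.
  move=> i; have [[_ [C HC]] _] := gP i; exists C; split => //.
  exact: le_trans (HC 0).
have /choice[B HB] : forall ij : 'I_n * 'I_n, exists C : R, 0 <= C /\
    forall x, `|h ij.1 ij.2 x| <= C.
  move=> [i j]; have [[_ [C HC]] _] := hP i j; exists C; split => //.
  exact: le_trans (HC 0).
pose a := \sum_i A i; pose b := \sum_ij B ij.
have a0 : 0 <= a by apply: sumr_ge0 => i _; have [] := HA i.
have b0 : 0 <= b by apply: sumr_ge0 => i _; have [] := HB i.
have ga i x : `|g i x| <= a.
  apply: (le_trans ((HA i).2 x)); rewrite /a (bigD1 i)//= lerDl sumr_ge0// => j _.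
  by have [] := HA j.
have hb i j x : `|h i j x| <= b.
  apply: (le_trans ((HB (i, j)).2 x)); rewrite /b (bigD1 (i, j))//= lerDl sumr_ge0// => ij _.
  by have [] := HB ij.
(* Here [a] bounds the first weak derivatives and [b] the second ones; the factor n converts a sum
   over coordinates into the sup norm. *)
exists (a + b * n%:R) => [|i]; first by rewrite addr_ge0// mulr_ge0.
apply: partial_lipschitz_of_approx => //; first by rewrite addr_ge0// mulr_ge0.
move=> e e0; have [phi [sphi phi_ge0 _ phi1]] := exists_mollifier e0.
exists (moll phi f), (fun j => moll phi (g j)); split.
- by move=> x r r0; exact: (moll_close (ltW e0) sphi phi_ge0 phi1 bf r0).
- by move=> j x; apply: (is_derive_moll sphi) => //; have [] := gP j.
- move=> j x; apply: (@le_trans _ _ a); last by rewrite lerDl mulr_ge0.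
  by apply: (moll_bound sphi phi_ge0 phi1) => //; have [] := gP j.
- move=> j x y; apply: (@le_trans _ _ (b * \sum_k `|x 0 k - y 0 k|)).
    apply: (partial_bound_lipschitz (g := fun k => moll phi (h j k))).
      move=> k z; apply: (is_derive_moll sphi); first by have [] := gP j.
      by have [] := hP j k.
    by move=> k z _; apply: (moll_bound sphi phi_ge0 phi1) => //; have [] := hP j k.
  apply: (@le_trans _ _ (b * n%:R * `|x - y|)); last by rewrite ler_wpM2r// lerDr.
  rewrite -mulrA ler_wpM2l//.
  by have := sum_coord_le (x - y); under eq_bigr do rewrite !mxE.
Qed.

(** * Wasserstein continuity *)

Section EuclideanNorm.
Context {R : realType} {n : nat}.
Implicit Types x y : 'rV[R]_n.

Lemma sqnorm_ge0 x : 0 <= sqnorm x.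
Proof. by apply: sumr_ge0 => i _; exact: sqr_ge0. Qed.

Lemma sqr_normrV_le_sqnorm x : `|x| ^+ 2 <= sqnorm x.
Proof.
suff : `|x| <= Num.sqrt (sqnorm x).
  by rewrite -ler_sqr ?nnegrE ?sqrtr_ge0// sqr_sqrtr// sqnorm_ge0.
apply: normrV_le => [|i]; first exact: sqrtr_ge0.
rewrite -sqrtr_sqr ler_sqrt ?sqnorm_ge0// /sqnorm (bigD1 i)//= lerDl.
by apply: sumr_ge0 => j _; exact: sqr_ge0.
Qed.

Lemma sqnorm_le x : sqnorm x <= n%:R * `|x| ^+ 2.
Proof.
apply: (@le_trans _ _ (\sum_(i < n) `|x| ^+ 2)).
  by apply: ler_sum => i _; rewrite -real_normK ?num_real// ler_sqr ?nnegrE// normrV_ge.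
by rewrite sumr_const card_ord mulr_natl.
Qed.

Lemma continuous_sqnorm : continuous (@sqnorm R n).
Proof.
rewrite (_ : @sqnorm R n = \sum_(i < n) (fun x => x 0 i ^+ 2)).
  elim/big_ind: _ => [x|f g cf cg x|i _ x].
  - exact: cst_continuous.
  - by apply: continuousD; [exact: cf|exact: cg].
  - by apply: continuousM; exact: coord_continuous.
by apply/funext => x; rewrite /sqnorm; elim/big_rec2: _ => // i a b _ ->.
Qed.

Lemma measurable_sqnormB : measurable_fun setT
  (fun z : 'rV[R]_n * 'rV[R]_n => sqnorm (z.1 - z.2)).
Proof.
apply: (measurableT_comp (continuous_measurable_rV continuous_sqnorm)).
apply: measurable_fun_rV => i.
rewrite (_ : (fun _ => _) = (fun z : 'rV[R]_n * 'rV[R]_n => z.1 0 i - z.2 0 i)).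
  apply: measurable_funB; apply: (measurableT_comp (measurable_coord i)) => //.
by apply/funext => z; rewrite !mxE.
Qed.

Lemma lipschitz_continuous (f : 'rV[R]_n -> R) (K : R) :
  (forall x y, `|f x - f y| <= K * `|x - y|) -> continuous f.
Proof.
move=> fK x; apply: (iffRL (@cvgrPdist_le _ _ _ _ (nbhs_filter x) f (f x))) => e e0.
have K1 : 0 < `|K| + 1 by rewrite ltr_wpDl.
near=> y; apply: (le_trans (fK x y)).
have xy : `|x - y| <= e / (`|K| + 1).
  near: y; apply/nbhs_ballP; exists (e / (`|K| + 1)); first by rewrite /= divr_gt0.
  by move=> y; rewrite -ball_normE /ball_ /= => /ltW.
apply: (@le_trans _ _ ((`|K| + 1) * (e / (`|K| + 1)))).
  apply: (@le_trans _ _ ((`|K| + 1) * `|x - y|)); last by rewrite ler_wpM2l// ltW.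
  by rewrite ler_wpM2r// (le_trans (ler_norm K))// lerDl.
by rewrite mulrC divfK// gt_eqF.
Unshelve. all: by end_near. Qed.

End EuclideanNorm.

Section Wasserstein.
Context {R : realType} {n : nat}.
Implicit Types mu xi : probability 'rV[R]_n R.

Lemma wasserstein2_sqr mu xi : (wasserstein2 mu xi ^+ 2 =
  ereal_inf [set (\int[gamma]_z (sqnorm (z.1 - z.2)%R)%:E) |
             gamma in [set gamma | coupling mu xi gamma]])%E.
Proof.
rewrite sqr_sqrte//; apply/ereal_infP => _ [gamma _ <-].
by apply: integral_ge0 => z _; rewrite lee_fin sqnorm_ge0.
Qed.

(** Instead of Cauchy-Schwarz, the inequality |x - y| <= d / 2 + |x - y|^2 / (2 d) is integrated
    against the coupling. *)
Lemma coupling_lipschitz mu xi (gamma : probability ('rV[R]_n * 'rV[R]_n)%type R)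
    (d : R) (f : 'rV[R]_n -> R) (K : R) :
  coupling mu xi gamma -> 0 < d ->
  (\int[gamma]_z (sqnorm (z.1 - z.2)%R)%:E <= (d ^+ 2)%:E)%E ->
  bounded_measurable f -> 0 <= K -> (forall x y, `|f x - f y| <= K * `|x - y|) ->
  `|\int[mu]_x f x - \int[xi]_x f x| <= K * d.
Proof.
move=> cg d0 gd bf K0 fK.
have fin1 : (gamma setT < +oo)%E by rewrite probability_setT ltry.
have mE A : measurable A -> mu A = gamma (fst @^-1` A).
  move=> mA; rewrite -(cg A mA).1; congr (gamma _).
  by apply/seteqP; split=> z /= => [[]|].
have xE A : measurable A -> xi A = gamma (snd @^-1` A).
  move=> mA; rewrite -(cg A mA).2; congr (gamma _).
  by apply/seteqP; split=> z /= => [[]|].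
rewrite (Rint_image measurable_fst fin1 mE bf) (Rint_image measurable_snd fin1 xE bf).
have b1 := bounded_measurable_comp (@measurable_fst _ _ 'rV[R]_n 'rV[R]_n) bf.
have b2 := bounded_measurable_comp (@measurable_snd _ _ 'rV[R]_n 'rV[R]_n) bf.
rewrite -RintB//; have bB := bounded_measurableB b1 b2.
apply: (le_trans (le_normr_Rintegral measurableT (bounded_measurable_integrable gamma bB))).
rewrite -lee_fin -(Rint_EFin gamma (bounded_measurable_norm bB)).
(* Chosen so that a + b d^2 = K d. *)
pose a := K * (d / 2); pose b := K / (2 * d).
have a0 : 0 <= a by rewrite mulr_ge0// divr_ge0// ltW.
have b0 : 0 <= b by rewrite divr_ge0// mulr_ge0// ltW.
have ms : measurable_fun setT (fun z : 'rV[R]_n * 'rV[R]_n => (sqnorm (z.1 - z.2))%:E).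
  by apply/measurable_EFinP; exact: measurable_sqnormB.
apply: (@le_trans _ _ (\int[gamma]_z (a%:E + b%:E * (sqnorm (z.1 - z.2)%R)%:E))%E).
  apply: ge0_le_integral => //.
  - by apply/measurable_EFinP; have [] := bounded_measurable_norm bB.
  - apply: emeasurable_funD => //; exact: measurable_funeM.
  move=> z _; rewrite -EFinM -EFinD lee_fin; apply: (le_trans (fK _ _)).
  apply: (@le_trans _ _ (K * (d / 2 + sqnorm (z.1 - z.2) / (2 * d)))); last first.
    by rewrite /a /b mulrDr lerD2l [leRHS]mulrAC [leLHS]mulrA.
  rewrite ler_wpM2l//; have := sqr_normrV_le_sqnorm (z.1 - z.2).
  move: `|_| (sqnorm _) => x s xs.
  have -> : d / 2 + s / (2 * d) = (d ^+ 2 + s) / (2 * d) by field; rewrite gt_eqF.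
  rewrite ler_pdivlMr ?mulr_gt0//; have := sqr_ge0 (x - d); nra.
rewrite ge0_integralD//; last 2 first.
- by move=> z _; rewrite -EFinM lee_fin mulr_ge0// sqnorm_ge0.
- exact: measurable_funeM.
have -> : (\int[gamma]_z a%:E = a%:E * gamma setT)%E by exact: integral_cst.
rewrite probability_setT mule1 ge0_integralZl//; last first.
  by move=> z _; rewrite lee_fin sqnorm_ge0.
apply: (@le_trans _ _ (a%:E + b%:E * (d ^+ 2)%:E)%E).
  by rewrite leeD2l// lee_wpmul2l// lee_fin.
rewrite -EFinM -EFinD lee_fin /a /b.
by rewrite le_eqVlt; apply/orP; left; apply/eqP; field; rewrite gt_eqF.
Qed.

Lemma wasserstein2_lipschitz mu xi (d : R) (f : 'rV[R]_n -> R) (K : R) :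
  (wasserstein2 mu xi < d%:E)%E -> 0 < d ->
  bounded_measurable f -> 0 <= K -> (forall x y, `|f x - f y| <= K * `|x - y|) ->
  `|\int[mu]_x f x - \int[xi]_x f x| <= K * d.
Proof.
move=> Wd d0 bf K0 fK.
have : (wasserstein2 mu xi ^+ 2 < (d ^+ 2)%:E)%E.
  by rewrite EFin_expe lte_sqr ?sqrte_ge0// lee_fin ltW.
rewrite wasserstein2_sqr => /ereal_inf_lt[_ [gamma cg <-]] gd.
exact: (coupling_lipschitz cg d0 (ltW gd)).
Qed.

End Wasserstein.

Section TimeClamp.
Context {R : realType}.

(* Curves are only given on [0, T]; composing them with [clamp T] makes every
   estimate in time global. *)
Definition clamp (T t : R) : R := Num.max 0 (Num.min t T).

Lemma clamp_in T t : 0 <= T -> clamp T t \in `[0, T].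
Proof.
by move=> T0; rewrite in_itv /= /clamp le_max lexx /= ge_max T0 ge_min lexx orbT.
Qed.

Lemma clamp_id T t : t \in `[0, T] -> clamp T t = t.
Proof.
by rewrite in_itv /= => /andP[t0 tT]; rewrite /clamp min_l// max_r.
Qed.

Lemma clamp_lip T s t : `|clamp T s - clamp T t| <= `|s - t|.
Proof.
have h1 := ler_norm (s - t); have := ler_norm (t - s); rewrite distrC => h2.
rewrite /clamp !maxEle !minEle; case: (leP s T) => ?; case: (leP t T) => ?;
  case: (leP 0 s) => ?; case: (leP 0 t) => ?; case: (leP 0 T) => ?;
  by rewrite ler_norml; apply/andP; split; lra.
Qed.

(** The modulus [d] depends on [f] only through its Lipschitz constant, so it serves whole families
    at once: the kernels k(. - z) for all z, or the partial derivatives of W(x - .) for all x. *)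
Definition uniform_curve n (mu : R -> probability 'rV[R]_n R) :=
  forall e : R, 0 < e -> exists2 d : R, 0 < d & forall s t, `|s - t| < d ->
  forall (f : 'rV[R]_n -> R) (K : R), bounded_measurable f -> 0 <= K ->
    (forall x y, `|f x - f y| <= K * `|x - y|) ->
    `|\int[mu s]_x f x - \int[mu t]_x f x| <= K * e.

(** This is the Heine-Cantor argument on the compact interval [0, T]. Two times near [t] are
    compared through mu_t by the triangle inequality for integrals, which replaces the one for the
    Wasserstein distance. *)
Lemma P2_curve_uniform n (T : R) (mu : R -> probability 'rV[R]_n R) : 0 <= T ->
  P2_curve T mu -> uniform_curve (fun t => mu (clamp T t)).
Proof.
move=> T0 Pmu e e0.
have e2 : 0 < e / 2 by rewrite divr_gt0.
pose close s t := forall (f : 'rV[R]_n -> R) (K : R), bounded_measurable f -> 0 <= K ->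
    (forall x y, `|f x - f y| <= K * `|x - y|) ->
    `|\int[mu s]_x f x - \int[mu t]_x f x| <= K * e.
pose P (d t : R) := t \in `[0, T] -> forall s, s \in `[0, T] -> `|s - t| < d -> close s t.
have H : forall t : R, `[0, T]%classic t -> \forall x \near t & d \near (0 : R)^'+, P d x.
  move=> t tT; have [_ /= ct] := Pmu t tT.
  have : \forall s \near within `[0, T] (nbhs t), (wasserstein2 (mu s) (mu t) < (e / 2)%:E)%E.
    apply: (ct [set y | (y < (e / 2)%:E)%E]).
    change (nbhs (0 : R) (fun r : R => (r%:E < (e / 2)%:E)%E)).
    by apply: filterS (lt_nbhsl e2) => r; rewrite lte_fin.
  rewrite /within /= => /nbhs_ballP [r /= r0 rP].
  have r2 : 0 < r / 2 by rewrite divr_gt0.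
  exists (ball t (r / 2), [set d | d < r / 2]).
    split => /=; first by apply/nbhs_ballP; exists (r / 2).
    exact: nbhs_right_lt.
  move=> [x d] /= [tx dr] xT s sT sx f K bf K0 fK.
  move: tx; rewrite -ball_normE /ball_ /= => tx.
  have Wx : (wasserstein2 (mu x) (mu t) < (e / 2)%:E)%E.
    by apply: rP => //; rewrite -ball_normE /ball_ /=; lra.
  have Ws : (wasserstein2 (mu s) (mu t) < (e / 2)%:E)%E.
    apply: rP => //; rewrite -ball_normE /ball_ /=.
    by have := ler_distD x t s; rewrite [`|x - s|]distrC; lra.
  have := wasserstein2_lipschitz Wx e2 bf K0 fK.
  have := wasserstein2_lipschitz Ws e2 bf K0 fK.
  have := ler_distD (\int[mu t]_x f x) (\int[mu s]_x f x) (\int[mu x]_x f x).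
  by rewrite [`|\int[mu t]_x f x - _|]distrC; lra.
have := @segment_compact R 0 T => /compact_near_coveringP /(_ R (0^'+) P) /(_ _ H) HP.
have [d [/= d0 dP]] := filter_ex (filterI (nbhs_right_gt (0 : R)) HP).
exists d => // s t std f K bf K0 fK.
apply: (dP (clamp T t)) => //; try exact: clamp_in.
exact: le_lt_trans (clamp_lip T s t) std.
Qed.

End TimeClamp.

(** * Increments along weak solutions *)

Section MeanValueSegment.
Context {R : realType}.

Lemma mean_value_bound_segment (f df : R -> R) (a b c r : R) : a <= b ->
  (forall x : R, is_derive x 1 f (df x)) ->
  (forall x : R, a <= x <= b -> `|df x - c| <= r) ->
  `|f b - f a - (b - a) * c| <= r * (b - a).
Proof.
move=> ab fdf dfC.
have cf : continuous f.
  move=> x; have [d _] := fdf x.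
  by apply: differentiable_continuous; apply/derivable1_diffP.
have [x xab ->] := MVT_segment ab (fun x _ => fdf x) (continuous_subspaceT cf).
rewrite [_ * c]mulrC -mulrBl normrM [`|b - a|]ger0_norm ?subr_ge0//.
by rewrite ler_wpM2r ?subr_ge0// dfC.
Qed.

Lemma smooth_jet_taylor K (phi : nat -> R -> R) k : smooth_jet K phi ->
  exists2 C : R, 0 <= C & forall y w : R,
    `|phi k (y + w) - phi k y - w * phi k.+1 y| <= C * w ^+ 2.
Proof.
move=> sphi; have [C C0 HC] := smooth_jet_bounded k.+2 sphi.
exists C => // y w.
have lip x : `|phi k.+1 x - phi k.+1 y| <= C * `|x - y|.
  exact: (mean_value_bound (fun z => sphi.1 k.+1 z)).
have := @mean_value_bound R (fun x => phi k x - x * phi k.+1 y)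
  (fun x => phi k.+1 x - phi k.+1 y) y (y + w) (C * `|w|).
have -> : y + w - y = w by ring.
rewrite -mulrA -expr2 real_normK ?num_real//.
have -> : phi k (y + w) - (y + w) * phi k.+1 y - (phi k y - y * phi k.+1 y) =
  phi k (y + w) - phi k y - w * phi k.+1 y by ring.
apply => [x|x xw].
  apply: is_deriveB; first exact: sphi.1.
  apply: (@is_derive_quadratic _ _ _ _ _ _ 0) => h _.
  by rewrite [h *: 1]mulr1 mul0r (_ : _ - _ = 0) ?normr0//; ring.
by apply: (le_trans (lip x)); rewrite ler_wpM2l.
Qed.

End MeanValueSegment.

Definition uniformly_cont (R : realType) (m : R -> R) :=
  forall e : R, 0 < e -> exists2 d : R, 0 < d & forall s t, `|s - t| < d -> `|m s - m t| <= e.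

Lemma uniformly_cont_bounded_measurable (R : realType) (m : R -> R) (M : R) :
  uniformly_cont m -> (forall t, `|m t| <= M) ->
  bounded_measurable (m : measurableTypeR R -> R).
Proof.
move=> um mM; split; last by exists M.
apply: continuous_measurable_fun => x; apply/cvgrPdist_le => e e0.
have [d d0 dP] := um e e0; apply/nbhs_ballP; exists d => //= y.
by rewrite /ball /= => /dP.
Qed.

(** * Increments from a distributional derivative in time *)

Section TimeDerivative.
Context {R : realType}.
Local Notation leb := (@lebesgue_measure R).
Variables (T M : R) (m g : R -> R).
Hypotheses (um : uniformly_cont m) (ug : uniformly_cont g)
  (mM : forall t, `|m t| <= M) (gM : forall t, `|g t| <= M)
  (weak : forall K (phi : nat -> R -> R) (a b : R), smooth_jet K phi -> 0 < a -> b < T ->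
    (forall k t, ~~ (a <= t <= b) -> phi k t = 0) ->
    \int[leb]_(t in `[0, T]) (phi 1%N t * m t + phi 0%N t * g t) = 0).

Let bm : bounded_measurable (m : measurableTypeR R -> R).
Proof. exact: uniformly_cont_bounded_measurable mM. Qed.

Let bg : bounded_measurable (g : measurableTypeR R -> R).
Proof. exact: uniformly_cont_bounded_measurable gM. Qed.

Section Mollify.
Variables (e : R) (phi : nat -> R -> R).
Hypotheses (e0 : 0 < e) (sphi : smooth_jet e phi) (phi_ge0 : forall x, 0 <= phi 0%N x)
  (phi1 : \int[leb]_t phi 0%N t = 1).
Variable l : {finite_measure set (measurableTypeR R) -> \bar R}.
Hypothesis lP : forall f : R -> R, (forall t, T < `|t| -> f t = 0) ->
  \int[leb]_t f t = \int[l]_t f t.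

Let sphi_shift s : smooth_jet (`|s| + e) (fun k t => phi k (t - s)).
Proof. exact: smooth_jet_shift sphi. Qed.

Let bphi k s : bounded_measurable ((fun t => phi k (t - s)) : measurableTypeR R -> R).
Proof. exact: (smooth_jet_bounded_measurable k (sphi_shift s)). Qed.

Let avg (f : R -> R) s := \int[l]_t (phi 0%N (t - s) * f t).

Let is_derive_avg (s : R) : is_derive s 1 (avg m) (- \int[l]_t (phi 1%N (t - s) * m t)).
Proof.
have [C C0 HC] := smooth_jet_taylor 0 sphi.
have M0 : 0 <= M by exact: le_trans (mM 0).
apply: (@is_derive_quadratic _ _ _ _ _ _ (C * M * fine (l setT))) => h _.
rewrite [h *: 1]mulr1 /avg mulrN opprK -RintZ; last exact: bounded_measurableM.
rewrite -RintB; try exact: bounded_measurableM.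
rewrite -RintD; last 2 first.
- by apply: bounded_measurableB; exact: bounded_measurableM.
- by apply: bounded_measurableM; [exact: bounded_measurable_cst|exact: bounded_measurableM].
rewrite mulrAC; apply: le_norm_Rint_cst.
  apply: bounded_measurableD.
    by apply: bounded_measurableB; exact: bounded_measurableM.
  by apply: bounded_measurableM; [exact: bounded_measurable_cst|exact: bounded_measurableM].
move=> t; have -> : phi 0%N (t - (h + s)) * m t - phi 0%N (t - s) * m t +
    h * (phi 1%N (t - s) * m t) =
  (phi 0%N (t - s + - h) - phi 0%N (t - s) - - h * phi 1%N (t - s)) * m t.
  by rewrite (_ : t - (h + s) = t - s + - h); ring.
rewrite normrM -mulrA [M * _]mulrC mulrA ler_pM//.
by have := HC (t - s) (- h); rewrite sqrrN.
Qed.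

Let avg_close (f : R -> R) (s c r : R) : 0 <= r ->
  bounded_measurable (f : measurableTypeR R -> R) -> e < s -> s < T - e ->
  (forall t : R, `|t - s| <= e -> `|f t - c| <= r) -> `|avg f s - c| <= r.
Proof.
move=> r0 bf es sT fc.
have one (b : R) : \int[l]_t (phi 0%N (t - s) * b) = b.
  under eq_Rintegral do rewrite mulrC.
  rewrite RintZ// -lP.
    rewrite (Rintegral_shift (- s)) ?phi1 ?mulr1//.
    by have [] := smooth_jet_bounded_measurable 0 sphi.
  move=> t tT; apply: (sphi_shift s).2.
  have s0 : 0 < s by exact: lt_trans es.
  by apply: le_trans (ltW tT); rewrite gtr0_norm//; lra.
rewrite /avg -{1}[c]one -RintB; try (apply: bounded_measurableM => //;
  exact: bounded_measurable_cst).
rewrite -[leRHS]one; apply: le_norm_Rint.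
- by apply: bounded_measurableB; apply: bounded_measurableM => //; exact: bounded_measurable_cst.
- by apply: bounded_measurableM => //; exact: bounded_measurable_cst.
move=> t; rewrite -mulrBr normrM [`|phi _ _|]ger0_norm//.
have [te|te] := leP `|t - s| e; first by rewrite ler_wpM2l// fc.
by rewrite sphi.2 ?mul0r// ltW.
Qed.

(** The function t |-> phi(t - s) is an admissible test function because its support [s - e, s + e]
    lies inside (0, T). *)
Let avg_derivE s : e < s -> s < T - e ->
  - (\int[l]_t (phi 1%N (t - s) * m t)) = avg g s.
Proof.
move=> es sT.
have out k t : ~~ (s - e <= t <= s + e) -> phi k (t - s) = 0.
  move=> st; apply: sphi.2; apply: ltW; rewrite ltNge ler_norml; apply: contra st.
  by move=> /andP[? ?]; apply/andP; split; lra.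
have := @weak _ _ (s - e) (s + e) (sphi_shift s) _ _ out.
rewrite subr_gt0 => /(_ es); have -> : s + e < T by lra.
move=> /(_ isT); rewrite Rintegral_mkcond.
set F := _ \_ _ => E.
have FE : F = fun t => phi 1%N (t - s) * m t + phi 0%N (t - s) * g t.
  apply/funext => t; rewrite /F patchE; case: ifPn => //.
  rewrite notin_setE /= in_itv /= => /negP tT; rewrite !out ?mul0r ?addr0//;
    by apply: contra tT => /andP[? ?]; apply/andP; split; lra.
rewrite FE lP in E; last first.
  move=> t tT; rewrite !out ?mul0r ?addr0//; apply/negP => /andP[? ?];
    by move: tT; apply/negP; rewrite -leNgt ler_norml; apply/andP; split; lra.
rewrite RintD in E; try exact: bounded_measurableM.
by apply/eqP; rewrite eq_sym -subr_eq0 opprK addrC /avg E.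
Qed.

(** On [a, b] the average of [m] has the average of [g] as classical derivative, so the mean value
    theorem applies to it; returning to [m] costs r' at each end. *)
Lemma weak_derivative_mollified (a b c r r' : R) : 0 <= r' -> e < a -> a <= b -> b < T - e ->
  (forall t : R, a - e <= t <= b + e -> `|g t - c| <= r) ->
  (forall s t, `|s - t| <= e -> `|m s - m t| <= r') ->
  `|m b - m a - (b - a) * c| <= r * (b - a) + 2 * r'.
Proof.
move=> r'0 ea ab bT gc mr.
have r0 : 0 <= r.
  have e1 : 0 < e by exact: e0.
  have ga : a - e <= a <= b + e by apply/andP; split; lra.
  exact: le_trans (normr_ge0 _) (gc a ga).
have h1 : `|avg m b - avg m a - (b - a) * c| <= r * (b - a).
  apply: (mean_value_bound_segment ab is_derive_avg) => s /andP[sa sb].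
  rewrite avg_derivE; [|lra|lra].
  apply: avg_close => //; [lra|lra|move=> t]; rewrite ler_norml => /andP[? ?].
  by apply: gc; apply/andP; split; lra.
have h2 : `|avg m b - m b| <= r'.
  by apply: avg_close => //; [lra|move=> t /mr].
have h3 : `|avg m a - m a| <= r'.
  by apply: avg_close => //; [lra|move=> t /mr].
move: h1 h2 h3; rewrite !ler_norml.
by move=> /andP[? ?] /andP[? ?] /andP[? ?]; apply/andP; split; lra.
Qed.

End Mollify.

(** The interval may touch 0 or T, where no test function is available: it is shrunk by [q] at both
    ends and continuity of [m] recovers the endpoints. *)
Lemma weak_derivative_increment (a b c r : R) : 0 <= a -> a <= b -> b <= T ->
  (forall t : R, a <= t <= b -> `|g t - c| <= r) ->
  `|m b - m a - (b - a) * c| <= r * (b - a).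
Proof.
move=> a0; rewrite le_eqVlt => /predU1P[<- _ _|ab bT gc].
  by rewrite !subrr mul0r mulr0 subrr normr0.
have r0 : 0 <= r.
  by apply: (le_trans _ (gc a _)) => //; rewrite lexx ltW.
apply/ler_addgt0Pr => e' e'0.
(* Six errors of size e: two from mollification, two from moving the endpoints of [m], and two from
   2 q |c|. *)
pose e : R := e' / 6; have e0 : 0 < e by rewrite divr_gt0.
have [d d0 md] := um e0.
have c0 : 0 < `|c| + 1 by rewrite ltr_wpDl.
(* The bounds respectively keep the shifts within the modulus of [m], keep a + q <= b - q, and make
   q |c| <= e. Mollifying at scale q / 2 then stays inside [a, b]. *)
pose q := Num.min (Num.min (d / 2) ((b - a) / 4)) (e / (`|c| + 1)).
have q0 : 0 < q by rewrite !lt_min !divr_gt0// subr_gt0.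
have qd : q <= d / 2 by rewrite !ge_min lexx.
have qab : q <= (b - a) / 4 by rewrite !ge_min lexx orbT.
have qc : q * `|c| <= e.
  apply: (@le_trans _ _ (q * (`|c| + 1))); first by rewrite ler_wpM2l ?lerDl// ltW.
  by rewrite -ler_pdivlMr// !ge_min lexx !orbT.
have q2 : 0 < q / 2 by rewrite divr_gt0.
have [phi [sphi phi_ge0 _ phi1]] := exists_mollifier q2.
have [l lP] := exists_interval_measure T.
have h : `|m (b - q) - m (a + q) - (b - q - (a + q)) * c| <= r * (b - q - (a + q)) + 2 * e.
  apply: (weak_derivative_mollified q2 sphi phi_ge0 phi1 lP); try lra.
  - by move=> t /andP[? ?]; apply: gc; apply/andP; split; lra.
  - by move=> s t st; apply: md; lra.
have h1 : `|m (b - q) - m b| <= e.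
  by apply: md; rewrite addrAC subrr add0r normrN gtr0_norm//; lra.
have h2 : `|m (a + q) - m a| <= e.
  by apply: md; rewrite addrAC subrr add0r gtr0_norm//; lra.
have h3 : `|q * c| <= e by rewrite normrM gtr0_norm.
have h4 : r * (b - q - (a + q)) <= r * (b - a) by rewrite ler_wpM2l//; lra.
move: h h1 h2 h3 h4; rewrite !ler_norml /e.
have -> : (b - q - (a + q)) * c = (b - a) * c - 2 * (q * c) by ring.
move: ((b - a) * c) (q * c) (r * (b - a)) (r * (b - q - _)) => x y z w.
by move=> /andP[? ?] /andP[? ?] /andP[? ?] /andP[? ?] ?; apply/andP; split; lra.
Qed.

End TimeDerivative.

Lemma le_norm_Rint_probability d (T : measurableType d) (R : realType)
    (P : probability T R) (f : T -> R) (c : R) :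
  bounded_measurable f -> (forall x, `|f x| <= c) -> `|\int[P]_x f x| <= c.
Proof.
move=> bf fc; have := le_norm_Rint_cst P bf fc.
by rewrite (_ : fine _ = 1) ?mulr1//; exact: (congr1 fine (probability_setT P)).
Qed.

(* Here and in the flow estimates the norm is the library's sup norm. *)
Definition velocity_field (R : realType) n (B L : R) (v : R -> 'rV[R]_n -> 'rV[R]_n) :=
  [/\ 0 <= B /\ 0 <= L, forall t x, `|v t x| <= B,
      forall t x y, `|v t x - v t y| <= L * `|x - y| &
      forall e : R, 0 < e -> exists2 d : R, 0 < d &
        forall s t, `|s - t| < d -> forall x, `|v s x - v t x| <= e].

Definition weak_continuity (R : realType) n (T : R) (mu : R -> probability 'rV[R]_n R)
    (v : R -> 'rV[R]_n -> 'rV[R]_n) :=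
  forall phi : 'rV[R]_(1 + n) -> R, test_function phi ->
    supp phi `<=` [set z : 'rV[R]_(1 + n) | 0 < z 0 0 < T] ->
    \int[lebesgue_measure]_(t in `[0, T])
      (\int[mu t]_x
         (partial 0 phi (cons_rV t x) +
          \sum_(i < n) partial (rshift 1 i) phi (cons_rV t x) * v t x 0 i)) = 0.

(** * Products of a time cutoff and a spatial kernel *)

Section SpaceTimeTestFunctions.
Context {R : realType} {n : nat}.
Variables (eta phi : nat -> R -> R) (z : 'rV[R]_n).

Definition space_time_jet (i : 'I_(1 + n)) : nat -> R -> R :=
  match fintype.split i with
  | inl _ => eta
  | inr j => fun k s => phi k (s - z 0 j)
  end.

Lemma space_time_jet0 : space_time_jet (lshift n ord0) = eta.
Proof. by rewrite /space_time_jet (unsplitK (inl ord0)). Qed.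

Lemma space_time_jetS j : space_time_jet (rshift 1 j) = fun k s => phi k (s - z 0 j).
Proof. by rewrite /space_time_jet (unsplitK (inr j)). Qed.

Lemma space_time_jetE al t x : prod_jet space_time_jet al (cons_rV t x) =
  eta (al (lshift n ord0)) t * prod_kernel phi (fun j => al (rshift 1 j)) (x - z).
Proof.
rewrite /prod_jet big_split_ord big_ord1 space_time_jet0 cons_rV0; congr (_ * _).
rewrite kernel_shiftE; apply: eq_bigr => j _.
by rewrite space_time_jetS cons_rVS.
Qed.

Lemma smooth_jet_le K K' (f : nat -> R -> R) : K <= K' -> smooth_jet K f -> smooth_jet K' f.
Proof. by move=> KK' [df f0]; split => // k x Kx; rewrite f0// (le_trans KK'). Qed.

Lemma smooth_space_time_jet K e : smooth_jet K eta -> smooth_jet e phi ->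
  forall i, smooth_jet (Num.max K (`|z| + e)) (space_time_jet i).
Proof.
move=> seta sphi i; rewrite /space_time_jet; case: (fintype.split i) => j.
  by apply: smooth_jet_le seta; rewrite le_max lexx.
apply: (smooth_jet_le _ (kernel_shift_jet sphi z j)).
by rewrite le_max lexx orbT.
Qed.

Lemma partial_space_time_jet0 K e t x : smooth_jet K eta -> smooth_jet e phi ->
  partial 0 (prod_jet space_time_jet (fun=> 0%N)) (cons_rV t x) =
  eta 1%N t * prod_kernel phi (fun=> 0%N) (x - z).
Proof.
move=> seta sphi; have sst := smooth_space_time_jet seta sphi.
have [_] := is_derive_prod_jet (fun=> 0%N) 0 (cons_rV t x) sst.
by rewrite /partial => ->; rewrite space_time_jetE; congr (_ * _).
Qed.

Lemma partial_space_time_jetS K e t x i : smooth_jet K eta -> smooth_jet e phi ->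
  partial (rshift 1 i) (prod_jet space_time_jet (fun=> 0%N)) (cons_rV t x) =
  eta 0%N t * prod_kernel phi (incr_at i (fun=> 0%N)) (x - z).
Proof.
move=> seta sphi; have sst := smooth_space_time_jet seta sphi.
have [_] := is_derive_prod_jet (fun=> 0%N) (rshift 1 i) (cons_rV t x) sst.
by rewrite /partial => ->; rewrite space_time_jetE; congr (_ * _).
Qed.

Lemma supp_space_time_jet (a b T : R) : 0 < a -> b < T ->
  (forall k t, ~~ (a <= t <= b) -> eta k t = 0) ->
  supp (prod_jet space_time_jet (fun=> 0%N)) `<=`
    [set w : 'rV[R]_(1 + n) | 0 < w 0 0 < T].
Proof.
move=> a0 bT eta0.
have sub : [set w | prod_jet space_time_jet (fun=> 0%N) w != 0] `<=`
    [set w : 'rV[R]_(1 + n) | a <= w 0 0 <= b].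
  move=> w /= w0; apply/negPn/negP => wab; move/eqP: w0; apply.
  rewrite /prod_jet big_split_ord big_ord1 space_time_jet0.
  have -> : w 0 (lshift n ord0) = w 0 0 by congr (w _ _); exact/val_inj.
  by rewrite eta0// [LHS]mul0r.
have cl : closed [set w : 'rV[R]_(1 + n) | a <= w 0 0 <= b].
  rewrite (_ : [set _ | _] = (fun w : 'rV[R]_(1 + n) => w 0 0) @^-1` `[a, b]%classic).
    apply: preimage_closed; last exact: interval_closed.
    by move=> w _; exact: coord_continuous.
  by apply/seteqP; split => w /=; rewrite in_itv.
move=> w /(closureS sub); rewrite -(iffLR (closure_id _) cl) /=.
by move=> /andP[aw wb]; rewrite (lt_le_trans a0)// (le_lt_trans wb).
Qed.

End SpaceTimeTestFunctions.

Section WeakIncrement.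
Context {R : realType} {n : nat}.
Variables (T B L : R) (mu : R -> probability 'rV[R]_n R) (v : R -> 'rV[R]_n -> 'rV[R]_n).
Hypotheses (umu : uniform_curve mu) (vv : velocity_field B L v)
  (wc : weak_continuity T mu v).
Variables (e : R) (phi : nat -> R -> R).
Hypothesis (sphi : smooth_jet e phi).
Local Notation al0 := (fun=> 0%N : nat).

Lemma velocity_bounded_measurable t i : bounded_measurable (fun x => v t x 0 i).
Proof.
have [_ vB vL _] := vv; split.
  apply: continuous_measurable_rV; apply: (@lipschitz_continuous _ _ _ L) => x y.
  by have := normrV_ge (v t x - v t y) i; rewrite !mxE => /le_trans; apply; exact: vL.
by exists B => x; exact: le_trans (normrV_ge _ _) (vB t x).
Qed.

Definition density t (z : 'rV[R]_n) : R := \int[mu t]_x prod_kernel phi al0 (x - z).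

(** The derivative of k(. - z) at x in the direction v_t(x); its integral against mu_t plays the
    part of the time derivative of the mollified density at z. *)
Definition flux t (z x : 'rV[R]_n) : R :=
  \sum_i prod_kernel phi (incr_at i al0) (x - z) * v t x 0 i.

Lemma flux_bounded_measurable t z : bounded_measurable (flux t z).
Proof.
apply: bounded_measurable_sum => i; apply: bounded_measurableM.
  exact: bounded_measurable_kernel sphi _ _.
exact: velocity_bounded_measurable.
Qed.

Let kernel_bounds : exists C : R, [/\ 0 <= C,
  forall x : 'rV[R]_n, `|prod_kernel phi al0 x| <= C,
  forall x y : 'rV[R]_n, `|prod_kernel phi al0 x - prod_kernel phi al0 y| <= C * `|x - y|,
  forall i (x : 'rV[R]_n), `|prod_kernel phi (incr_at i al0) x| <= C &
  forall i (x y : 'rV[R]_n),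
    `|prod_kernel phi (incr_at i al0) x - prod_kernel phi (incr_at i al0) y| <= C * `|x - y| ].
Proof.
have [A A0 HA] := prod_jet_bounded (n := n) al0 (fun=> sphi).
have [A' A'0 HA'] := prod_jet_lipschitz (n := n) al0 (fun=> sphi).
have /choice[D HD] : forall i : 'I_n, exists C : R, 0 <= C /\
    forall x : 'rV[R]_n, `|prod_kernel phi (incr_at i al0) x| <= C.
  by move=> i; have [C C0 HC] := prod_jet_bounded (n := n) (incr_at i al0) (fun=> sphi);
    exists C.
have /choice[E HE] : forall i : 'I_n, exists C : R, 0 <= C /\ forall x y : 'rV[R]_n,
    `|prod_kernel phi (incr_at i al0) x - prod_kernel phi (incr_at i al0) y| <= C * `|x - y|.
  by move=> i; have [C C0 HC] := prod_jet_lipschitz (n := n) (incr_at i al0) (fun=> sphi);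
    exists C.
have DE0 : 0 <= \sum_i (D i + E i).
  by apply: sumr_ge0 => i _; rewrite addr_ge0//; [have [] := HD i|have [] := HE i].
have DEi i : D i + E i <= \sum_i (D i + E i).
  rewrite [leRHS](bigD1 i)//= lerDl; apply: sumr_ge0 => j _.
  by rewrite addr_ge0//; [have [] := HD j|have [] := HE j].
exists (A + A' + \sum_i (D i + E i)); split.
- by rewrite !addr_ge0.
- by move=> x; apply: (le_trans (HA x)); rewrite -addrA lerDl addr_ge0.
- move=> x y; apply: (le_trans (HA' x y)); rewrite ler_wpM2r//.
  by rewrite addrAC lerDr addr_ge0.
- move=> i x; apply: (le_trans ((HD i).2 x)); apply: (le_trans _ (le_trans (DEi i) _)).
    by rewrite lerDl; have [] := HE i.
  by rewrite lerDr addr_ge0.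
- move=> i x y; apply: (le_trans ((HE i).2 x y)); rewrite ler_wpM2r//.
  apply: (le_trans _ (le_trans (DEi i) _)); first by rewrite lerDr; have [] := HD i.
  by rewrite lerDr addr_ge0.
Qed.

Let fin_sum (F : 'I_n -> R) (C : R) : (forall i, `|F i| <= C) -> `|\sum_i F i| <= n%:R * C.
Proof.
move=> FC; apply: (le_trans (ler_norm_sum _ _ _)).
apply: (@le_trans _ _ (\sum_(i < n) C)); first by apply: ler_sum => i _.
by rewrite sumr_const card_ord mulr_natl.
Qed.

Lemma flux_bounds : exists2 C : R, 0 <= C &
  (forall t z x, `|flux t z x| <= C) /\
  (forall t z x y, `|flux t z x - flux t z y| <= C * `|x - y|) /\
  (forall s t z (r : R), (forall x, `|v s x - v t x| <= r) ->
    forall x, `|flux s z x - flux t z x| <= C * r).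
Proof.
have [C [C0 _ _ kC kL]] := kernel_bounds.
have [[B0 L0] vB vL _] := vv.
have viB t x i : `|v t x 0 i| <= B by exact: le_trans (normrV_ge _ _) (vB t x).
have nCB : 0 <= n%:R * (C * B) by rewrite !mulr_ge0.
have nCBL : 0 <= n%:R * (C * B + C * L) by rewrite mulr_ge0// addr_ge0// mulr_ge0.
have nC : 0 <= n%:R * C by rewrite mulr_ge0.
exists (n%:R * (C * B) + n%:R * (C * B + C * L) + n%:R * C).
  by rewrite !addr_ge0.
split; [move=> t z x|split=> [t z x y|s t z r vr x]].
- apply: (@le_trans _ _ (n%:R * (C * B))); last by rewrite -addrA lerDl addr_ge0.
  by apply: fin_sum => i; rewrite normrM ler_pM.
- apply: (@le_trans _ _ (n%:R * (C * B + C * L) * `|x - y|)); last first.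
    by rewrite ler_wpM2r// addrAC lerDr addr_ge0.
  rewrite /flux -sumrB -mulrA; apply: fin_sum => i.
  have -> : prod_kernel phi (incr_at i al0) (x - z) * v t x 0 i -
      prod_kernel phi (incr_at i al0) (y - z) * v t y 0 i =
    (prod_kernel phi (incr_at i al0) (x - z) - prod_kernel phi (incr_at i al0) (y - z)) * v t x 0 i
    + prod_kernel phi (incr_at i al0) (y - z) * (v t x 0 i - v t y 0 i) by ring.
  apply: (le_trans (ler_normD _ _)); rewrite [leRHS]mulrDl !normrM.
  apply: lerD.
    rewrite mulrAC; apply: ler_pM => //.
    by have := kL i (x - z) (y - z); rewrite opprB addrA subrK.
  rewrite -mulrA; apply: ler_pM => //.
  by have := normrV_ge (v t x - v t y) i; rewrite !mxE => /le_trans; apply.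
- have r0 : 0 <= r by exact: le_trans (vr 0).
  apply: (@le_trans _ _ (n%:R * C * r)); last by rewrite ler_wpM2r// lerDr addr_ge0.
  rewrite /flux -sumrB -mulrA; apply: fin_sum => i.
  rewrite -mulrBr normrM ler_pM//.
  by have := normrV_ge (v s x - v t x) i; rewrite !mxE => /le_trans; apply.
Qed.

(** The step bound [d] must not depend on [z], because the estimate is later integrated in z against
    the observable; all kernels k(. - z) and their fluxes share the same sup and Lipschitz
    bounds. *)
Lemma density_increment (k : R) : 0 < k -> exists2 d : R, 0 < d &
  forall z (s t : R), 0 <= s -> s <= t -> t <= T -> t - s < d ->
  `|density t z - density s z - (t - s) * \int[mu s]_x flux s z x| <= k * (t - s).
Proof.
move=> k0.
have [C [C0 kC kL _ _]] := kernel_bounds.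
have [D D0 [fB [fL ft]]] := flux_bounds.
have [_ _ _ vt] := vv.
have bk (z : 'rV[R]_n) : bounded_measurable (fun x : 'rV[R]_n => prod_kernel phi al0 (x - z)).
  exact: bounded_measurable_kernel sphi _ _.
have ucP z : uniformly_cont (density^~ z).
  move=> r r0; have r1 : 0 < r / (C + 1) by rewrite divr_gt0// ltr_wpDl.
  have [d d0 dP] := umu r1; exists d => // s t st.
  apply: (le_trans (dP s t st _ C (bk z) C0 _)).
    by move=> x y; have := kL (x - z) (y - z); rewrite opprB addrA subrK.
  by rewrite mulrCA ger_pMr// ler_pdivrMr ?ltr_wpDl// mul1r lerDl.
have ucQ (r : R) : 0 < r -> exists2 d : R, 0 < d & forall z s t, `|s - t| < d ->
    `|\int[mu s]_x flux s z x - \int[mu t]_x flux t z x| <= r.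
  move=> r0; have r1 : 0 < r / (2 * (D + 1)) by rewrite divr_gt0// mulr_gt0// ltr_wpDl.
  have [d1 d10 d1P] := umu r1; have [d2 d20 d2P] := vt _ r1.
  exists (Num.min d1 d2) => [|z s t]; first by rewrite lt_min d10.
  rewrite lt_min => /andP[st1 st2].
  (* The velocity is changed first at fixed measure, then the measure at fixed velocity. *)
  have h1 : `|\int[mu s]_x flux s z x - \int[mu s]_x flux t z x| <= D * (r / (2 * (D + 1))).
    rewrite -RintB; try exact: flux_bounded_measurable.
    apply: le_norm_Rint_probability.
      by apply: bounded_measurableB; exact: flux_bounded_measurable.
    by move=> x; apply: (ft _ _ _ (r / (2 * (D + 1)))) => y; exact: d2P.
  have h2 := d1P s t st1 _ D (flux_bounded_measurable t z) D0 (fL t z).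
  have h3 : D * (r / (2 * (D + 1))) <= r / 2.
    rewrite (_ : _ * _ = r / 2 * (D / (D + 1))); last by field; rewrite gt_eqF ?ltr_wpDl.
    by rewrite ger_pMr ?divr_gt0// ler_pdivrMr ?ltr_wpDl// mul1r lerDl.
  rewrite -(subrKA (\int[mu s]_x flux t z x)) (le_trans (ler_normD _ _))//.
  by lra.
have [d d0 dP] := ucQ k k0; exists d => // z s t s0 st tT tsd.
apply: (@weak_derivative_increment _ T (C + D) (density^~ z)
  (fun t => \int[mu t]_x flux t z x)) => //.
- by move=> r /ucQ[d' d'0 d'P]; exists d' => // s' t'; exact: d'P.
- move=> t'; apply: (@le_trans _ _ C); last by rewrite lerDl.
  exact: (le_norm_Rint_probability (mu t') (bk z) (fun x => kC (x - z))).
- move=> t'; apply: (@le_trans _ _ D); last by rewrite lerDr.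
  exact: (le_norm_Rint_probability (mu t') (flux_bounded_measurable t' z) (fB t' z)).
- move=> K eta a b seta a0 bT eta0.
  have sst := smooth_space_time_jet z seta sphi.
  have := wc (prod_jet_test_function al0 sst) (@supp_space_time_jet _ _ eta phi z a b T a0 bT eta0).
  move=> E; rewrite -[RHS]E; apply: eq_Rintegral => r _.
  have -> : (fun x => partial 0 (prod_jet (space_time_jet eta phi z) al0) (cons_rV r x) +
      \sum_(i < n) partial (rshift 1 i) (prod_jet (space_time_jet eta phi z) al0)
         (cons_rV r x) * v r x 0 i) =
      fun x => eta 1%N r * prod_kernel phi al0 (x - z) + eta 0%N r * flux r z x.
    apply/funext => x; rewrite (partial_space_time_jet0 _ _ _ seta sphi); congr (_ + _).
    rewrite mulr_sumr; apply: eq_bigr => i _.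
    by rewrite (partial_space_time_jetS _ _ _ _ seta sphi) mulrA.
  rewrite RintD.
  + by rewrite RintZ// RintZ//; exact: flux_bounded_measurable.
  + by apply: bounded_measurableM => //; exact: bounded_measurable_cst.
  + by apply: bounded_measurableM; [exact: bounded_measurable_cst|exact: flux_bounded_measurable].
move=> r /andP[sr rt]; apply: dP.
by rewrite ger0_norm ?subr_ge0//; apply: le_lt_trans tsd; rewrite lerB.
Qed.

End WeakIncrement.

(** * Flows *)

Lemma divr2_gt0 (R : realFieldType) (e : R) : 0 < e -> 0 < e / 2.
Proof. by move=> e0; rewrite divr_gt0. Qed.

(** The sources are allowed to vary with the step since in the stability estimate they form a
    Riemann sum of a_t. *)
Lemma discrete_gronwall_sum (R : realType) (a b : nat -> R) (c : R) N :
  (forall k, 0 <= b k) -> 0 <= c -> 0 <= a 0%N ->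
  (forall k, (k < N)%N -> a k.+1 <= (1 + c) * a k + b k) ->
  forall k, (k <= N)%N -> a k <= expR (c * k%:R) * (a 0%N + \sum_(i < k) b i).
Proof.
move=> b0 c0 a0 aS; elim=> [_|k IH kN].
  by rewrite mulr0 expR0 mul1r big_ord0 addr0.
apply: (le_trans (aS k kN)).
have ec : 1 + c <= expR c by exact: expR_ge1Dx.
have e1 : 1 <= expR (c * k.+1%:R).
  by apply: le_trans (expR_ge1Dx _); rewrite lerDl mulr_ge0.
have E : expR (c * k.+1%:R) = expR c * expR (c * k%:R).
  by rewrite -expRD -natr1 mulrDr mulr1 addrC.
have ab : 0 <= a 0%N + \sum_(i < k) b i by rewrite addr_ge0// sumr_ge0.
have h1 : (1 + c) * a k <= expR (c * k.+1%:R) * (a 0%N + \sum_(i < k) b i).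
  apply: (@le_trans _ _ ((1 + c) * (expR (c * k%:R) * (a 0%N + \sum_(i < k) b i)))).
    by rewrite ler_wpM2l ?IH ?addr_ge0// ltnW.
  by rewrite E -mulrA ler_wpM2r// mulr_ge0// expR_ge0.
have h2 : b k <= expR (c * k.+1%:R) * b k by rewrite ler_peMl.
by rewrite big_ord_recr /= addrA mulrDr lerD.
Qed.

Lemma discrete_gronwall (R : realType) (a : nat -> R) (b c : R) N :
  0 <= b -> 0 <= c -> 0 <= a 0%N ->
  (forall k, (k < N)%N -> a k.+1 <= (1 + c) * a k + b) ->
  forall k, (k <= N)%N -> a k <= expR (c * k%:R) * (a 0%N + k%:R * b).
Proof.
move=> b0 c0 a0 aS k kN.
have := @discrete_gronwall_sum R a (fun=> b) c N (fun=> b0) c0 a0 aS k kN.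
by rewrite sumr_const card_ord mulr_natl.
Qed.

Lemma uniform_cauchy_limit (R : realType) (V : completeNormedModType R) (I : Type)
    (P : I -> Prop) (u : nat -> I -> V) :
  (forall e : R, 0 < e -> exists N, forall p q i, (N <= p)%N -> (N <= q)%N -> P i ->
     `|u p i - u q i| <= e) ->
  exists l : I -> V, forall e : R, 0 < e -> exists N, forall p i, (N <= p)%N -> P i ->
     `|u p i - l i| <= e.
Proof.
move=> uc.
have cu i : P i -> cvg (u p i @[p --> \oo]).
  move=> Pi; apply/cauchy_cvgP/cauchy_exP => e e0.
  have [N NP] := uc (e / 2) (divr2_gt0 e0).
  exists (u N i); exists N => // p /= Np; rewrite -ball_normE /ball_ /=.
  have := NP N p i (leqnn N) Np Pi; lra.
exists (fun i => lim (u p i @[p --> \oo])) => e e0.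
have e2 : 0 < e / 2 by rewrite divr_gt0.
have [N NP] := uc (e / 2) e2; exists N => p i Np Pi.
have /cvgrPdist_le /(_ _ e2) [M _ MP] := cu i Pi.
have h1 := MP (maxn M N) (leq_maxl _ _).
have h2 := NP p (maxn M N) i Np (leq_maxr _ _) Pi.
rewrite -(subrKA (u (maxn M N) i)) (le_trans (ler_normD _ _))//.
by rewrite [`|u (maxn M N) i - _|]distrC; move: h1 h2 => /=; lra.
Qed.

Section Euler.
Context {R : realType} {n : nat}.
Variables (B L : R) (v : R -> 'rV[R]_n -> 'rV[R]_n).
Hypothesis vv : velocity_field B L v.

Fixpoint euler (h : R) k (x : 'rV[R]_n) : 'rV[R]_n :=
  if k is k'.+1 then
    euler h k' x + h *: v (k'%:R * h) (euler h k' x)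
  else x.

Lemma euler_lipschitz h k x y : 0 <= h ->
  `|euler h k x - euler h k y| <= expR (h * L * k%:R) * `|x - y|.
Proof.
move=> h0; have [[B0 L0] _ vL _] := vv.
have := @discrete_gronwall R (fun k => `|euler h k x - euler h k y|) 0 (h * L) k.
move=> /(_ (lexx 0)) H.
have -> : `|x - y| = `|euler h 0 x - euler h 0 y| + k%:R * 0 by rewrite mulr0 addr0.
apply: H => //; first by rewrite mulr_ge0.
move=> j _; rewrite addr0 /=.
have -> : euler h j x + h *: v (j%:R * h) (euler h j x) -
    (euler h j y + h *: v (j%:R * h) (euler h j y)) =
    (euler h j x - euler h j y) +
    h *: (v (j%:R * h) (euler h j x) - v (j%:R * h) (euler h j y)).
  by rewrite scalerBr opprD addrACA.
rewrite (le_trans (ler_normD _ _))// mulrDl mul1r lerD2l normrZ ger0_norm//.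
by rewrite -mulrA ler_wpM2l.
Qed.

Lemma euler_displacement h i m x : 0 <= h ->
  `|euler h (i + m) x - euler h i x| <= m%:R * h * B.
Proof.
move=> h0; have [[B0 L0] vB _ _] := vv.
elim: m => [|m IH]; first by rewrite addn0 subrr normr0 !mul0r.
rewrite addnS /= addrAC (le_trans (ler_normD _ _))//.
rewrite -natr1 !mulrDl lerD// mul1r normrZ ger0_norm// ler_wpM2l//.
Qed.

Lemma euler_increment h i m x (s c : R) : 0 <= h ->
  (forall k, (k < m)%N ->
     `|v ((i + k)%:R * h) (euler h (i + k) x) - v s (euler h i x)| <= c) ->
  `|euler h (i + m) x - euler h i x - (m%:R * h) *: v s (euler h i x)| <= m%:R * h * c.
Proof.
move=> h0; elim: m => [_|m IH vc].
  by rewrite addn0 subrr !mul0r scale0r subr0 normr0.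
rewrite addnS /= -natr1 !mulrDl !mul1r scalerDl.
set w := v s _; set w' := v _ _.
have -> : euler h (i + m) x + h *: w' - euler h i x - ((m%:R * h) *: w + h *: w) =
    euler h (i + m) x - euler h i x - (m%:R * h) *: w + h *: (w' - w).
  by apply/rowP => l; rewrite !mxE; ring.
rewrite (le_trans (ler_normD _ _))// lerD//.
  by apply: IH => k km; apply: vc; rewrite ltnS ltnW.
by rewrite normrZ ger0_norm// ler_wpM2l// vc.
Qed.

(** Piecewise constant in time; its jumps at the grid times account for the term h (k + B) in the
    increment estimate. *)
Definition euler_path h (t : R) x := euler h (Num.truncn (t / h)) x.

Lemma truncn_divr (t h : R) : 0 <= t -> 0 < h ->
  (Num.truncn (t / h))%:R * h <= t < (Num.truncn (t / h))%:R * h + h.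
Proof.
move=> t0 h0; have /truncn_itv : 0 <= t / h by rewrite divr_ge0// ltW.
by rewrite ler_pdivlMr// ltr_pdivrMr// -natr1 mulrDl mul1r.
Qed.

Lemma euler_path_increment (k : R) : 0 < k -> exists2 d : R, 0 < d &
  forall h s t x, 0 < h -> h <= d -> 0 <= s -> s <= t -> t - s <= d ->
  `|euler_path h t x - euler_path h s x - (t - s) *: v s (euler_path h s x)| <=
  (t - s) * k + h * (k + B).
Proof.
move=> k0; have [[B0 L0] vB vL vt] := vv.
have [d1 d10 d1P] := vt (k / 2) (divr2_gt0 k0).
(* The grid times involved lie within 2 d of s, and the polygon moves by at most 2 d B meanwhile:
   the variation of v in time and the one in space are then each at most k / 2. *)
pose d := Num.min (d1 / 3) (k / (4 * (L * B + 1))).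
have LB : 0 < L * B + 1 by rewrite ltr_wpDl// mulr_ge0.
have d0 : 0 < d by rewrite lt_min !divr_gt0// mulr_gt0.
have dd1 : d <= d1 / 3 by rewrite ge_min lexx.
have dk : L * (2 * d * B) <= k / 2.
  have : d * (4 * (L * B + 1)) <= k by rewrite -ler_pdivlMr ?mulr_gt0// ge_min lexx orbT.
  by nra.
exists d => // h s t x h0 hd s0 st tsd.
have /andP[i1 i2] := truncn_divr s0 h0.
have /andP[j1 j2] := truncn_divr (le_trans s0 st) h0.
rewrite /euler_path; set i := Num.truncn (s / h) in i1 i2 *.
set j := Num.truncn (t / h) in j1 j2 *.
have ij : (i <= j)%N by apply: le_truncn; rewrite ler_pM2r// invr_gt0.
move: (j - i)%N (subnKC ij) => m mE.
rewrite -mE in j1 j2 *.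
have mh : `|m%:R * h - (t - s)| <= h.
  by move: j1 j2; rewrite natrD mulrDl => j1 j2; rewrite ler_norml; apply/andP; split; lra.
have mts : m%:R * h <= t - s + h by move: mh; rewrite ler_norml => /andP[]; lra.
have h1 := @euler_increment h i m x s k (ltW h0).
have {}h1 : `|euler h (i + m) x - euler h i x - (m%:R * h) *: v s (euler h i x)| <=
    m%:R * h * k.
  apply: h1 => l lm.
  have lm' : l%:R * h <= m%:R * h by rewrite ler_pM2r// ler_nat ltnW.
  have l0 : 0 <= l%:R * h by rewrite mulr_ge0// ltW.
  rewrite -(subrKA (v s (euler h (i + l) x))) (le_trans (ler_normD _ _))//.
  have -> : k = k / 2 + k / 2 by field.
  apply: lerD.
    apply: d1P; rewrite natrD mulrDl ltr_norml; apply/andP; split; lra.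
  apply: (le_trans (vL _ _ _)); apply: le_trans dk; rewrite ler_wpM2l//.
  apply: (le_trans (euler_displacement _ _ _ (ltW h0))); rewrite ler_wpM2r//; lra.
set w := v s (euler h i x) in h1 *.
have -> : euler h (i + m) x - euler h i x - (t - s) *: w =
    euler h (i + m) x - euler h i x - (m%:R * h) *: w + (m%:R * h - (t - s)) *: w.
  by apply/rowP => l; rewrite !mxE; ring.
rewrite (le_trans (ler_normD _ _))// normrZ.
have h2 : `|m%:R * h - (t - s)| * `|w| <= h * B by rewrite ler_pM// vB.
have h3 : m%:R * h * k <= (t - s + h) * k by rewrite ler_wpM2r// ltW.
lra.
Qed.

(** Each curve has a local defect E on every one of the N steps, and Gronwall propagates the total 2
    N E. Applied to two polygons with different meshes, it compares them on a common coarser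
    grid. *)
Lemma approximate_flows_close T t N (Y Z : R -> 'rV[R]_n) (E : R) :
  0 <= t -> t <= T -> (0 < N)%N -> 0 <= E -> Y 0 = Z 0 ->
  (forall s, 0 <= s -> s + t / N%:R <= T ->
     `|Y (s + t / N%:R) - Y s - (t / N%:R) *: v s (Y s)| <= E) ->
  (forall s, 0 <= s -> s + t / N%:R <= T ->
     `|Z (s + t / N%:R) - Z s - (t / N%:R) *: v s (Z s)| <= E) ->
  `|Y t - Z t| <= expR (L * T) * (N%:R * (2 * E)).
Proof.
move=> t0 tT N0 E0 YZ HY HZ; have [[B0 L0] _ vL _] := vv.
pose h := t / N%:R; have h0 : 0 <= h by rewrite divr_ge0.
have Nh : N%:R * h = t by rewrite mulrC divfK// pnatr_eq0 -lt0n.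
have := @discrete_gronwall R (fun k => `|Y (k%:R * h) - Z (k%:R * h)|) (2 * E) (h * L) N.
rewrite /= mul0r YZ subrr normr0 => H.
have {}H := H _ _ (lexx 0) _ N (leqnn N); rewrite Nh add0r in H.
apply: (le_trans (H _ _ _)).
- by rewrite mulr_ge0.
- by rewrite mulr_ge0.
- move=> k kN.
  have kh : 0 <= k%:R * h by rewrite mulr_ge0.
  have khT : k%:R * h + h <= T.
    apply: le_trans tT; rewrite -Nh -{2}[h]mul1r -mulrDl natr1.
    by rewrite ler_wpM2r// ler_nat.
  have {}HY := HY _ kh khT; have {}HZ := HZ _ kh khT.
  rewrite -natr1 mulrDl mul1r -/h in HY HZ *.
  set y' := Y (_ + h) in HY *; set z' := Z (_ + h) in HZ *.
  move: kh HY HZ; set s := k%:R * h => kh HY HZ.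
  have -> : y' - z' = (y' - Y s - h *: v s (Y s)) - (z' - Z s - h *: v s (Z s)) +
     ((Y s - Z s) + h *: (v s (Y s) - v s (Z s))).
    apply/rowP => i; rewrite !mxE; ring.
  rewrite (le_trans (ler_normD _ _))// addrC lerD//.
    rewrite (le_trans (ler_normD _ _))// mulrDl mul1r lerD2l normrZ ger0_norm//.
    by rewrite -[leRHS]mulrA; apply: ler_wpM2l => //; exact: vL.
  by rewrite (le_trans (ler_normB _ _))//; lra.
- rewrite ler_wpM2r ?mulr_ge0// ler_expR.
  have -> : h * L * N%:R = L * (N%:R * h) by ring.
  by rewrite Nh ler_wpM2l.
Qed.

Lemma euler_path_lipschitz T h t x y : 0 < h -> 0 <= t -> t <= T ->
  `|euler_path h t x - euler_path h t y| <= expR (L * T) * `|x - y|.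
Proof.
move=> h0 t0 tT; have [[B0 L0] _ _ _] := vv.
apply: (le_trans (euler_lipschitz _ _ _ (ltW h0))); rewrite ler_wpM2r// ler_expR.
have /andP[h1 _] := truncn_divr t0 h0.
rewrite mulrAC mulrC ler_wpM2l// mulrC; exact: le_trans h1 tT.
Qed.

Lemma natSinv_small (c : R) : 0 < c -> exists N, forall p, (N <= p)%N -> p.+1%:R^-1 <= c.
Proof.
move=> c0; have [N _ NP] := near_infty_natSinv_lt (PosNum c0).
by exists N => p /NP /= /ltW.
Qed.

(** The equation X' = v(X) is encoded by first-order increments whose remainder is uniform in the
    time and in the starting point, the form in which Gronwall arguments and integration over x use
    it. *)
Definition is_flow T (X : R -> 'rV[R]_n -> 'rV[R]_n) :=
  [/\ forall x, X 0 x = x,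
      forall t x y, 0 <= t -> t <= T -> `|X t x - X t y| <= expR (L * T) * `|x - y| &
      forall k : R, 0 < k -> exists2 d : R, 0 < d &
        forall (s t : R) x, 0 <= s -> s <= t -> t <= T -> t - s <= d ->
        `|X t x - X s x - (t - s) *: v s (X s x)| <= (t - s) * k].

Lemma exists_flow T : 0 < T -> exists X, is_flow T X.
Proof.
move=> T0; have [[B0 L0] vB vL _] := vv.
have eT : 0 < expR (L * T) by exact: expR_gt0.
pose h p : R := p.+1%:R^-1.
have h0 p : 0 < h p by rewrite invr_gt0 ltr0n.
have uc : forall e : R, 0 < e -> exists M, forall p q (i : R * 'rV[R]_n),
    (M <= p)%N -> (M <= q)%N -> 0 <= i.1 <= T ->
    `|euler_path (h p) i.1 i.2 - euler_path (h q) i.1 i.2| <= e.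
  move=> e e0.
  pose k := e / (4 * T * expR (L * T)).
  have k0 : 0 < k by rewrite divr_gt0// !mulr_gt0.
  have [d d0 dP] := euler_path_increment k0.
  pose N := (Num.truncn (T / d)).+1.
  have N0 : 0 < N%:R :> R by rewrite ltr0n.
  have TN : T / N%:R <= d.
    have /andP[_] := truncn_itv (ltW (divr_gt0 T0 d0)).
    by rewrite -/N ltr_pdivrMr// ler_pdivrMr// mulrC => /ltW.
  (* The coarse grid N is fixed before the mesh: the jump error h (k + B) is incurred N times, and
     the mesh must be small against 1 / N. *)
  pose c := Num.min d (e / (4 * N%:R * (k + B) * expR (L * T))).
  have kB : 0 < k + B by rewrite ltr_pwDl.
  have c0 : 0 < c by rewrite lt_min d0 divr_gt0// !mulr_gt0.
  have [M MP] := natSinv_small c0; exists M => p q [t x] Mp Mq /= /andP[t0 tT].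
  have step r : (M <= r)%N -> forall s, 0 <= s -> s + t / N%:R <= T ->
      `|euler_path (h r) (s + t / N%:R) x - euler_path (h r) s x -
        (t / N%:R) *: v s (euler_path (h r) s x)| <= t / N%:R * k + c * (k + B).
    move=> Mr s s0 sT; have hc := MP r Mr.
    have tN : 0 <= t / N%:R by rewrite divr_ge0.
    have := dP (h r) s (s + t / N%:R) x (h0 r) _ s0 _ _.
    rewrite lerDl tN addrAC subrr add0r => H.
    apply: (le_trans (H _ isT _)).
    - by rewrite (le_trans hc)// ge_min lexx.
    - by rewrite (le_trans _ TN)// ler_pM2r ?invr_gt0.
    - by rewrite lerD2l ler_wpM2r// ltW.
  have E0 : 0 <= t / N%:R * k + c * (k + B).
    have tN : 0 <= t / N%:R by exact: (divr_ge0 t0 (ltW N0)).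
    by rewrite addr_ge0// mulr_ge0// ?(ltW k0) ?(ltW c0) ?(ltW kB).
  have := approximate_flows_close t0 tT (ltn0Sn _) E0 _ (step p Mp) (step q Mq).
  rewrite /euler_path !mul0r truncn0 => /(_ erefl) H.
  apply: (le_trans H).
  have h1 : expR (L * T) * (2 * T * k) = e / 2 by rewrite /k; field; rewrite !gt_eqF.
  have h2 : c * (4 * N%:R * (k + B) * expR (L * T)) <= e.
    by rewrite -ler_pdivlMr ?mulr_gt0// ge_min lexx orbT.
  have -> : expR (L * T) * (N%:R * (2 * (t / N%:R * k + c * (k + B)))) =
    expR (L * T) * (2 * t * k) + c * (4 * N%:R * (k + B) * expR (L * T)) / 2.
    by field; rewrite gt_eqF.
  have h3 : expR (L * T) * (2 * t * k) <= expR (L * T) * (2 * T * k).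
    by rewrite ler_pM2l// ler_pM2r// ler_pM2l.
  lra.
have [l lP] := uniform_cauchy_limit uc.
have lP' (e : R) : 0 < e -> exists N, forall p, (N <= p)%N -> forall t x, 0 <= t -> t <= T ->
    `|euler_path (h p) t x - l (t, x)| <= e.
  move=> /lP[N NP]; exists N => p Np t x t0 tT.
  by have := NP p (t, x) Np; rewrite /= t0 tT; exact.
exists (fun t x => l (t, x)); split.
- move=> x; apply/eqP; rewrite -subr_eq0 -normr_le0; apply/ler_addgt0Pr => e /lP'[N NP].
  have := NP N (leqnn N) 0 x (lexx 0) (ltW T0).
  by rewrite /euler_path mul0r truncn0 /= distrC add0r.
- move=> t x y t0 tT; apply/ler_addgt0Pr => e e0.
  have [N NP] := lP' _ (divr2_gt0 e0).
  have h1 := NP N (leqnn N) t x t0 tT; have h2 := NP N (leqnn N) t y t0 tT.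
  have h3 := euler_path_lipschitz x y (h0 N) t0 tT.
  have := ler_distD (euler_path (h N) t x) (l (t, x)) (l (t, y)).
  have := ler_distD (euler_path (h N) t y) (euler_path (h N) t x) (l (t, y)).
  rewrite [`|l (t, x) - euler_path _ _ _|]distrC; lra.
- move=> k k0; have [d d0 dP] := euler_path_increment k0.
  exists d => // s t x s0 st tT tsd; apply/ler_addgt0Pr => e e0.
  have sT : s <= T by exact: le_trans tT.
  have t0 : 0 <= t by exact: le_trans st.
  (* The distance between limit and polygon is paid once at t, once at s, and (t - s) L times
     through the velocity. *)
  pose r := e / (2 * (2 + (t - s) * L)).
  have ts0 : 0 <= t - s by rewrite subr_ge0.
  have den : 0 < 2 + (t - s) * L by rewrite ltr_pwDl// mulr_ge0.
  have r0 : 0 < r by rewrite divr_gt0// mulr_gt0.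
  have [N1 N1P] := lP' r r0.
  have kB : 0 < k + B by rewrite ltr_pwDl.
  have c0 : 0 < Num.min d (e / (2 * (k + B))) by rewrite lt_min d0 divr_gt0// mulr_gt0.
  have [N2 N2P] := natSinv_small c0.
  pose p := maxn N1 N2.
  have hp := N2P p (leq_maxr _ _); rewrite le_min in hp; move: hp => /andP[hd hk].
  have h1 := N1P p (leq_maxl _ _) t x t0 tT.
  have h2 := N1P p (leq_maxl _ _) s x s0 sT.
  have h3 := dP (h p) s t x (h0 p) hd s0 st tsd.
  have h4 : h p * (k + B) <= e / 2.
    have := hk; rewrite ler_pdivlMr ?mulr_gt0// -/(h p); lra.
  set Y := euler_path (h p) in h1 h2 h3 *.
  have -> : l (t, x) - l (s, x) - (t - s) *: v s (l (s, x)) =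
     (Y t x - Y s x - (t - s) *: v s (Y s x)) + ((l (t, x) - Y t x) +
       ((Y s x - l (s, x)) + (t - s) *: (v s (Y s x) - v s (l (s, x))))).
    by apply/rowP => i; rewrite !mxE; ring.
  have h5 : `|(t - s) *: (v s (Y s x) - v s (l (s, x)))| <= (t - s) * (L * r).
    rewrite normrZ ger0_norm// ler_wpM2l//; apply: (le_trans (vL _ _ _)).
    by rewrite ler_wpM2l.
  rewrite (le_trans (ler_normD _ _))// (le_trans (lerD h3 (ler_normD _ _)))//.
  rewrite [`|l (t, x) - Y _ _|]distrC.
  have := ler_normD (Y s x - l (s, x)) ((t - s) *: (v s (Y s x) - v s (l (s, x)))).
  have h6 : r * (2 + (t - s) * L) = e / 2 by rewrite /r; field; rewrite gt_eqF.
  lra.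
Qed.

(** The step t / N.+1 makes the last Euler point fall exactly at time t, and the threshold is
    uniform in x. *)
Lemma euler_cvg_flow T X (t e : R) : is_flow T X -> 0 <= t -> t <= T -> 0 < e ->
  exists M, forall N, (M <= N)%N -> forall x,
    `|euler (t / N.+1%:R) N.+1 x - X t x| <= e.
Proof.
move=> [X0 _ Xi] t0 tT e0; have [[B0 L0] vB vL _] := vv.
have T0 : 0 <= T by exact: le_trans tT.
have eT : 0 < expR (L * T) by exact: expR_gt0.
pose k := e / ((T + 1) * expR (L * T)).
have T1 : 0 < T + 1 by rewrite ltr_wpDl.
have k0 : 0 < k by rewrite divr_gt0// mulr_gt0.
have [d d0 dP] := Xi k k0.
have [M MP] := natSinv_small (divr_gt0 d0 T1).
exists M => N MN x; set h := t / N.+1%:R.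
have h0 : 0 <= h by rewrite divr_ge0.
have Nh : N.+1%:R * h = t by rewrite mulrC divfK// pnatr_eq0.
have hd : h <= d.
  apply: (@le_trans _ _ ((T + 1) * (d / (T + 1)))); last by rewrite mulrC divfK// gt_eqF.
  by apply: ler_pM => //; [rewrite (le_trans tT)// lerDl|exact: MP].
have := @discrete_gronwall R (fun j => `|euler h j x - X (j%:R * h) x|) (h * k) (h * L) N.+1.
rewrite /= mul0r X0 subrr normr0 => H.
have {H} := H _ _ (lexx 0) _ N.+1 (leqnn _); rewrite add0r Nh => H.
apply: (le_trans (H _ _ _)).
- by rewrite mulr_ge0// ltW.
- by rewrite mulr_ge0.
- move=> j jN.
  have jh : 0 <= j%:R * h by rewrite mulr_ge0.
  have jhT : j%:R * h + h <= T.
    apply: le_trans tT; rewrite -Nh -{2}[h]mul1r -mulrDl natr1.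
    by rewrite ler_wpM2r// ler_nat.
  have := dP (j%:R * h) (j%:R * h + h) x jh _ jhT _.
  rewrite lerDl h0 addrAC subrr add0r => /(_ isT hd) h1.
  rewrite -natr1 mulrDl mul1r.
  set s := j%:R * h in h1 jh *; set y := euler h j x.
  have -> : y + h *: v s y - X (s + h) x =
    (y - X s x) + h *: (v s y - v s (X s x)) - (X (s + h) x - X s x - h *: v s (X s x)).
    by apply/rowP => i; rewrite !mxE; ring.
  rewrite (le_trans (ler_normB _ _))// lerD// (le_trans (ler_normD _ _))//.
  rewrite mulrDl mul1r lerD2l normrZ ger0_norm// -[leRHS]mulrA.
  by apply: ler_wpM2l => //; exact: vL.
- have -> : h * L * N.+1%:R = L * t by rewrite -Nh; ring.
  have -> : N.+1%:R * (h * k) = t * k by rewrite -Nh; ring.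
  have -> : e = expR (L * T) * ((T + 1) * k).
    by rewrite /k; field; rewrite !gt_eqF.
  apply: ler_pM; [exact: expR_ge0|exact: mulr_ge0 t0 (ltW k0)| |].
    by rewrite ler_expR ler_wpM2l.
  by rewrite ler_pM2r// (le_trans tT)// lerDl.
Qed.

End Euler.

(** * Transport of weak solutions by the flow *)

(** The three constants are tracked because composing with an Euler step keeps [U], multiplies [l]
    by 1 + h L and enlarges the support radius [r] by h B. *)
Definition lipschitz_observable (R : realType) n (U l r : R) (u : 'rV[R]_n -> R) :=
  [/\ forall x, `|u x| <= U, forall x y, `|u x - u y| <= l * `|x - y| & box_supported r u].

Lemma observable_bounded_measurable (R : realType) n (U l r : R) (u : 'rV[R]_n -> R) :
  lipschitz_observable U l r u -> bounded_measurable u.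
Proof.
move=> [uU ul _]; split; last by exists U.
exact: continuous_measurable_rV (lipschitz_continuous ul).
Qed.

Lemma bounded_measurable_diff (R : realType) n (f : 'rV[R]_n -> R) : bounded_measurable f ->
  bounded_measurable (fun z : 'rV[R]_n * 'rV[R]_n => f (z.1 - z.2)).
Proof.
apply: (@bounded_measurable_comp _ _ _ ('rV[R]_n * 'rV[R]_n)%type R f (fun z => z.1 - z.2)).
apply: measurable_fun_rV => i.
rewrite (_ : (fun _ => _) = (fun z : 'rV[R]_n * 'rV[R]_n => z.1 0 i - z.2 0 i)).
  apply: measurable_funB; apply: (measurableT_comp (measurable_coord i)) => //.
by apply/funext => z; rewrite !mxE.
Qed.

Lemma bounded_measurable_fst d1 d2 (T1 : measurableType d1) (T2 : measurableType d2)
    (R : realType) (f : T1 -> R) : bounded_measurable f ->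
  bounded_measurable (fun z : T1 * T2 => f z.1).
Proof. exact: (bounded_measurable_comp measurable_fst). Qed.

Lemma bounded_measurable_snd d1 d2 (T1 : measurableType d1) (T2 : measurableType d2)
    (R : realType) (f : T2 -> R) : bounded_measurable f ->
  bounded_measurable (fun z : T1 * T2 => f z.2).
Proof. exact: (bounded_measurable_comp measurable_snd). Qed.

Lemma lipschitz_measurable_rV (R : realType) n (F : 'rV[R]_n -> 'rV[R]_n) (K : R) :
  (forall x y, `|F x - F y| <= K * `|x - y|) -> measurable_fun setT F.
Proof.
move=> FK; apply: measurable_fun_rV => i; apply: continuous_measurable_rV.
apply: (@lipschitz_continuous _ _ _ K) => x y.
by have := normrV_ge (F x - F y) i; rewrite !mxE => /le_trans; apply.
Qed.

Section MollB.
Context {R : realType} {n : nat}.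
Variables (e : R) (phi : nat -> R -> R).
Hypothesis (sphi : smooth_jet e phi).

Lemma mollB (f g : 'rV[R]_n -> R) x : bounded_measurable f -> bounded_measurable g ->
  moll phi (fun y => f y - g y) x = moll phi f x - moll phi g x.
Proof.
move=> bf bg; have [m mP] := exists_box_measure n (`|x| + e).
have bk := bounded_measurable_kernel sphi (fun=> 0%N) x.
have mE h : bounded_measurable h ->
    moll phi h x = \int[m]_y (h y * prod_kernel phi (fun=> 0%N) (y - x)).
  move=> bh; rewrite /moll mP//; first exact: bounded_measurableM.
  exact: (box_supported_kernel sphi).
rewrite !mE//; last exact: bounded_measurableB.
rewrite -RintB; try exact: bounded_measurableM.
by congr Rintegral; apply/funext => y; rewrite mulrBl.
Qed.

End MollB.

Section TransportStep.
Context {R : realType} {n : nat}.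
Variables (T B L : R) (mu : R -> probability 'rV[R]_n R) (v : R -> 'rV[R]_n -> 'rV[R]_n).
Hypotheses (umu : uniform_curve mu) (vv : velocity_field B L v)
  (wc : weak_continuity T mu v).
Variables (e : R) (phi : nat -> R -> R).
Hypotheses (e0 : 0 <= e) (sphi : smooth_jet e phi) (phi_ge0 : forall x, 0 <= phi 0%N x)
  (phi_even : forall x, phi 0%N (- x) = phi 0%N x)
  (phi1 : \int[lebesgue_measure]_t phi 0%N t = 1).
Local Notation al0 := (fun=> 0%N : nat).
Variables (rmax : R) (m : {finite_measure set 'rV[R]_n -> \bar R}).
Hypothesis (mP : box_measure_spec rmax m).

Lemma kernel_even (x y : 'rV[R]_n) : prod_kernel phi al0 (x - y) = prod_kernel phi al0 (y - x).
Proof.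
by apply: eq_bigr => i _; rewrite -phi_even !mxE opprB.
Qed.

Lemma moll_box (u : 'rV[R]_n -> R) x : bounded_measurable u -> box_supported rmax u ->
  moll phi u x = \int[m]_z (u z * prod_kernel phi al0 (x - z)).
Proof.
move=> bu u0; rewrite /moll mP.
- by congr Rintegral; apply/funext => z; rewrite kernel_even.
- by apply: bounded_measurableM => //; exact: bounded_measurable_kernel sphi _ _.
- by move=> y i Ky; rewrite (u0 y i Ky) mul0r.
Qed.

Let bkernel al : bounded_measurable (prod_kernel phi al : 'rV[R]_n -> R).
Proof.
have := bounded_measurable_kernel sphi al (0 : 'rV[R]_n).
by congr bounded_measurable; apply/funext => y; rewrite subr0.
Qed.

Lemma bounded_measurable_moll (u : 'rV[R]_n -> R) :
  bounded_measurable u -> box_supported rmax u -> bounded_measurable (moll phi u).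
Proof.
move=> bu u0; rewrite (_ : moll phi u = fun x => \int[m]_z (u z * prod_kernel phi al0 (x - z))).
  apply: (@bounded_measurable_Rint2 _ _ 'rV[R]_n 'rV[R]_n R m m
    (fun z => u z.2 * prod_kernel phi al0 (z.1 - z.2))).
  apply: bounded_measurableM; first exact: bounded_measurable_snd.
  exact: bounded_measurable_diff (bkernel al0).
by apply/funext => x; exact: moll_box.
Qed.

(* The commutator [moll u (x + h v x) - moll (u \o E) x], with [E x = x + h v x],
   is [O(h e)] rather than just [O(e)]: the shift [h v] varies by at most
   [h L e] on the support of the kernel. *)
Lemma transport_step (k : R) : 0 < k -> exists2 C : R, 0 <= C & exists2 d : R, 0 < d &
  forall (U l r : R) (u : 'rV[R]_n -> R) (s t : R),
    lipschitz_observable U l r u -> 0 <= U -> 0 <= l -> r + (t - s) * B <= rmax ->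
    0 <= s -> s <= t -> t <= T -> t - s < d ->
    `|\int[mu t]_x moll phi u x -
      \int[mu s]_x moll phi (fun z => u (z + (t - s) *: v s z)) x| <=
    (t - s) * (U * fine (m setT) * (k + (t - s) * C) + l * L * e).
Proof.
move=> k0; have [[B0 L0] vB vL _] := vv.
have [C C0 CP] := prod_jet_taylor (n := n) al0 (fun=> sphi).
have [d d0 dP] := density_increment umu vv wc sphi k0.
exists (C * B ^+ 2); first by rewrite mulr_ge0// exprn_ge0.
exists d => // U l r u s t ou U0 l0 rr s0 st tT tsd.
set h := t - s in tsd rr *; have h0 : 0 <= h by rewrite subr_ge0.
have bu := observable_bounded_measurable ou; have [uU ul ur] := ou.
have hB : 0 <= h * B by rewrite mulr_ge0.
have u0 : box_supported rmax u by move=> x i xi; apply: ur; lra.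
have mfin : 0 <= fine (m setT) by exact: fine_ge0.
have bG : bounded_measurable (fun z : 'rV[R]_n * 'rV[R]_n =>
    u z.2 * (prod_kernel phi al0 (z.1 - z.2) + h * flux v phi s z.2 z.1)).
  apply: bounded_measurableM; first exact: bounded_measurable_snd.
  apply: bounded_measurableD; first exact: bounded_measurable_diff (bkernel al0).
  apply: bounded_measurableM; first exact: bounded_measurable_cst.
  rewrite /flux; apply: bounded_measurable_sum => i; apply: bounded_measurableM.
    exact: bounded_measurable_diff (bkernel _).
  exact: bounded_measurable_fst (velocity_bounded_measurable vv s i).
have bK : bounded_measurable (fun z : 'rV[R]_n * 'rV[R]_n =>
    u z.2 * prod_kernel phi al0 (z.1 - z.2)).
  apply: bounded_measurableM; first exact: bounded_measurable_snd.
  exact: bounded_measurable_diff (bkernel al0).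
(* Fubini, with the evenness of the kernel, moves the mollification from u to mu_t. *)
have At : \int[mu t]_x moll phi u x = \int[m]_z (u z * density mu phi t z).
  under eq_Rintegral do rewrite moll_box//.
  rewrite (@Rint_Fubini _ _ 'rV[R]_n 'rV[R]_n R (mu t) m
    (fun z => u z.2 * prod_kernel phi al0 (z.1 - z.2)))//=.
  apply: eq_Rintegral => z _; rewrite RintZ//; exact: bounded_measurable_kernel sphi _ _.
have Bs : \int[mu s]_x \int[m]_z
     (u z * (prod_kernel phi al0 (x - z) + h * flux v phi s z x)) =
   \int[m]_z (u z * (density mu phi s z + h * \int[mu s]_x flux v phi s z x)).
  rewrite (@Rint_Fubini _ _ 'rV[R]_n 'rV[R]_n R (mu s) m (fun z =>
    u z.2 * (prod_kernel phi al0 (z.1 - z.2) + h * flux v phi s z.2 z.1)))//=.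
  apply: eq_Rintegral => z _.
  have bf := flux_bounded_measurable vv sphi s z.
  have bk := bounded_measurable_kernel sphi al0 z.
  rewrite RintZ//; last first.
    by apply: bounded_measurableD => //; apply: bounded_measurableM => //;
      exact: bounded_measurable_cst.
  rewrite RintD//; last by apply: bounded_measurableM => //; exact: bounded_measurable_cst.
  by rewrite RintZ.
have bdens t' : bounded_measurable (density mu phi t').
  apply: (@bounded_measurable_Rint1 _ _ 'rV[R]_n 'rV[R]_n R (mu t') m
    (fun z => prod_kernel phi al0 (z.1 - z.2))).
  exact: bounded_measurable_diff (bkernel al0).
have bflux : bounded_measurable (fun z => \int[mu s]_x flux v phi s z x).
  apply: (@bounded_measurable_Rint1 _ _ 'rV[R]_n 'rV[R]_n R (mu s) m
    (fun z => flux v phi s z.2 z.1)).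
  rewrite /flux; apply: bounded_measurable_sum => i; apply: bounded_measurableM.
    exact: bounded_measurable_diff (bkernel _).
  exact: bounded_measurable_fst (velocity_bounded_measurable vv s i).
have bhflux : bounded_measurable (fun z => h * \int[mu s]_x flux v phi s z x).
  by apply: bounded_measurableM => //; exact: bounded_measurable_cst.
have d1 : `|\int[m]_z (u z * density mu phi t z) -
   \int[m]_z (u z * (density mu phi s z + h * \int[mu s]_x flux v phi s z x))| <=
   U * (k * h) * fine (m setT).
  have b1 := bounded_measurableM bu (bdens t).
  have b2 := bounded_measurableM bu (bounded_measurableD (bdens s) bhflux).
  rewrite -RintB//; apply: le_norm_Rint_cst; first exact: bounded_measurableB.
  move=> z; rewrite -mulrBr normrM ler_pM// opprD addrA; exact: dP.
pose E (x : 'rV[R]_n) := x + h *: v s x.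
have EL x y : `|E x - E y| <= (1 + h * L) * `|x - y|.
  have -> : E x - E y = (x - y) + h *: (v s x - v s y).
    by apply/rowP => i; rewrite !mxE; ring.
  rewrite (le_trans (ler_normD _ _))// mulrDl mul1r lerD2l normrZ ger0_norm// -mulrA.
  by rewrite ler_wpM2l.
have bmE : bounded_measurable (fun x => moll phi u (E x)).
  apply: (bounded_measurable_comp (lipschitz_measurable_rV EL)).
  exact: bounded_measurable_moll.
have bmG : bounded_measurable (fun x : 'rV[R]_n => \int[m]_z
     (u z * (prod_kernel phi al0 (x - z) + h * flux v phi s z x))).
  exact: (@bounded_measurable_Rint2 _ _ 'rV[R]_n 'rV[R]_n R m m _ bG).
(* By Taylor's formula, k(x - z) + h flux is k(E(x) - z) up to C (h B)^2. *)
have d2 : `|\int[mu s]_x \int[m]_z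
     (u z * (prod_kernel phi al0 (x - z) + h * flux v phi s z x)) -
     \int[mu s]_x moll phi u (E x)| <= U * (C * (h * B) ^+ 2) * fine (m setT).
  rewrite -RintB//; apply: le_norm_Rint_probability; first exact: bounded_measurableB.
  move=> x; rewrite moll_box// -RintB.
  - apply: le_norm_Rint_cst.
      apply: bounded_measurableB.
        exact: (@bounded_measurable_pair1 _ _ 'rV[R]_n 'rV[R]_n R _ x bG).
      exact: (@bounded_measurable_pair1 _ _ 'rV[R]_n 'rV[R]_n R _ (E x) bK).
    move=> z; rewrite -mulrBr normrM ler_pM// distrC.
    have := CP (x - z) (h *: v s x).
    have -> : x - z + h *: v s x = E x - z by rewrite /E addrAC.
    have -> : \sum_i prod_jet (fun=> phi) (incr_at i al0) (x - z) * (h *: v s x) 0 i =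
       h * flux v phi s z x.
      by rewrite /flux mulr_sumr; apply: eq_bigr => i _; rewrite !mxE; rewrite /prod_kernel; ring.
    rewrite opprD addrA => /le_trans; apply; rewrite ler_wpM2l// lerXn2r ?nnegrE//.
    by rewrite normrZ ger0_norm// ler_wpM2l.
  - exact: (@bounded_measurable_pair1 _ _ 'rV[R]_n 'rV[R]_n R _ x bG).
  - exact: (@bounded_measurable_pair1 _ _ 'rV[R]_n 'rV[R]_n R _ (E x) bK).
have buE : bounded_measurable (u \o E).
  exact: (bounded_measurable_comp (lipschitz_measurable_rV EL)).
(* Both terms are mollifications at the same point x once u is translated by h v(x). The difference
   of the mollified functions vanishes at x, so [moll_close] with value 0 there bounds it. *)
have pw x : `|moll phi u (E x) - moll phi (u \o E) x| <= h * (l * L * e).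
  have bus : bounded_measurable (fun y : 'rV[R]_n => u (y + h *: v s x)).
    apply: (@bounded_measurable_comp _ _ _ _ R u) => //.
    by apply: (@lipschitz_measurable_rV _ _ _ 1) => y z; rewrite opprD addrACA subrr addr0 mul1r.
  have -> : moll phi u (E x) = moll phi (fun y : 'rV[R]_n => u (y + h *: v s x)) x.
    rewrite /moll -(@integral_rV_shift _ _ (`|E x| + e) _ (h *: v s x)).
    - congr integral_rV; apply/funext => y; congr (_ * prod_kernel _ _ _).
      by rewrite /E; apply/rowP => i; rewrite !mxE; ring.
    - by apply: bounded_measurableM => //; exact: bounded_measurable_kernel sphi _ _.
    - exact: (box_supported_kernel sphi).
  rewrite -(mollB sphi _ bus buE).
  have := @moll_close _ n e phi e0 sphi phi_ge0 phi1
    (fun y : 'rV[R]_n => u (y + h *: v s x) - (u \o E) y) x (h * (l * L * e)).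
  have -> : u (x + h *: v s x) - (u \o E) x = 0 by rewrite /= subrr.
  rewrite subr0; apply.
  - exact: bounded_measurableB.
  - by rewrite !mulr_ge0.
  - move=> y ye; rewrite subr0 (le_trans (ul _ _))//.
    have -> : y + h *: v s x - E y = h *: (v s x - v s y).
      by apply/rowP => i; rewrite !mxE; ring.
    rewrite normrZ ger0_norm// mulrCA ler_wpM2l// -mulrA ler_wpM2l//.
    by rewrite (le_trans (vL _ _ _))// ler_wpM2l// distrC.
have supE : box_supported rmax (u \o E).
  move=> x i xi; apply: ur; rewrite !mxE.
  have : `|h * v s x 0 i| <= h * B.
    rewrite normrM ger0_norm// ler_wpM2l//; exact: le_trans (normrV_ge _ _) (vB _ _).
  have := ler_normB (x 0 i + h * v s x 0 i) (h * v s x 0 i); rewrite addrK; lra.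
have bE := bounded_measurable_moll buE supE.
have d3 : `|\int[mu s]_x moll phi u (E x) - \int[mu s]_x moll phi (u \o E) x| <=
    h * (l * L * e).
  rewrite -RintB//; apply: le_norm_Rint_probability => //; exact: bounded_measurableB.
rewrite At; move: d1 d2 d3; rewrite -Bs.
set a := \int[m]_z _; set b := \int[mu s]_x _; set b' := \int[mu s]_x _.
set c := \int[mu s]_x _ => d1 d2 d3.
rewrite (_ : a - c = (a - b) + (b - b') + (b' - c)); last by ring.
rewrite (le_trans (ler_normD _ _))// (le_trans (lerD (ler_normD _ _) (lexx _)))//.
rewrite (le_trans (lerD (lerD d1 d2) d3))//.
by rewrite le_eqVlt; apply/orP; left; apply/eqP; ring.
Qed.

Lemma observable_euler_step U l r h s (u : 'rV[R]_n -> R) : 0 <= h -> 0 <= l ->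
  lipschitz_observable U l r u ->
  lipschitz_observable U (l * (1 + h * L)) (r + h * B) (fun z => u (z + h *: v s z)).
Proof.
move=> h0 l0 [uU ul ur]; have [[B0 L0] vB vL _] := vv; split=> [//|x y|x i xi].
  rewrite (le_trans (ul _ _))// -mulrA ler_wpM2l//.
  have -> : x + h *: v s x - (y + h *: v s y) = (x - y) + h *: (v s x - v s y).
    by apply/rowP => i; rewrite !mxE; ring.
  rewrite (le_trans (ler_normD _ _))// mulrDl mul1r lerD2l normrZ ger0_norm// -mulrA.
  by rewrite ler_wpM2l.
apply: (ur _ i); rewrite !mxE.
have : `|h * v s x 0 i| <= h * B.
  rewrite normrM ger0_norm// ler_wpM2l//; exact: le_trans (normrV_ge _ _) (vB _ _).
have := ler_normB (x 0 i + h * v s x 0 i) (h * v s x 0 i); rewrite addrK; lra.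
Qed.

(** The last time step is peeled off first: it turns u into u composed with the Euler step at time j
    h, which is exactly the outermost step of [euler]. The bound l' dominates the Lipschitz
    constants of all the successive observables. *)
Lemma transport_iterate (k : R) : 0 < k -> exists2 C : R, 0 <= C & exists2 d : R, 0 < d &
  forall (h U l' : R) j l r (u : 'rV[R]_n -> R), 0 <= h -> h < d -> 0 <= U ->
    j%:R * h <= T -> lipschitz_observable U l r u -> 0 <= l ->
    l * (1 + h * L) ^+ j <= l' -> r + j%:R * h * B <= rmax ->
    `|\int[mu (j%:R * h)]_x moll phi u x -
      \int[mu 0]_x moll phi (u \o euler v h j) x| <=
    j%:R * h * (U * fine (m setT) * (k + h * C) + l' * L * e).
Proof.
move=> k0; have [[B0 L0] vB vL _] := vv.
have [C C0 [d d0 dP]] := transport_step k0.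
exists C => //; exists d => // h U l' j l r u h0 hd U0.
elim: j l r u => [|j IH] l r u jT ou l0 ll rr.
  by rewrite !mul0r subrr normr0.
have jh0 : 0 <= j%:R * h by rewrite mulr_ge0.
have jS : j.+1%:R * h = j%:R * h + h by rewrite -natr1 mulrDl mul1r.
rewrite jS in jT rr *.
have hL : 0 <= h * L by rewrite mulr_ge0.
have ou' := observable_euler_step (j%:R * h) h0 l0 ou.
have l1 : 0 <= l * (1 + h * L) by rewrite mulr_ge0// addr_ge0.
have ll' : l * (1 + h * L) * (1 + h * L) ^+ j <= l' by rewrite -mulrA -exprS.
have jT' : j%:R * h <= T by lra.
have rr' : r + h * B + j%:R * h * B <= rmax by lra.
have IH' := IH _ _ _ jT' ou' l1 ll' rr'.
have jhB : 0 <= j%:R * h * B by rewrite mulr_ge0.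
have rh : r + h * B <= rmax by lra.
have := dP U l r u (j%:R * h) (j%:R * h + h) ou U0 l0.
have -> : j%:R * h + h - j%:R * h = h by ring.
rewrite lerDl h0 hd => /(_ rh jh0 isT jT isT) st.
set a := \int[mu (_ + h)]_x _ in st *; set c := \int[mu 0]_x _ in IH' *.
set b := \int[mu _]_x _ in st IH'.
rewrite (_ : a - c = (a - b) + (b - c)); last by ring.
rewrite (le_trans (ler_normD _ _))// [leRHS]mulrDl addrC lerD//.
apply: (le_trans st); rewrite ler_wpM2l// lerD2l.
rewrite ler_wpM2r// ler_wpM2r//; apply: le_trans ll.
by rewrite ler_peMr// exprn_ege1// lerDl.
Qed.

End TransportStep.

(** * Measures determined by Lipschitz observables *)

Lemma exists_distance (R : realType) n (U : set 'rV[R]_n) : open U ->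
  exists d : 'rV[R]_n -> R, [/\ forall x, 0 <= d x, forall x y, `|d x - d y| <= `|x - y|,
    forall x, ~ U x -> d x = 0 & forall x, U x -> 0 < d x].
Proof.
move=> oU; have [[z Uz]|UT] := pselect (exists z, ~ U z); last first.
  (* When U is everything, the infimum over its empty complement would be 0 by convention, so a
     positive constant is taken instead. *)
  exists (fun=> 1); split=> // [x y|x Ux]; first by rewrite subrr normr0.
  by exfalso; apply: UT; exists x.
pose D x := [set `|x - y| | y in ~` U]; pose d x := inf (D x).
have D0 x : D x !=set0 by exists `|x - z|; exists z.
have lbD x : has_lbound (D x) by exists 0 => _ [y _ <-].
have d0 x : 0 <= d x by apply: lb_le_inf => // _ [y _ <-].
have dD x y : ~ U y -> d x <= `|x - y| by move=> Uy; apply: ge_inf => //; exists y.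
have dlip x y : d x <= d y + `|x - y|.
  rewrite -lerBlDr; apply: lb_le_inf => // _ [w Uw <-].
  by rewrite lerBlDl (le_trans (dD x w Uw))// ler_distD.
exists d; split=> //.
- move=> x y; have := dlip x y; have := dlip y x; rewrite [`|y - x|]distrC ler_norml.
  by move=> h1 h2; apply/andP; split; lra.
- by move=> x Ux; apply/eqP; rewrite eq_le d0 andbT -(normr0 'rV[R]_n) -(subrr x) dD.
- move=> x Ux; have : nbhs x U by rewrite nbhsE; exists U.
  rewrite -nbhs_ballE => -[e /= e0 eU]; apply: (lt_le_trans e0).
  apply: lb_le_inf => // _ [y Uy <-]; rewrite leNgt; apply/negP => xy; apply: Uy.
  by apply: eU; rewrite -ball_normE.
Qed.

Lemma dist_min (R : realType) (a b a' b' c : R) : `|a - a'| <= c -> `|b - b'| <= c ->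
  `|Num.min a b - Num.min a' b'| <= c.
Proof.
rewrite !ler_norml => /andP[? ?] /andP[? ?].
by case: (leP a b) => ?; case: (leP a' b') => ?; apply/andP; split; lra.
Qed.

Lemma dist_max (R : realType) (a b a' b' c : R) : `|a - a'| <= c -> `|b - b'| <= c ->
  `|Num.max a b - Num.max a' b'| <= c.
Proof.
rewrite !ler_norml => /andP[? ?] /andP[? ?].
by case: (leP a b) => ?; case: (leP a' b') => ?; apply/andP; split; lra.
Qed.

(** The indicator of U is the pointwise limit of observables: a cutoff of the ball of radius k,
    capped by k times the distance to the complement of U. At each point the sequence is eventually
    constant. *)
Lemma measure_open_eq (R : realType) n (P Q : {finite_measure set 'rV[R]_n -> \bar R}) :
  (forall l r (u : 'rV[R]_n -> R), 0 <= l -> lipschitz_observable 1 l r u ->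
     \int[P]_x u x = \int[Q]_x u x) ->
  forall U, open U -> P U = Q U.
Proof.
move=> PQ U oU; have [d [d0 dl dU0 dU]] := exists_distance oU.
pose u k (x : 'rV[R]_n) := Num.min (Num.max 0 (Num.min 1 (k%:R - `|x|))) (k%:R * d x).
have u01 k x : 0 <= u k x <= 1.
  by rewrite /u le_min ge_min ge_max ge_min le_max !lexx ler01 mulr_ge0.
have uobs k : lipschitz_observable 1 k.+1%:R k%:R (u k).
  split=> [x|x y|x i kx].
  - by have /andP[u0 u1] := u01 k x; rewrite ger0_norm.
  - have h1 := ler_dist_dist x y; have h2 := dl x y.
    have h3 : `|k%:R * d x - k%:R * d y| <= k%:R * `|x - y|.
      by rewrite -mulrBr normrM ger0_norm// ler_wpM2l.
    rewrite -natr1 mulrDl mul1r /u.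
    have k0 : 0 <= k%:R * `|x - y| by rewrite mulr_ge0.
    apply: dist_min; last by rewrite (le_trans h3)// lerDl.
    apply: dist_max; first by rewrite subrr normr0 addr_ge0.
    apply: dist_min; first by rewrite subrr normr0 addr_ge0.
    have -> : k%:R - `|x| - (k%:R - `|y|) = - (`|x| - `|y|) by ring.
    by rewrite normrN (le_trans h1)// lerDr.
  - have xk : k%:R - `|x| <= 0 by rewrite subr_le0 (le_trans (ltW kx))// normrV_ge.
    apply/eqP; rewrite eq_le; have /andP[-> _] := u01 k x; rewrite andbT.
    by rewrite /u ge_min ge_max lexx ge_min xk orbT.
have ucvg x : (u k x)%:E @[k --> \oo] --> (\1_U x)%:E.
  apply: cvg_near_cst; have [Ux|Ux] := pselect (U x); last first.
    apply: nearW => k; rewrite indicE memNset// /u dU0// mulr0; congr EFin.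
    by apply/eqP; rewrite eq_le ge_min lexx orbT le_min le_max lexx.
  have dx := dU x Ux.
  have [N _ NP] : \forall k \near \oo, Num.max (1 + `|x|) (d x)^-1 <= k%:R.
    exact: nbhs_infty_ger.
  exists N => // k /NP /=; rewrite ge_max => /andP[k1 k2].
  rewrite indicE mem_set// /u; congr EFin.
  have kd : 1 <= k%:R * d x by rewrite -ler_pdivrMr// mul1r.
  have -> : Num.min 1 (k%:R - `|x|) = 1 by apply/min_idPl; lra.
  by rewrite (max_idPr _)// (min_idPl _).
have lim (M : {finite_measure set 'rV[R]_n -> \bar R}) :
    (\int[M]_x (u k x)%:E)%E @[k --> \oo] --> M U.
  have mU : measurable U by exact: open_measurable_rV.
  have -> : M U = (\int[M]_x (\1_U x)%:E)%E by rewrite integral_indic// setIT.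
  apply: (@dominated_cvg _ _ _ _ _ measurableT _ _ (cst 1%E)) => //.
  - by move=> k; apply/measurable_EFinP; have [] := observable_bounded_measurable (uobs k).
  - exact: (bounded_measurable_integrable M (bounded_measurable_cst _ 1)).
  - move=> k x _; have /andP[x0 x1] := u01 k x.
    by rewrite /= lee_fin ger0_norm.
have PQk : (fun k => \int[P]_x (u k x)%:E)%E = (fun k => \int[Q]_x (u k x)%:E)%E.
  apply/funext => k; have bu := observable_bounded_measurable (uobs k).
  by rewrite !Rint_EFin// (PQ _ _ _ _ (uobs k)).
by apply: (@cvg_unique _ (@ereal_hausdorff R) _ _ _ _ (lim P)); rewrite /= PQk.
Qed.

Section TransportByFlow.
Context {R : realType} {n : nat}.
Variables (T B L : R) (mu : R -> probability 'rV[R]_n R) (v X : R -> 'rV[R]_n -> 'rV[R]_n).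
Hypotheses (umu : uniform_curve mu) (vv : velocity_field B L v)
  (wc : weak_continuity T mu v) (XP : is_flow L v T X).

(** The error eps is shared out as eps/3 for mollification and commutators, eps/6 for the density
    increments, eps/6 for the Taylor remainders, and eps/3 for replacing the Euler map by the
    flow. *)
Lemma transport_observable U l r (u : 'rV[R]_n -> R) t : 0 <= t -> t <= T ->
  lipschitz_observable U l r u -> 0 <= U -> 0 <= l ->
  \int[mu t]_x u x = \int[mu 0]_x u (X t x).
Proof.
move=> t0 tT ou U0 l0; have [[B0 L0] vB vL _] := vv; have [uU ul ur] := ou.
have T0 : 0 <= T by exact: le_trans tT.
have bu := observable_bounded_measurable ou.
apply/eqP; rewrite -subr_eq0 -normr_le0; apply/ler_addgt0Pr => eps eps0; rewrite add0r.
pose l' := l * expR (L * T); have l'0 : 0 <= l' by rewrite mulr_ge0// expR_ge0.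
(* All the coefficients of e: mollifying u, mollifying u composed with the Euler map, and the
   accumulated commutators. *)
pose S := l + l' + T * (l' * L).
have S0 : 0 <= S by rewrite !addr_ge0// !mulr_ge0.
have [e [e0 eS]] : exists e, 0 < e /\ S * e <= eps / 3.
  exists (eps / 3 / (S + 1)); have S1 : 0 < S + 1 by rewrite ltr_wpDl.
  have e30 : 0 < eps / 3 by rewrite divr_gt0.
  by split; [rewrite divr_gt0|rewrite mulrCA ger_pMr// ler_pdivrMr// mul1r lerDl].
have [phi [sphi phi_ge0 phi_even phi1]] := exists_mollifier e0.
(* Every Euler step enlarges the support by h B, hence by at most T B in total. *)
have [m mP] := exists_box_measure n (r + T * B).
pose A := T * (U * fine (m setT)).
have A0 : 0 <= A by rewrite !mulr_ge0// fine_ge0.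
have small (c q : R) : 0 <= c -> 0 < q -> exists2 k : R, 0 < k & c * k <= q.
  move=> c0 q0; exists (q / (c + 1)); have c1 : 0 < c + 1 by rewrite ltr_wpDl.
    by rewrite divr_gt0.
  by rewrite mulrCA ger_pMr// ler_pdivrMr// mul1r lerDl.
have e60 : 0 < eps / 6 by rewrite divr_gt0.
have e30 : 0 < eps / 3 by rewrite divr_gt0.
have [k k0 Ak] := small A _ A0 e60.
have [C C0 [d d0 dP]] :=
  transport_iterate umu vv wc (ltW e0) sphi phi_ge0 phi_even phi1 mP k0.
(* The constant C depends on the mollifier, hence on e, so the time step can only be chosen now. *)
have [c c0 Ac] := small (A * C) _ (mulr_ge0 A0 C0) e60.
have [dl dl0 ldl] := small l _ l0 e30.
have [N1 N1P] := euler_cvg_flow vv XP t0 tT dl0.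
pose c' := Num.min c (d / 2).
have c'0 : 0 < c' by rewrite lt_min c0 divr_gt0.
have [h1 h10 Th] := small T _ T0 c'0.
have [N2 N2P] := natSinv_small h10.
pose N := maxn N1 N2; pose h := t / N.+1%:R.
have h0 : 0 <= h by rewrite divr_ge0.
have hc' : h <= c'.
  by apply: le_trans Th; apply: ler_pM => //; apply: N2P; exact: leq_maxr.
have hd : h < d.
  apply: (le_lt_trans hc'); rewrite gt_min; apply/orP; right.
  by rewrite ltr_pdivrMr// ltr_pMr// ltr1n.
have hc : h <= c by apply: (le_trans hc'); rewrite ge_min lexx.
have Nh : N.+1%:R * h = t by rewrite mulrC divfK// pnatr_eq0.
have pow : l * (1 + h * L) ^+ N.+1 <= l'.
  rewrite /l' ler_wpM2l//; apply: (@le_trans _ _ (expR (h * L) ^+ N.+1)).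
    by rewrite lerXn2r ?nnegrE ?expR_ge0 ?expR_ge1Dx// addr_ge0// mulr_ge0.
  by rewrite -expRM_natl ler_expR mulrA Nh mulrC ler_wpM2l.
have rT : r + N.+1%:R * h * B <= r + T * B by rewrite Nh lerD2l ler_wpM2r.
have Nt : N.+1%:R * h <= T by rewrite Nh.
have := dP h U l' N.+1 l r u h0 hd U0 Nt ou l0 pow rT; rewrite Nh => it.
pose w := u \o euler v h N.+1.
have wl x y : `|w x - w y| <= l' * `|x - y|.
  rewrite (le_trans (ul _ _))// /l' -mulrA ler_wpM2l//.
  rewrite (le_trans (euler_lipschitz vv _ _ _ h0))// ler_wpM2r// ler_expR.
  by rewrite mulrAC [h * _]mulrC Nh mulrC ler_wpM2l.
have bw : bounded_measurable w.
  split; first exact: continuous_measurable_rV (lipschitz_continuous wl).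
  by exists U => x; exact: uU.
have XL x y : `|X t x - X t y| <= expR (L * T) * `|x - y| by case: XP => _ H _; exact: H.
have bX : bounded_measurable (fun x => u (X t x)).
  exact: (bounded_measurable_comp (lipschitz_measurable_rV XL)).
have u0 : box_supported (r + T * B) u.
  by move=> x i xi; apply: ur; apply: le_lt_trans xi; rewrite lerDl mulr_ge0.
have bmu := bounded_measurable_moll sphi phi_even mP bu u0.
have w0 : box_supported (r + T * B) w.
  move=> x i xi; apply: (ur _ i).
  have := euler_displacement vv 0 N.+1 x h0; rewrite add0n /= Nh => dis.
  have := le_trans (normrV_ge _ i) dis; rewrite !mxE => disi.
  have tB : t * B <= T * B by rewrite ler_wpM2r.
  have := lerB_dist (x 0 i) (euler v h N.+1 x 0 i); rewrite distrC /= !mxE.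
  by move: disi xi; lra.
have bmw : bounded_measurable (moll phi w).
  by have := bounded_measurable_moll sphi phi_even mP bw w0.
have close l1 (f : 'rV[R]_n -> R) (s : R) : 0 <= l1 -> bounded_measurable f ->
    bounded_measurable (moll phi f) ->
    (forall x y, `|f x - f y| <= l1 * `|x - y|) ->
    `|\int[mu s]_x moll phi f x - \int[mu s]_x f x| <= l1 * e.
  move=> l10 bf bmf fl; rewrite -RintB//; apply: le_norm_Rint_probability.
    exact: bounded_measurableB.
  move=> x; apply: (moll_close (ltW e0) sphi phi_ge0 phi1 bf).
    by rewrite mulr_ge0// ltW.
  by move=> y ye; rewrite (le_trans (fl _ _))// ler_wpM2l.
have s1 := close l u t l0 bu bmu ul.
have s2 := close l' w 0 l'0 bw bmw wl.
have s3 : `|\int[mu 0]_x w x - \int[mu 0]_x u (X t x)| <= l * dl.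
  rewrite -RintB//; apply: le_norm_Rint_probability; first exact: bounded_measurableB.
  move=> x; rewrite (le_trans (ul _ _))// ler_wpM2l//.
  by apply: N1P; exact: leq_maxl.
move: it s1 s2 s3; set a := \int[_]_x _; set b := \int[_]_x _; set a' := \int[_]_x _.
set b' := \int[_]_x _; set b'' := \int[_]_x _ => it s1 s2 s3.
rewrite (_ : a' - b'' = - (a - a') + (a - b) + ((b - b') + (b' - b''))); last by ring.
have h2 : t * (U * fine (m setT) * (k + h * C) + l' * L * e) <=
    A * k + A * C * c + T * (l' * L) * e.
  apply: (@le_trans _ _ (T * (U * fine (m setT) * (k + h * C) + l' * L * e))).
    by rewrite ler_wpM2r// !(addr_ge0, mulr_ge0)// ?fine_ge0// ltW.
  have : A * C * h <= A * C * c by rewrite ler_wpM2l// mulr_ge0.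
  by rewrite /A; lra.
apply: (le_trans (ler_normD _ _)); apply: (le_trans (lerD (ler_normD _ _) (ler_normD _ _))).
rewrite normrN; move: eS; rewrite /S; lra.
Qed.

(** Open sets are stable under intersection and generate the Borel sets, so agreement on them is
    enough. *)
Lemma transport_flow t A : 0 <= t -> t <= T -> measurable A ->
  mu t A = mu 0 (X t @^-1` A).
Proof.
move=> t0 tT; move: A.
have XL x y : `|X t x - X t y| <= expR (L * T) * `|x - y| by case: XP => _ H _; exact: H.
have mX := lipschitz_measurable_rV XL.
have mu0oo : (mu 0 setT < +oo)%E by rewrite probability_setT ltry.
have [m mE] := exists_image_measure mX mu0oo.
suff H : forall A, measurable A -> mu t A = m A by move=> A mA; rewrite H// mE.
have HU : forall U, open U -> mu t U = m U.
  apply: measure_open_eq => l r u l0 ou.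
  have bu := observable_bounded_measurable ou.
  rewrite (transport_observable t0 tT ou ler01 l0).
  by rewrite (Rint_image mX mu0oo mE bu).
apply: (measure_unique (@open 'rV[R]_n) (fun=> setT)) => //.
- by move=> U V; exact: openI.
- by move=> _; exact: openT.
- by rewrite bigcup_const//; exists 0%N.
- by move=> _; exact: (@fin_num_fun_lty _ _ _ (mu t) (fin_num_measure (mu t))).
Qed.

End TransportByFlow.

(** * Stability *)

(** On each cell the left-end value is at most a + eta. Half-open cells make the decomposition of
    the interval disjoint. *)
Lemma riemann_sum_le (R : realType) (a : R -> R) (h eta : R) N :
  measurable_fun setT (a : measurableTypeR R -> R) -> (forall s, 0 <= a s) ->
  0 <= h -> 0 <= eta ->
  (forall s r : R, 0 <= s -> s <= r -> r - s < h -> a s <= a r + eta) ->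
  ((\sum_(i < N) h * a (i%:R * h))%:E <=
   \int[lebesgue_measure]_(s in `[0%R, (N%:R * h)%R[) (a s + eta)%:E)%E.
Proof.
move=> ma a0 h0 eta0 ah.
have mf (D : set (measurableTypeR R)) : measurable_fun D (fun s => (a s + eta)%:E).
  apply: measurable_funTS; apply/measurable_EFinP; exact: measurable_funD.
elim: N => [|N IH]; first by rewrite big_ord0; apply: integral_ge0 => s _; rewrite lee_fin addr_ge0.
have Nh : 0 <= N%:R * h by rewrite mulr_ge0.
have NS : N.+1%:R * h = N%:R * h + h by rewrite -natr1 mulrDl mul1r.
have -> : `[0%R, (N.+1%:R * h)%R[%classic =
    `[0%R, (N%:R * h)%R[ `|` `[(N%:R * h)%R, (N.+1%:R * h)%R[.
  apply/seteqP; split=> s /=; rewrite !in_itv /= NS.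
    by move=> /andP[s0 s1]; case: (ltP s (N%:R * h)) => ?; [left|right]; rewrite ?s0 ?s1.
  by case=> /andP[s0 s1]; apply/andP; split; lra.
rewrite ge0_integral_setU//; last 2 first.
- by move=> s _; rewrite lee_fin addr_ge0.
- apply/disj_setPLR => s /=; rewrite !in_itv /= => /andP[_ s1].
  by apply/negP; rewrite negb_and -ltNge s1.
rewrite big_ord_recr /= EFinD leeD//.
apply: (@le_trans _ _ (\int[lebesgue_measure]_(s in `[(N%:R * h)%R, (N.+1%:R * h)%R[)
    cst (a (N%:R * h))%:E s)%E); last first.
  apply: ge0_le_integral => //; first by move=> s _; rewrite lee_fin.
  move=> s /=; rewrite in_itv /= NS lee_fin => /andP[s1 s2]; apply: ah => //; lra.
have lm : lebesgue_measure `[(N%:R * h)%R, (N.+1%:R * h)%R[%classic = h%:E.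
  rewrite lebesgue_measure_itv /= lte_fin NS ltrDl; case: ltP => h1.
    by rewrite -EFinB addrAC subrr add0r.
  by congr EFin; apply/eqP; rewrite eq_le h0 h1.
have -> := @integral_cst _ _ R lebesgue_measure _
  (measurable_itv `[(N%:R * h)%R, (N.+1%:R * h)%R[) (a (N%:R * h))%:E.
by rewrite [X in (_ * X)%E]lm -EFinM mulrC.
Qed.

Section Jensen.
Context d (Z : measurableType d) (R : realType) (P : probability Z R).

Lemma bounded_measurable_sqr (f : Z -> R) : bounded_measurable f ->
  bounded_measurable (fun z => f z ^+ 2).
Proof. by move=> bf; under eq_fun do rewrite expr2; exact: bounded_measurableM. Qed.

Lemma bounded_measurable_sqnorm n (f : Z -> 'rV[R]_n) :
  (forall i, bounded_measurable (fun z => f z 0 i)) ->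
  bounded_measurable (fun z => sqnorm (f z)).
Proof.
by move=> bf; apply: bounded_measurable_sum => i; exact: bounded_measurable_sqr.
Qed.

(* The integral of [(f - c)^2] is nonnegative, with [c] the mean of [f]. *)
Lemma sqr_Rint_le (f : Z -> R) : bounded_measurable f ->
  (\int[P]_z f z) ^+ 2 <= \int[P]_z (f z ^+ 2).
Proof.
move=> bf; set c := \int[P]_z f z.
have b1 := bounded_measurable_sqr bf.
have bc (r : R) : bounded_measurable (fun _ : Z => r) := bounded_measurable_cst _ r.
have Pc (r : R) : \int[P]_z r = r.
  have -> : \int[P]_z r = fine (r%:E * P setT).
    by rewrite -integral_cst.
  rewrite fineM//; last exact: fin_num_measure.
  by rewrite (_ : fine (P _) = 1) ?mulr1//; exact: (congr1 fine (probability_setT P)).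
have : \int[P]_z 0 <= \int[P]_z (f z ^+ 2 - 2 * c * f z + c ^+ 2).
  apply: le_Rint => //.
    apply: bounded_measurableD => //; apply: bounded_measurableB => //.
    exact: bounded_measurableM.
  by move=> z; rewrite (_ : _ + _ = (f z - c) ^+ 2) ?sqr_ge0//; ring.
rewrite RintD//; last by apply: bounded_measurableB => //; exact: bounded_measurableM.
rewrite RintB//; last exact: bounded_measurableM.
rewrite RintZ// !Pc -/c; lra.
Qed.

Lemma sqnorm_Rint_le n (f : Z -> 'rV[R]_n) :
  (forall i, bounded_measurable (fun z => f z 0 i)) ->
  sqnorm (\row_i \int[P]_z f z 0 i) <= \int[P]_z sqnorm (f z).
Proof.
move=> bf; rewrite /sqnorm Rint_sum => [|i]; last exact: bounded_measurable_sqr.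
by apply: ler_sum => i _; rewrite mxE sqr_Rint_le.
Qed.

End Jensen.

Lemma sobolev2oo_gradient (R : realType) n (f : 'rV[R]_n -> R) : sobolev2oo f ->
  exists2 M : R, 0 <= M & (forall x, `|grad f x| <= M) /\
    (forall x y, `|grad f x - grad f y| <= M * `|x - y|).
Proof.
move=> /sobolev2oo_grad[M M0 HM]; exists M => //; split=> [x|x y].
  by apply: normrV_le => // i; rewrite mxE; have [] := HM i.
apply: normrV_le => [|i]; first by rewrite mulr_ge0.
by rewrite !mxE; have [] := HM i.
Qed.

(* The infimum defining [lipschitz_constant] is attained. *)
Lemma lipschitz_constantP (R : realType) n (F : 'rV[R]_n -> 'rV[R]_n) (M : R) :
  0 <= M -> (forall x y, `|F x - F y| <= M * `|x - y|) ->
  forall x y, sqnorm (F x - F y) <= lipschitz_constant F ^+ 2 * sqnorm (x - y).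
Proof.
move=> M0 FM x y; rewrite /lipschitz_constant; set S := [set K | _].
have en0 (z : 'rV[R]_n) : 0 <= enorm z by exact: sqrtr_ge0.
have enE (z : 'rV[R]_n) : sqnorm z = enorm z ^+ 2 by rewrite sqr_sqrtr// sqnorm_ge0.
have S0 : S !=set0.
  (* The factor sqrt(n) is the price of passing from the sup norm to the Euclidean one; it only
     serves to show that the set is nonempty. *)
  exists (Num.sqrt (n%:R * M ^+ 2)); split=> [|{}x {}y]; first exact: sqrtr_ge0.
  rewrite -sqrtrM ?ler_wsqrtr//; last by rewrite mulr_ge0// exprn_ge0.
  rewrite (le_trans (sqnorm_le _))// -mulrA ler_wpM2l//.
  apply: (@le_trans _ _ ((M * `|x - y|) ^+ 2)).
    by rewrite lerXn2r ?nnegrE ?mulr_ge0.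
  by rewrite exprMn ler_wpM2l ?exprn_ge0// sqr_normrV_le_sqnorm.
have iS0 : 0 <= inf S by apply: lb_le_inf => // K [].
rewrite !enE -exprMn lerXn2r ?nnegrE ?mulr_ge0//.
have [xy|xy] := leP (enorm (x - y)) 0.
  have [K [K0 KP]] := S0; apply: (le_trans (KP x y)).
  by rewrite (_ : enorm (x - y) = 0) ?mulr0//; apply/eqP; rewrite eq_le xy en0.
rewrite -ler_pdivrMr//; apply: lb_le_inf => // K [K0 KP].
by rewrite ler_pdivrMr.
Qed.

(** * Velocity fields generated by the kernels and the potential *)

Section VelocityFields.
Context {R : realType} {n : nat}.
Implicit Types (v w : R -> 'rV[R]_n -> 'rV[R]_n) (mu : R -> probability 'rV[R]_n R).

Lemma velocity_fieldN B L v : velocity_field B L v -> velocity_field B L (fun t x => - v t x).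
Proof.
move=> [BL vB vL vt]; split=> // [t x|t x y|e e0].
- by rewrite normrN.
- by rewrite -opprD normrN.
- by have [d d0 dP] := vt e e0; exists d => // s t st x; rewrite -opprD normrN dP.
Qed.

Lemma velocity_fieldD B L B' L' v w : velocity_field B L v -> velocity_field B' L' w ->
  velocity_field (B + B') (L + L') (fun t x => v t x + w t x).
Proof.
move=> [[B0 L0] vB vL vt] [[B0' L0'] wB wL wt]; split=> [|t x|t x y|e e0].
- by split; rewrite addr_ge0.
- by rewrite (le_trans (ler_normD _ _))// lerD.
- by rewrite opprD addrACA (le_trans (ler_normD _ _))// mulrDl lerD.
- have [d d0 dP] := vt _ (divr2_gt0 e0); have [d' d'0 d'P] := wt _ (divr2_gt0 e0).
  exists (Num.min d d') => [|s t]; first by rewrite lt_min d0.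
  rewrite lt_min => /andP[s1 s2] x; rewrite opprD addrACA (le_trans (ler_normD _ _))//.
  by have := dP s t s1 x; have := d'P s t s2 x; lra.
Qed.

Lemma velocity_field_cst M (F : 'rV[R]_n -> 'rV[R]_n) : 0 <= M -> (forall x, `|F x| <= M) ->
  (forall x y, `|F x - F y| <= M * `|x - y|) -> velocity_field M M (fun=> F).
Proof.
by move=> M0 FM FL; split=> // e e0; exists 1 => // s t _ x; rewrite subrr normr0 ltW.
Qed.

Section Convolution.
Variables (M : R) (W : 'rV[R]_n -> R).
Hypotheses (M0 : 0 <= M) (WM : forall x, `|grad W x| <= M)
  (WL : forall x y, `|grad W x - grad W y| <= M * `|x - y|).

Lemma bounded_measurable_grad i : bounded_measurable (fun x => grad W x 0 i).
Proof. exact: (velocity_bounded_measurable (velocity_field_cst M0 WM WL) 0). Qed.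

Lemma bounded_measurable_grad_shift x i :
  bounded_measurable (fun y : 'rV[R]_n => grad W (x - y) 0 i).
Proof.
apply: (@bounded_measurable_comp _ _ _ 'rV[R]_n _ (fun x => grad W x 0 i)).
  apply: (@lipschitz_measurable_rV _ _ _ 1) => y z.
  by rewrite opprB addrC addrA subrK distrC mul1r.
exact: bounded_measurable_grad.
Qed.

(** For continuity in time, the functions y |-> grad W(x - y) have the same bound and Lipschitz
    constant M for all x, so the modulus of the curve is uniform in x. *)
Lemma velocity_field_grad_conv mu : uniform_curve mu ->
  velocity_field M M (fun t => grad_conv W (mu t)).
Proof.
move=> umu; split=> // [t x|t x y|e e0].
- apply: normrV_le => // i; rewrite mxE; apply: le_norm_Rint_probability.
    exact: bounded_measurable_grad_shift.
  by move=> y; exact: le_trans (normrV_ge _ _) (WM _).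
- apply: normrV_le => [|i]; first by rewrite mulr_ge0.
  rewrite !mxE -RintB; try exact: bounded_measurable_grad_shift.
  apply: le_norm_Rint_probability.
    by apply: bounded_measurableB; exact: bounded_measurable_grad_shift.
  move=> z; have := normrV_ge (grad W (x - z) - grad W (y - z)) i.
  rewrite !mxE => /le_trans; apply; rewrite (le_trans (WL _ _))//.
  by rewrite opprB addrA subrK.
- have M1 : 0 < M + 1 by rewrite ltr_wpDl.
  have [d d0 dP] := umu _ (divr_gt0 e0 M1); exists d => // s t st x.
  apply: normrV_le => [|i]; first exact: ltW.
  rewrite !mxE; apply: (le_trans (dP s t st _ M (bounded_measurable_grad_shift x i) M0 _)).
    move=> y z; have := normrV_ge (grad W (x - y) - grad W (x - z)) i.
    rewrite !mxE => /le_trans; apply; rewrite (le_trans (WL _ _))//.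
    by rewrite opprB addrC addrA subrK distrC.
  by rewrite mulrCA ger_pMr// ler_pdivrMr// mul1r lerDl.
Qed.

End Convolution.

(** Meant for a_t: its uniform continuity is what lets the sums of the discrete Gronwall lemma be
    bounded by the time integral. *)
Lemma uniformly_cont_sqnorm B L mu v : uniform_curve mu -> velocity_field B L v ->
  uniformly_cont (fun t => \int[mu t]_x sqnorm (v t x)).
Proof.
move=> umu vv e e0; have [[B0 L0] vB vL vt] := vv.
have vi t x i : `|v t x 0 i| <= B by exact: le_trans (normrV_ge _ _) (vB t x).
have sq t s x y (r : R) : `|v t x - v s y| <= r ->
    `|sqnorm (v t x) - sqnorm (v s y)| <= n%:R * (2 * B) * r.
  move=> xr; rewrite /sqnorm -sumrB (le_trans (ler_norm_sum _ _ _))//.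
  apply: (@le_trans _ _ (\sum_(i < n) 2 * B * r)); last first.
    by rewrite sumr_const card_ord -[leRHS]mulrA [leRHS]mulr_natl.
  apply: ler_sum => i _; rewrite subr_sqr normrM mulrC ler_pM//.
    by rewrite (le_trans (ler_normD _ _))//; have := vi t x i; have := vi s y i; lra.
  by have := normrV_ge (v t x - v s y) i; rewrite !mxE => /le_trans; apply.
have nB : 0 <= n%:R * (2 * B) by rewrite !mulr_ge0.
pose c := n%:R * (2 * B) * (L + 1).
have c0 : 0 <= c by rewrite mulr_ge0// addr_ge0.
have r0 : 0 < e / (2 * (c + 1)) by rewrite divr_gt0// mulr_gt0// ltr_wpDl.
have rc : c * (e / (2 * (c + 1))) <= e / 2.
  rewrite (_ : _ * _ = e / 2 * (c / (c + 1))); last by field; rewrite gt_eqF// ltr_wpDl.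
  by rewrite ger_pMr ?divr_gt0// ler_pdivrMr ?ltr_wpDl// mul1r lerDl.
have [d d0 dP] := umu _ r0; have [d' d'0 d'P] := vt _ r0.
exists (Num.min d d') => [|s t]; first by rewrite lt_min d0.
rewrite lt_min => /andP[s1 s2].
have b r : bounded_measurable (fun x => sqnorm (v r x)).
  by apply: bounded_measurable_sqnorm => i; exact: (velocity_bounded_measurable vv).
have h1 : `|\int[mu s]_x sqnorm (v s x) - \int[mu s]_x sqnorm (v t x)| <= e / 2.
  rewrite -RintB//; apply: le_norm_Rint_probability; first exact: bounded_measurableB.
  move=> x; apply: le_trans rc; apply: (le_trans (sq _ _ _ _ _ (d'P s t s2 x))).
  by apply: ler_wpM2r; [exact: ltW|rewrite /c ler_peMr// lerDr].
have h2 : `|\int[mu s]_x sqnorm (v t x) - \int[mu t]_x sqnorm (v t x)| <= e / 2.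
  apply: le_trans rc; apply: dP => // x y.
  apply: (le_trans (sq _ _ _ _ _ (vL t x y))); rewrite /c mulrA ler_wpM2r//.
  by apply: ler_wpM2l => //; rewrite lerDl.
rewrite -(subrKA (\int[mu s]_x sqnorm (v t x))) (le_trans (ler_normD _ _))//.
by move: h1 h2; lra.
Qed.

End VelocityFields.

(* [2 x a <= x^2 + a^2] for each of the five terms. *)
Lemma sqnorm_increment (R : realType) n (h : R) (x a b c1 c2 r : 'rV[R]_n) : 0 <= h ->
  sqnorm (x + h *: (a + b + c1 + c2 + r)) <=
  (1 + 5 * h) * sqnorm x +
  h * (sqnorm a + sqnorm b + sqnorm c1 + sqnorm c2 + sqnorm r) +
  h ^+ 2 * sqnorm (a + b + c1 + c2 + r).
Proof.
move=> h0; rewrite /sqnorm -!big_split /= !mulr_sumr -!big_split /=.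
apply: ler_sum => i _; rewrite !mxE.
move: (x 0 i) (a 0 i) (b 0 i) (c1 0 i) (c2 0 i) (r 0 i) => {}x {}a {}b {}c1 {}c2 {}r.
rewrite -subr_ge0 (_ : _ - _ = h * ((x - a) ^+ 2 + (x - b) ^+ 2 + (x - c1) ^+ 2 +
  (x - c2) ^+ 2 + (x - r) ^+ 2)); last by ring.
by rewrite mulr_ge0// !addr_ge0// sqr_ge0.
Qed.

Lemma exists_small (R : realType) (c q : R) : 0 <= c -> 0 < q ->
  exists k : R, [/\ 0 < k, k <= 1 & c * k <= q].
Proof.
move=> c0 q0; have c1 : 0 < c + 1 by rewrite ltr_wpDl.
have qc : 0 < q / (c + 1) by rewrite divr_gt0.
exists (Num.min 1 (q / (c + 1))); split.
- by rewrite lt_min ltr01.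
- by rewrite ge_min lexx.
apply: (@le_trans _ _ (c * (q / (c + 1)))).
  by rewrite ler_wpM2l// ge_min lexx orbT.
by rewrite mulrCA ger_pMr// ler_pdivrMr// mul1r lerDl.
Qed.

Definition lipschitz_gradient (R : realType) n (M : R) (f : 'rV[R]_n -> R) :=
  [/\ 0 <= M, forall x, `|grad f x| <= M &
      forall x y, `|grad f x - grad f y| <= M * `|x - y|].

Definition drift (R : realType) n (W V : 'rV[R]_n -> R) (mu : R -> probability 'rV[R]_n R)
  (t : R) (x : 'rV[R]_n) : 'rV[R]_n := - (grad_conv W (mu t) x + grad V x).

Section Drift.
Context {R : realType} {n : nat}.
Variables (M : R) (W V : 'rV[R]_n -> R) (mu : R -> probability 'rV[R]_n R).
Hypotheses (gW : lipschitz_gradient M W) (gV : lipschitz_gradient M V)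
  (umu : uniform_curve mu).

Lemma velocity_field_drift : velocity_field (M + M) (M + M) (drift W V mu).
Proof.
have [M0 WM WL] := gW; have [_ VM VL] := gV.
apply: velocity_fieldN; apply: velocity_fieldD; first exact: velocity_field_grad_conv.
exact: velocity_field_cst.
Qed.

End Drift.

Lemma sqnormN (R : realType) n (x : 'rV[R]_n) : sqnorm (- x) = sqnorm x.
Proof. by rewrite /sqnorm; apply: eq_bigr => i _; rewrite !mxE sqrrN. Qed.

(** The free vectors [e] and [f] are intermediate values, to be grad What * mu and grad What * muhat
    at the first point: the difference then splits into the kernel error, a change of measure, a
    change of point and the potential. *)
Lemma drift_diff (R : realType) n (a b c d e f : 'rV[R]_n) :
  - (a + b) - - (c + d) = - (a - e) - (e - f) - (f - c) - (b - d).
Proof. by apply/rowP => i; rewrite !mxE; ring. Qed.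

Lemma sqnorm_le_sqr (R : realType) n (x : 'rV[R]_n) (r : R) : `|x| <= r ->
  sqnorm x <= n%:R * r ^+ 2.
Proof.
move=> xr; rewrite (le_trans (sqnorm_le _))// ler_wpM2l// lerXn2r ?nnegrE//.
exact: le_trans xr.
Qed.

(** The change of measure [b] is bounded by a number [H] independent of the points, whereas [c1] and
    [c2] are controlled by the current distance; they therefore enter the recursion differently. *)
Lemma sqnorm_step (R : realType) n (h k e l1 l2 H C : R)
    (x y x' y' vp vq a b c1 c2 : 'rV[R]_n) :
  0 < h -> 0 <= k -> k <= 1 -> 4 * n%:R * k <= e / 2 -> h * (n%:R * (C + 2) ^+ 2) <= e / 2 ->
  `|x' - x - h *: vp| <= h * k -> `|y' - y - h *: vq| <= h * k ->
  vp - vq = - a - b - c1 - c2 -> `|vp - vq| <= C -> sqnorm b <= H ->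
  sqnorm c1 <= l1 * sqnorm (x - y) -> sqnorm c2 <= l2 * sqnorm (x - y) ->
  sqnorm (x' - y') <= (1 + h * (5 + l1 + l2)) * sqnorm (x - y) +
    (h * sqnorm a + h * (H + e)).
Proof.
move=> h0 k0 k1 ke he xk yk vE vC bH c1H c2H.
(* The joint remainder of the two flows divided by h, so that the increment of x - y is exactly h
   times a sum of five vectors. *)
pose r := h^-1 *: ((x' - x - h *: vp) - (y' - y - h *: vq)).
have rk : `|r| <= 2 * k.
  rewrite normrZ ger0_norm ?invr_ge0 ?(ltW h0)// mulrC ler_pdivrMr//.
  rewrite (le_trans (ler_normB _ _))// (le_trans (lerD xk yk))//.
  by rewrite le_eqVlt; apply/orP; left; apply/eqP; ring.
have E : x' - y' = (x - y) + h *: (- a - b - c1 - c2 + r).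
  by rewrite -vE /r; apply/rowP => i; rewrite !mxE; field; exact: lt0r_neq0.
(* Since k <= 1, n (2 k)^2 <= 4 n k. *)
have hr : sqnorm r <= e / 2.
  apply: le_trans ke; rewrite (le_trans (sqnorm_le_sqr rk))//.
  rewrite (_ : _ * _ = 4 * n%:R * k * k); last by ring.
  by rewrite ler_piMr// !mulr_ge0.
have hu : h * sqnorm (- a - b - c1 - c2 + r) <= e / 2.
  apply: le_trans he; rewrite ler_wpM2l ?(ltW h0)//; apply: sqnorm_le_sqr.
  rewrite -vE (le_trans (ler_normD _ _))// lerD// (le_trans rk)//.
  by rewrite ler_piMr.
rewrite E; apply: (le_trans (sqnorm_increment _ _ _ _ _ _ (ltW h0))).
rewrite (sqnormN a) (sqnormN b) (sqnormN c1) (sqnormN c2).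
move: (sqnorm (x - y)) (sqnorm (- a - b - c1 - c2 + r)) (sqnorm a) (sqnorm b) (sqnorm c1)
  (sqnorm c2) (sqnorm r) hr hu bH c1H c2H => g w a' b' c1' c2' r' hr hu bH c1H c2H.
rewrite expr2 -mulrA.
have hsum : a' + b' + c1' + c2' + r' + h * w <= a' + H + l1 * g + l2 * g + e / 2 + e / 2.
  by rewrite !lerD.
have := ler_wpM2l (ltW h0) hsum; rewrite -subr_ge0 => hs; rewrite -subr_ge0.
by apply: (le_trans hs); rewrite le_eqVlt; apply/orP; left; apply/eqP; field.
Qed.

Section Stability.
Context d (Z : measurableType d) {R : realType} {n : nat}.
Variables (T M Lh LV : R) (gamma : probability Z R) (W What V : 'rV[R]_n -> R)
  (mu muh : R -> probability 'rV[R]_n R) (p q : R -> Z -> 'rV[R]_n).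
Hypotheses (gW : lipschitz_gradient M W) (gWh : lipschitz_gradient M What)
  (gV : lipschitz_gradient M V)
  (lWh : forall x y, sqnorm (grad What x - grad What y) <= Lh ^+ 2 * sqnorm (x - y))
  (lV : forall x y, sqnorm (grad V x - grad V y) <= LV ^+ 2 * sqnorm (x - y))
  (umu : uniform_curve mu) (umuh : uniform_curve muh).
(** A process on the probability space (Z, gamma) with law nu_t that follows the drift. Two such
    processes on the same space realise a coupling at every time, without building its joint law. *)
Definition characteristics (W' : 'rV[R]_n -> R) (nu : R -> probability 'rV[R]_n R)
    (x : R -> Z -> 'rV[R]_n) :=
  [/\ forall t, 0 <= t <= T -> measurable_fun setT (x t),
      forall t, 0 <= t <= T -> forall A, measurable A -> nu t A = gamma (x t @^-1` A) &
      forall k : R, 0 < k -> exists2 e : R, 0 < e & forall (s t : R) z,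
        0 <= s -> s <= t -> t <= T -> t - s <= e ->
        `|x t z - x s z - (t - s) *: drift W' V nu s (x s z)| <= (t - s) * k].
Hypotheses (cp : characteristics W mu p) (cq : characteristics What muh q).

Let D t := (\int[gamma]_z (sqnorm (p t z - q t z)%R)%:E)%E.
Let A t x := grad_conv W (mu t) x - grad_conv What (mu t) x.
Let a t := \int[mu t]_x sqnorm (A t x).
Let K := 5 + 2 * Lh ^+ 2 + LV ^+ 2.
Hypothesis (D0oo : (D 0 < +oo)%E).

Let M0 : 0 <= M. Proof. by case: gW. Qed.

Let gammaoo : (gamma setT < +oo)%E.
Proof. exact: (fin_num_fun_lty (fin_num_measure gamma)). Qed.

Let measurable_distance t : 0 <= t <= T ->
  measurable_fun setT (fun z => (sqnorm (p t z - q t z))%:E).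
Proof.
move=> tT; have [mp _ _] := cp; have [mq _ _] := cq.
apply/measurable_EFinP.
apply: (@measurableT_comp _ _ _ _ ('rV[R]_n * 'rV[R]_n)%type _
  (fun z => sqnorm (z.1 - z.2)) _ (fun z => (p t z, q t z))).
  exact: measurable_sqnormB.
by apply/measurable_fun_pairP; split; [exact: mp|exact: mq].
Qed.

Let D_ge0 t : (0 <= D t)%E.
Proof. by apply: integral_ge0 => z _; rewrite lee_fin sqnorm_ge0. Qed.

(** Both convolutions are means over the common space (Z, gamma), so Jensen's inequality compares
    the gradients at p_s(z) and q_s(z) under a single integral. *)
Lemma grad_conv_diff_le s x : 0 <= s <= T ->
  ((sqnorm (grad_conv What (mu s) x - grad_conv What (muh s) x))%:E <=
   (Lh ^+ 2)%:E * D s)%E.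
Proof.
move=> sT; have [mp pE _] := cp; have [mq qE _] := cq; have [_ WM WL] := gWh.
have bg := bounded_measurable_grad_shift M0 WM WL x.
have bp i : bounded_measurable (fun z => grad What (x - p s z) 0 i).
  exact: (bounded_measurable_comp (mp s sT) (bg i)).
have bq i : bounded_measurable (fun z => grad What (x - q s z) 0 i).
  exact: (bounded_measurable_comp (mq s sT) (bg i)).
have -> : grad_conv What (mu s) x - grad_conv What (muh s) x =
    \row_i \int[gamma]_z (grad What (x - p s z) - grad What (x - q s z)) 0 i.
  apply/rowP => i; rewrite !mxE.
  rewrite (Rint_image (mp s sT) gammaoo (pE s sT) (bg i)).
  rewrite (Rint_image (mq s sT) gammaoo (qE s sT) (bg i)) -RintB//.
  by apply: eq_Rintegral => z _; rewrite !mxE.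
have bf i : bounded_measurable (fun z => (grad What (x - p s z) - grad What (x - q s z)) 0 i).
  by under eq_fun do rewrite !mxE; have := bounded_measurableB (bp i) (bq i);
    under eq_fun do rewrite !mxE.
apply: (le_trans (y := (\int[gamma]_z
    sqnorm (grad What (x - p s z) - grad What (x - q s z)))%:E)).
  by rewrite lee_fin; exact: sqnorm_Rint_le.
have bsf := bounded_measurable_sqnorm bf.
rewrite -Rint_EFin// -ge0_integralZl_EFin ?sqr_ge0//; last 2 first.
- by move=> z _; rewrite lee_fin sqnorm_ge0.
- exact: measurable_distance.
apply: ge0_le_integral => //.
- by move=> z _; rewrite lee_fin sqnorm_ge0.
- by apply/measurable_EFinP; case: bsf.
- by apply: measurable_funeM; exact: measurable_distance.
move=> z _; rewrite -EFinM lee_fin (le_trans (lWh _ _))// ler_wpM2l ?sqr_ge0//.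
have -> : x - p s z - (x - q s z) = - (p s z - q s z).
  by apply/rowP => i; rewrite !mxE; ring.
by rewrite /sqnorm; apply: ler_sum => i _; rewrite !mxE sqrrN.
Qed.

(** Jensen's inequality again: averaging translates of grad What does not increase its Euclidean
    Lipschitz constant. *)
Lemma grad_conv_lipschitz s x y :
  sqnorm (grad_conv What (muh s) x - grad_conv What (muh s) y) <= Lh ^+ 2 * sqnorm (x - y).
Proof.
have [_ WM WL] := gWh; have bg := bounded_measurable_grad_shift M0 WM WL.
have -> : grad_conv What (muh s) x - grad_conv What (muh s) y =
    \row_i \int[muh s]_z (grad What (x - z) - grad What (y - z)) 0 i.
  apply/rowP => i; rewrite !mxE -RintB//.
  by apply: eq_Rintegral => z _; rewrite !mxE.
have bf i : bounded_measurable (fun z : 'rV[R]_n => (grad What (x - z) - grad What (y - z)) 0 i).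
  by under eq_fun do rewrite !mxE; have := bounded_measurableB (bg x i) (bg y i);
    under eq_fun do rewrite !mxE.
apply: (le_trans (sqnorm_Rint_le (muh s) bf)).
apply: (le_trans (ler_norm _)); apply: le_norm_Rint_probability.
  exact: bounded_measurable_sqnorm.
move=> z; rewrite ger0_norm ?sqnorm_ge0// (le_trans (lWh _ _))//.
by rewrite opprB addrA subrK.
Qed.

Let vA : velocity_field (M + M) (M + M) A.
Proof.
have [_ WM WL] := gW; have [_ WhM WhL] := gWh.
apply: velocity_fieldD; first exact: velocity_field_grad_conv.
by apply: velocity_fieldN; exact: velocity_field_grad_conv.
Qed.

Let a_ge0 s : 0 <= a s.
Proof. by apply: Rintegral_ge0 => x _; exact: sqnorm_ge0. Qed.

Let a_image s : 0 <= s <= T ->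
  (\int[gamma]_z (sqnorm (A s (p s z)))%:E = (a s)%:E)%E.
Proof.
move=> sT; have [mp pE _] := cp.
have bA : bounded_measurable (fun x => sqnorm (A s x)).
  by apply: bounded_measurable_sqnorm => i; exact: (velocity_bounded_measurable vA).
have bAp : bounded_measurable (fun z => sqnorm (A s (p s z))).
  exact: (bounded_measurable_comp (mp s sT) bA).
by rewrite Rint_EFin// /a (Rint_image (mp s sT) gammaoo (pE s sT) bA).
Qed.

(** A pointwise one-step estimate is integrated over gamma, and the kernel error becomes a_s because
    p_s has law mu_s. *)
Lemma distance_step (e : R) : 0 < e -> exists2 dl : R, 0 < dl & forall (s t : R),
  0 <= s -> s < t -> t <= T -> t - s <= dl -> (D s < +oo)%E ->
  (D t <= ((1 + (t - s) * K) * fine (D s) + (t - s) * (a s + e))%:E)%E.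
Proof.
move=> e0; have [mp pE ip] := cp; have [mq qE iq] := cq.
have [_ vpB _ _] := velocity_field_drift gW gV umu.
have [_ vqB _ _] := velocity_field_drift gWh gV umuh.
have e2 := divr2_gt0 e0.
have [k [k0 k1 ke]] := exists_small (mulr_ge0 (ler0n R 4) (ler0n R n)) e2.
(* Each drift is at most 2 M, their difference at most 4 M, and the remainder at most 2 k <= 2. *)
have c0 : 0 <= n%:R * (4 * M + 2) ^+ 2 by rewrite mulr_ge0// sqr_ge0.
have [dl [dl0 dl1 dle]] := exists_small c0 e2.
have [d1 d10 d1P] := ip k k0; have [d2 d20 d2P] := iq k k0.
exists (Num.min dl (Num.min d1 d2)) => [|s t s0 st tT].
  by rewrite !lt_min dl0 d10.
rewrite !le_min => /and3P[td td1 td2] Dsoo.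
have sT : 0 <= s <= T by rewrite s0 (le_trans (ltW st)).
have tT' : 0 <= t <= T by rewrite tT (le_trans s0 (ltW st)).
set h := t - s in td td1 td2 *; have h0 : 0 < h by rewrite subr_gt0.
have Ds : D s = (fine (D s))%:E by rewrite fineK// ge0_fin_numE.
set Dr := fine (D s) in Ds *.
have Dr0 : 0 <= Dr by rewrite fine_ge0.
have pw z : sqnorm (p t z - q t z) <= (1 + h * (5 + Lh ^+ 2 + LV ^+ 2)) * sqnorm (p s z - q s z) +
    (h * sqnorm (A s (p s z)) + h * (Lh ^+ 2 * Dr + e)).
  (* This bound is already a mean over gamma and does not depend on z; integrating it gives the
     second Lh^2 of [K], next to the one from the change of point. *)
  have hb : sqnorm (grad_conv What (mu s) (p s z) - grad_conv What (muh s) (p s z)) <=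
      Lh ^+ 2 * Dr.
    by have := grad_conv_diff_le (p s z) sT; rewrite Ds -EFinM lee_fin.
  have := @sqnorm_step _ _ h k e (Lh ^+ 2) (LV ^+ 2) (Lh ^+ 2 * Dr) (4 * M)
    (p s z) (q s z) (p t z) (q t z) (drift W V mu s (p s z)) (drift What V muh s (q s z))
    (A s (p s z)) (grad_conv What (mu s) (p s z) - grad_conv What (muh s) (p s z))
    (grad_conv What (muh s) (p s z) - grad_conv What (muh s) (q s z))
    (grad V (p s z) - grad V (q s z)) h0 (ltW k0) k1 ke.
  apply.
  - by rewrite mulrC; exact: le_trans (ler_wpM2l c0 td) dle.
  - exact: d1P s t z s0 (ltW st) tT td1.
  - exact: d2P s t z s0 (ltW st) tT td2.
  - exact: drift_diff.
  - apply: (le_trans (ler_normB _ _)); apply: (le_trans (lerD (vpB _ _) (vqB _ _))).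
    by rewrite le_eqVlt; apply/orP; left; apply/eqP; ring.
  - exact: hb.
  - exact: grad_conv_lipschitz.
  - exact: lV.
have Kp : 0 <= 1 + h * (5 + Lh ^+ 2 + LV ^+ 2).
  by rewrite addr_ge0// mulr_ge0 ?(ltW h0)// !addr_ge0// sqr_ge0.
have bA : bounded_measurable (fun z => sqnorm (A s (p s z))).
  have bA : bounded_measurable (fun x => sqnorm (A s x)).
    by apply: bounded_measurable_sqnorm => i; exact: (velocity_bounded_measurable vA).
  exact: (bounded_measurable_comp (mp s sT) bA).
have ce : 0 <= h * (Lh ^+ 2 * Dr + e).
  by rewrite mulr_ge0 ?(ltW h0)// addr_ge0 ?(ltW e0)// mulr_ge0// sqr_ge0.
have md := measurable_distance sT.
have mA : measurable_fun setT (fun z => (sqnorm (A s (p s z)))%:E).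
  by apply/measurable_EFinP; case: bA.
apply: (@le_trans _ _ (\int[gamma]_z
    (((1 + h * (5 + Lh ^+ 2 + LV ^+ 2))%:E * (sqnorm (p s z - q s z))%:E) +
    (h%:E * (sqnorm (A s (p s z)))%:E + cst (h * (Lh ^+ 2 * Dr + e))%:E z)))%E).
  apply: ge0_le_integral => //.
  - by move=> z _; rewrite lee_fin sqnorm_ge0.
  - exact: measurable_distance.
  - apply: emeasurable_funD; first exact: measurable_funeM.
    by apply: emeasurable_funD => //; exact: measurable_funeM.
  - by move=> z _; rewrite -!EFinM -!EFinD lee_fin.
rewrite ge0_integralD//; last 4 first.
- by move=> z _; rewrite -EFinM lee_fin mulr_ge0// sqnorm_ge0.
- exact: measurable_funeM.
- by move=> z _; rewrite -EFinM -EFinD lee_fin addr_ge0// mulr_ge0 ?sqnorm_ge0// ltW.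
- by apply: emeasurable_funD => //; exact: measurable_funeM.
rewrite ge0_integralD//; last 2 first.
- by move=> z _; rewrite -EFinM lee_fin mulr_ge0 ?sqnorm_ge0// ltW.
- exact: measurable_funeM.
rewrite !ge0_integralZl_EFin//; last 3 first.
- by move=> z _; rewrite lee_fin sqnorm_ge0.
- exact: ltW.
- by move=> z _; rewrite lee_fin sqnorm_ge0.
rewrite a_image// -/(D s) Ds integral_cst//.
rewrite [X in (_ + (_ + _ * X))%E](_ : gamma setT = 1%E); last exact: probability_setT.
rewrite mule1 -!EFinM -!EFinD lee_fin le_eqVlt; apply/orP; left; apply/eqP.
by rewrite /K; ring.
Qed.

Lemma distance_gronwall t : 0 <= t -> t <= T ->
  (D t <= (expR (K * T))%:E *
     (D 0 + \int[lebesgue_measure]_(s in `[0%R, T]) (a s)%:E))%E.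
Proof.
move=> t0 tT; have T0 : 0 <= T by exact: le_trans tT.
have K0 : 0 <= K by rewrite /K; move: (sqr_ge0 Lh) (sqr_ge0 LV); lra.
have eKT : 1 <= expR (K * T) by rewrite -[leLHS]expR0 ler_expR mulr_ge0.
have eK0 : 0 <= expR (K * T) by exact: expR_ge0.
have S_ge0 : (0 <= \int[lebesgue_measure]_(s in `[0%R, T]) (a s)%:E)%E.
  by apply: integral_ge0 => s _; rewrite lee_fin.
(* Time 0 is separated so that the step t / N.+1 is positive below. *)
move: t0; rewrite le_eqVlt => /orP[/eqP <-|t0].
  apply: (@le_trans _ _ (D 0 + \int[lebesgue_measure]_(s in `[0%R, T]) (a s)%:E)%E).
    by rewrite leeDl.
  by apply: lee_pemull; [exact: adde_ge0|rewrite lee_fin].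
have ua := uniformly_cont_sqnorm umu vA.
have [_ AM _ _] := vA.
have aM s : `|a s| <= n%:R * (M + M) ^+ 2.
  apply: le_norm_Rint_probability.
    by apply: bounded_measurable_sqnorm => i; exact: (velocity_bounded_measurable vA).
  by move=> x; rewrite ger0_norm ?sqnorm_ge0// sqnorm_le_sqr.
have [ma _] := uniformly_cont_bounded_measurable ua aM.
have mT (D' : set (measurableTypeR R)) : measurable_fun D' (fun s => (a s)%:E).
  by apply: measurable_funTS; exact/measurable_EFinP.
have lT : lebesgue_measure `[0%R, T]%classic = T%:E.
  rewrite lebesgue_measure_itv /= lte_fin; case: ltP => h1; first by rewrite sube0.
  by congr EFin; apply/eqP; rewrite eq_le T0 h1.
have icst (c : R) : (\int[lebesgue_measure]_(s in `[0%R, T]) (cst c%:E s) = (c * T)%:E)%E.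
  have -> := @integral_cst _ _ R lebesgue_measure _ (measurable_itv `[0%R, T]) c%:E.
  by rewrite [X in (_ * X)%E]lT -EFinM.
have Soo : (\int[lebesgue_measure]_(s in `[0%R, T]) (a s)%:E < +oo)%E.
  apply: (@le_lt_trans _ _ (\int[lebesgue_measure]_(s in `[0%R, T])
    (cst (n%:R * (M + M) ^+ 2)%:E s))%E); last by rewrite icst ltry.
  apply: ge0_le_integral => //.
  - by move=> s _; rewrite lee_fin.
  - by move=> s _; rewrite lee_fin (le_trans (ler_norm _)).
have [S SE] : exists S : R, (\int[lebesgue_measure]_(s in `[0%R, T]) (a s)%:E = S%:E)%E.
  by exists (fine (\int[lebesgue_measure]_(s in `[0%R, T]) (a s)%:E)%E);
    rewrite fineK// ge0_fin_numE.
rewrite SE.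
have D0E : D 0 = (fine (D 0))%:E by rewrite fineK// ge0_fin_numE.
rewrite D0E -EFinD -EFinM; apply/lee_addgt0Pr => e e0; rewrite -EFinD.
(* The margin 2 T eta consists of T eta from the one-step errors and T eta from replacing the
   Riemann sum by the integral. *)
have [eta [eta0 _ etae]] := exists_small (mulr_ge0 eK0 (mulr_ge0 (ler0n R 2) T0)) e0.
have [dl dl0 dlP] := distance_step eta0; have [d' d'0 d'P] := ua _ eta0.
have m0 : 0 < Num.min dl (d' / 2) by rewrite lt_min dl0 divr_gt0.
have [c [c0 _ cT]] := exists_small T0 m0.
have [N NP] := natSinv_small c0.
pose h := t / N.+1%:R; have h0 : 0 < h by rewrite divr_gt0.
have hm : h <= Num.min dl (d' / 2).
  by apply: le_trans cT; apply: ler_pM => //; [exact: ltW|exact: NP].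
have hdl : h <= dl by apply: (le_trans hm); rewrite ge_min lexx.
have hd' : h < d'.
  apply: (le_lt_trans hm); rewrite gt_min; apply/orP; right.
  by rewrite ltr_pdivrMr// ltr_pMr// ltr1n.
have Nh : N.+1%:R * h = t by rewrite mulrC divfK// pnatr_eq0.
have st k : (k < N.+1)%N -> (D (k%:R * h) < +oo)%E ->
    (D (k.+1%:R * h) <= ((1 + h * K) * fine (D (k%:R * h)) + h * (a (k%:R * h) + eta))%:E)%E.
  move=> kN Dk.
  have k0 : 0 <= k%:R * h by rewrite mulr_ge0// ltW.
  have kS : k%:R * h < k.+1%:R * h by rewrite ltr_pM2r// ltr_nat.
  have kT : k.+1%:R * h <= T by apply: le_trans tT; rewrite -Nh ler_pM2r// ler_nat.
  have := dlP _ _ k0 kS kT; rewrite -mulrBl -natrB// subSnn mul1r; exact.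
(* Finiteness at the initial time propagates along the grid by the one-step bound itself, after
   which the recursion can be read in the reals. *)
have fin k : (k <= N.+1)%N -> (D (k%:R * h) < +oo)%E.
  elim: k => [|k IH] kN; first by rewrite mul0r.
  by apply: (le_lt_trans (st k kN (IH (ltnW kN)))); rewrite ltry.
have := @discrete_gronwall_sum R (fun k => fine (D (k%:R * h)))
  (fun k => h * (a (k%:R * h) + eta)) (h * K) N.+1.
rewrite /= mul0r => G.
have {}G : fine (D t) <= expR (K * t) * (fine (D 0) + \sum_(i < N.+1) h * (a (i%:R * h) + eta)).
  rewrite -Nh (_ : K * (N.+1%:R * h) = h * K * N.+1%:R); last by ring.
  apply: G => //.
  - by move=> k; rewrite mulr_ge0 ?(ltW h0)// addr_ge0// ltW.
  - by rewrite mulr_ge0// ltW.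
  - by rewrite fine_ge0.
  - move=> k kN; have := st k kN (fin k (ltnW kN)).
    by rewrite -[X in (X <= _)%E -> _]fineK ?ge0_fin_numE ?fin// lee_fin.
have Dt : D t = (fine (D t))%:E by rewrite fineK// ge0_fin_numE// -Nh fin.
rewrite Dt lee_fin.
have riem : \sum_(i < N.+1) h * a (i%:R * h) <= S + eta * T.
  rewrite -lee_fin EFinD -SE -icst -ge0_integralD//; last 2 first.
  - by move=> s _; rewrite lee_fin.
  - by move=> s _; rewrite lee_fin ltW.
  apply: (@le_trans _ _
      (\int[lebesgue_measure]_(s in `[0%R, (N.+1%:R * h)%R[) (a s + eta)%:E)%E).
    apply: riemann_sum_le => //; [exact: ltW|exact: ltW|move=> s r s0 sr rh].
    have : `|s - r| < d' by rewrite distrC ger0_norm ?subr_ge0// (lt_trans rh).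
    by move=> /d'P; rewrite ler_norml => /andP[_]; rewrite lerBlDl.
  rewrite Nh; apply: ge0_subset_integral => //.
  - by apply: measurable_funTS; apply/measurable_EFinP; exact: measurable_funD.
  - by move=> s _; rewrite lee_fin addr_ge0// ltW.
  - by move=> s /=; rewrite !in_itv /= => /andP[-> /ltW st']; exact: le_trans tT.
have sumE : \sum_(i < N.+1) h * (a (i%:R * h) + eta) =
    \sum_(i < N.+1) h * a (i%:R * h) + t * eta.
  under eq_bigr do rewrite mulrDr.
  by rewrite big_split /= sumr_const card_ord -mulr_natl mulrA Nh.
apply: (le_trans G).
apply: (@le_trans _ _ (expR (K * T) * (fine (D 0) + (S + 2 * T * eta)))); last first.
  by rewrite addrA mulrDr lerD2l mulrA.
apply: ler_pM; rewrite ?expR_ge0//.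
- by rewrite addr_ge0 ?fine_ge0// sumr_ge0// => i _; rewrite mulr_ge0 ?addr_ge0// ltW.
- by rewrite ler_expR ler_wpM2l.
rewrite lerD2l sumE; have : t * eta <= T * eta by rewrite ler_pM2r.
by move: riem; lra.
Qed.

End Stability.

(** * From a fixed initial coupling to the Wasserstein distance *)

Lemma lipschitz_gradient_le (R : realType) n (M M' : R) (f : 'rV[R]_n -> R) : M <= M' ->
  lipschitz_gradient M f -> lipschitz_gradient M' f.
Proof.
move=> MM' [M0 fM fL]; split=> [|x|x y]; first exact: le_trans MM'.
  exact: le_trans (fM x) MM'.
by rewrite (le_trans (fL x y))// ler_wpM2r.
Qed.

Lemma exists_distribution d d' (Z : measurableType d) (Z' : measurableType d') (R : realType)
    (P : probability Z R) (f : Z -> Z') : measurable_fun setT f ->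
  exists Q : probability Z' R, forall A, Q A = P (f @^-1` A).
Proof.
move=> mf; pose X : {mfun Z >-> Z'} := HB.pack f (isMeasurableFun.Build _ _ _ _ f mf).
by exists (distribution P X).
Qed.

(** The joint law of [f] and [g] is a competitor in the infimum. *)
Lemma wasserstein2_le_distance (R : realType) n d (Z : measurableType d) (P : probability Z R)
    (mu xi : probability 'rV[R]_n R) (f g : Z -> 'rV[R]_n) :
  measurable_fun setT f -> measurable_fun setT g ->
  (forall A, measurable A -> mu A = P (f @^-1` A)) ->
  (forall A, measurable A -> xi A = P (g @^-1` A)) ->
  (wasserstein2 mu xi ^+ 2 <= \int[P]_z (sqnorm (f z - g z)%R)%:E)%E.
Proof.
move=> mf mg muE xiE; have mfg : measurable_fun setT (fun z => (f z, g z)).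
  exact/measurable_fun_pairP.
have [Q QE] := exists_distribution P mfg.
rewrite wasserstein2_sqr; apply: ereal_inf_lbound; exists Q => /=.
  move=> A mA; rewrite !QE muE// xiE//.
  by split; congr (P _); apply/seteqP; split=> z //= [].
rewrite (ge0_integral_image (h := fun z => (f z, g z)) mfg (m := P))//.
- by move=> A _; exact: QE.
- by apply/measurable_EFinP; exact: measurable_sqnormB.
- by move=> z; rewrite lee_fin sqnorm_ge0.
Qed.

Lemma weak_solution_continuity (R : realType) n (T : R) (W V : 'rV[R]_n -> R) mu0
    (mu : R -> probability 'rV[R]_n R) : weak_solution T W V mu0 mu ->
  weak_continuity T (fun t => mu (clamp T t)) (drift W V (fun t => mu (clamp T t))).
Proof.
move=> [_ ws] phi tphi sphi; rewrite -[RHS](ws phi tphi sphi).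
apply: eq_Rintegral => t; rewrite inE /= => /clamp_id tT.
rewrite /drift tT; apply: eq_Rintegral => x _; congr (_ + _).
by rewrite -sumrN; apply: eq_bigr => i _; rewrite -mulrN mxE.
Qed.

Lemma flow_characteristics (R : realType) n (T B L : R) (W V : 'rV[R]_n -> R)
    (mu : R -> probability 'rV[R]_n R) X d (Z : measurableType d) (P : probability Z R)
    (f : Z -> 'rV[R]_n) :
  uniform_curve mu -> velocity_field B L (drift W V mu) ->
  weak_continuity T mu (drift W V mu) -> is_flow L (drift W V mu) T X ->
  measurable_fun setT f -> (forall A, measurable A -> mu 0 A = P (f @^-1` A)) ->
  characteristics T P V W mu (fun t z => X t (f z)).
Proof.
move=> umu vv wc XP mf fE; have [_ XL Xi] := XP.
have mX t : 0 <= t <= T -> measurable_fun setT (X t).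
  by move=> /andP[t0 tT]; apply: lipschitz_measurable_rV => x y; exact: XL.
split=> [t tT|t tT A mA|k k0].
- exact: measurableT_comp (mX t tT) mf.
- have /andP[t0 tT'] := tT; rewrite (transport_flow umu vv wc XP t0 tT' mA) fE//.
  by rewrite -[X in measurable X]setTI; exact: mX.
- have [e e0 eP] := Xi k k0; exists e => // s t z s0 st tT ts.
  exact: eP.
Qed.

(** Only couplings of finite cost have to be treated: if the infimum is infinite, c > 0 makes the
    right-hand side infinite. *)
Lemma le_addl_ereal_inf (R : realType) (S : set (\bar R)) (x y : \bar R) (c : R) :
  (0 <= y)%E -> 0 < c -> (forall z, S z -> (0 <= z)%E) ->
  (forall z, S z -> (z < +oo)%E -> (x <= y + c%:E * z)%E) ->
  (x <= y + c%:E * ereal_inf S)%E.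
Proof.
move=> y0 c0 S0 H; have i0 : (0 <= ereal_inf S)%E by exact/ereal_infP.
have [ioo|] := eqVneq (ereal_inf S) +oo%E.
  rewrite ioo gt0_muley ?lte_fin// addey ?leey//.
  by apply/eqP => yE; rewrite yE in y0.
rewrite -ltey -ge0_fin_numE// => ifin; apply/lee_addgt0Pr => e e0.
have [z Sz zi] := lb_ereal_inf_adherent (divr_gt0 e0 c0) ifin.
have zoo : (z < +oo)%E.
  by apply: (lt_trans zi); rewrite -(fineK ifin) -EFinD ltry.
apply: (le_trans (H z Sz zoo)); rewrite -addeA leeD2l//.
apply: (@le_trans _ _ (c%:E * (ereal_inf S + (e / c)%:E))%E).
  by apply: lee_wpmul2l; [rewrite lee_fin ltW|exact: ltW].
rewrite muleDr ?fin_num_adde_defl// -EFinM.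
by rewrite (_ : c * (e / c) = e)// mulrC divfK// gt_eqF.
Qed.

Theorem proposition3p1 (R : realType) :
  exists C1 C2 : R -> R -> R -> R -> R,
    (forall T LW LWhat LV : R, 0 <= C1 T LW LWhat LV /\ 0 <= C2 T LW LWhat LV) /\
    forall (d : nat) (T : R) (Omega : set 'rV[R]_d) (W What V : 'rV[R]_d -> R)
      (mu0 muhat0 : probability 'rV[R]_d R)
      (mu muhat : R -> probability 'rV[R]_d R),
    0 < T ->
    compact Omega ->
    sobolev2oo W -> sobolev2oo What -> sobolev2oo V ->
    supp W `<=` Omega -> supp V `<=` Omega ->
    finite_second_moment mu0 -> finite_second_moment muhat0 ->
    P2_curve T mu -> P2_curve T muhat ->
    weak_solution T W V mu0 mu -> weak_solution T What V muhat0 muhat ->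
    forall t : R, t \in `[0, T] ->
    let LW := lipschitz_constant (grad W) in
    let LWhat := lipschitz_constant (grad What) in
    let LV := lipschitz_constant (grad V) in
    (wasserstein2 (mu t) (muhat t) ^+ 2 <=
       (C1 T LW LWhat LV)%:E * error_functional T W mu What +
       (C2 T LW LWhat LV)%:E * wasserstein2 mu0 muhat0 ^+ 2)%E.
Proof.
pose K (l1 l2 : R) := 5 + 2 * l1 ^+ 2 + l2 ^+ 2.
(* The factor T undoes the 1 / T of the error functional; the absolute value gives nonnegativity for
   every real T. *)
exists (fun T _ LWhat LV => `|T| * expR (K LWhat LV * `|T|)).
exists (fun T _ LWhat LV => expR (K LWhat LV * `|T|)).
split=> [T LW LWhat LV|]; first by rewrite mulr_ge0 ?expR_ge0.
move=> d T Omega W What V mu0 muhat0 mu muhat T0 _ sW sWh sV _ _ _ _ Pmu Pmuh wmu wmuh t.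
move=> tT; cbv zeta.
set LWh := lipschitz_constant (grad What); set LV := lipschitz_constant (grad V).
have [M1 M10 [W1 W2]] := sobolev2oo_gradient sW.
have [M2 M20 [Wh1 Wh2]] := sobolev2oo_gradient sWh.
have [M3 M30 [V1 V2]] := sobolev2oo_gradient sV.
(* One sup-norm bound common to the three gradients, for the flows and the vanishing remainders; the
   constants of the estimate come from [lWh] and [lV]. *)
pose M := M1 + M2 + M3.
have gW : lipschitz_gradient M W.
  by apply: (@lipschitz_gradient_le _ _ M1) => //; rewrite /M -addrA lerDl addr_ge0.
have gWh : lipschitz_gradient M What.
  by apply: (@lipschitz_gradient_le _ _ M2) => //; rewrite /M addrAC lerDr addr_ge0.
have gV : lipschitz_gradient M V.
  by apply: (@lipschitz_gradient_le _ _ M3) => //; rewrite /M lerDr addr_ge0.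
have lWh := lipschitz_constantP M20 Wh2; have lV := lipschitz_constantP M30 V2.
rewrite -/LWh -/LV in lWh lV.
have umu := P2_curve_uniform (ltW T0) Pmu; have umuh := P2_curve_uniform (ltW T0) Pmuh.
pose m s := mu (clamp T s); pose mh s := muhat (clamp T s).
have v := velocity_field_drift gW gV umu; have vh := velocity_field_drift gWh gV umuh.
have [X XP] := exists_flow v T0; have [Xh XhP] := exists_flow vh T0.
have [t0 tT'] : 0 <= t /\ t <= T by move: tT; rewrite in_itv => /andP.
have z0 : (0 : R) \in `[0, T] by rewrite in_itv /= lexx ltW.
have mt : m t = mu t by rewrite /m clamp_id.
have mht : mh t = muhat t by rewrite /mh clamp_id.
rewrite [X in (_ + _ * X)%E]wasserstein2_sqr (ger0_norm (ltW T0)).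
set E := error_functional _ _ _ _; set C2 := expR _.
have bs s : bounded_measurable
    (fun x => sqnorm (grad_conv W (m s) x - grad_conv What (m s) x)).
  apply: bounded_measurable_sqnorm => i; have [M0 W1' W2'] := gW; have [_ Wh1' Wh2'] := gWh.
  exact: (velocity_bounded_measurable (velocity_fieldD
    (velocity_field_grad_conv M0 W1' W2' umu)
    (velocity_fieldN (velocity_field_grad_conv M0 Wh1' Wh2' umu)))).
have TE : ((T * C2)%:E * E)%E = (C2%:E * \int[lebesgue_measure]_(s in `[0%R, T])
   (\int[m s]_x sqnorm (grad_conv W (m s) x - grad_conv What (m s) x))%:E)%E.
  rewrite /E /error_functional muleA -EFinM mulrAC divff ?gt_eqF// mul1r; congr (_ * _)%E.
  apply: eq_integral => s; rewrite inE /= => /clamp_id sT.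
  by rewrite -(Rint_EFin _ (bs s)) /m sT.
rewrite TE; apply: le_addl_ereal_inf.
- apply: mule_ge0; first by rewrite lee_fin expR_ge0.
  apply: integral_ge0 => s _; rewrite lee_fin; apply: Rintegral_ge0 => x _; exact: sqnorm_ge0.
- exact: expR_gt0.
- by move=> _ [gamma _ <-]; apply: integral_ge0 => z _; rewrite lee_fin sqnorm_ge0.
(* The coupling itself is the probability space: the characteristics are the two flows started from
   its first and second projections. *)
move=> _ [gamma cg <-] goo.
have p0 A : measurable A -> m 0 A = gamma (fst @^-1` A).
  move=> mA; rewrite /m clamp_id//; have [/(_ A mA) -> _] := wmu; have [<- _] := cg A mA.
  by congr (gamma _); apply/seteqP; split=> z //= [].
have q0 A : measurable A -> mh 0 A = gamma (snd @^-1` A).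
  move=> mA; rewrite /mh clamp_id//; have [/(_ A mA) -> _] := wmuh; have [_ <-] := cg A mA.
  by congr (gamma _); apply/seteqP; split=> z //= [].
have cX := flow_characteristics umu v (weak_solution_continuity wmu) XP measurable_fst p0.
have cXh := flow_characteristics umuh vh (weak_solution_continuity wmuh) XhP measurable_snd q0.
have [X0 _ _] := XP; have [Xh0 _ _] := XhP.
have E0 : (\int[gamma]_z (sqnorm (X 0 z.1 - Xh 0 z.2))%:E =
    \int[gamma]_z (sqnorm (z.1 - z.2))%:E)%E.
  by apply: eq_integral => z _; rewrite X0 Xh0.
have := distance_gronwall gW gWh gV lWh lV umu umuh cX cXh.
rewrite E0 => /(_ goo t t0 tT') H.
have [mp pE _] := cX; have [mq qE _] := cXh.
have tT2 : 0 <= t <= T by rewrite t0.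
have := wasserstein2_le_distance (mp t tT2) (mq t tT2) (pE t tT2) (qE t tT2).
rewrite -/(m t) -/(mh t) mt mht => /le_trans; apply; apply: (le_trans H).
rewrite ge0_muleDr.
- by rewrite addeC.
- by apply: integral_ge0 => z _; rewrite lee_fin sqnorm_ge0.
- apply: integral_ge0 => s _; rewrite lee_fin; apply: Rintegral_ge0 => x _; exact: sqnorm_ge0.
Qed.
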